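(* Let the objectives satisfy (F), the noise satisfy (N), and the coupling matrix satisfy (W), as described in the context, and let $\alpha>0$, $\gamma>0$, $p\ge0$, $q\ge0$. There exists some $m>0$ such that, under $\gamma_k=\gamma/(m+k)^p$ and $\beta_k=1/(m+k)^q$, the errors of the algorithm in the context satisfy the following, where each $\mathcal{O}(1)$ denotes some constant independent of $k$: 1) $$\mathbb{E}[\|\bar x_k-x^\ast\|_2^2]\le\frac{\mathcal{O}(1)}{(m+k)^{2q}},\quad \mathbb{E}[\|\boldsymbol{x}_k-\boldsymbol{1}\bar x_k\|_2^2]\le\frac{\mathcal{O}(1)}{(m+k)^{2q}},\quad \mathbb{E}[\|\boldsymbol{y}_k-\boldsymbol{1}\bar y_k\|_2^2]\le\frac{\mathcal{O}(1)}{(m+k)^{2q}},$$ if $p=0$ (i.e., $\gamma_k=\gamma$), $q>0$, and $\alpha$ and $\gamma$ satisfy $$\alpha\gamma<\min\left\{\frac{2}{\mu+L},\ \frac{1-\rho_w^2}{4\sqrt2\,L d_I},\ \sqrt{\frac{2}{c_{42}+\sqrt{c_{42}^2+4c_{41}}}}\right\},$$ with $$c_{41}=\frac{64(1+\rho_w^2)(3\mu+L)L^6d_I^2}{(1-\rho_w^2)^4(\mu+L)},\qquad c_{42}=\frac{64(1+\rho_w^2)(\mu+L+2L^2)L^2d_I^2}{(1-\rho_w^2)^4(\mu+L)};$$ 2) $$\mathbb{E}[\|\bar x_k-x^\ast\|_2^2]\le\frac{\mathcal{O}(1)}{(m+k)^{\min\{2q-p,2p\}}},\quad \mathbb{E}[\|\boldsymbol{x}_k-\boldsymbol{1}\bar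 x_k\|_2^2]\le\frac{\mathcal{O}(1)}{(m+k)^{2\min\{q,p\}}},\quad \mathbb{E}[\|\boldsymbol{y}_k-\boldsymbol{1}\bar y_k\|_2^2]\le\frac{\mathcal{O}(1)}{(m+k)^{2\min\{q,p\}}},$$ if $0<p\le1$ and $q>p$, and $\alpha$ and $\gamma$ satisfy $\alpha\gamma>\frac{\min\{2q-p,\,2p\}}{\mu}$; 3) $$\mathbb{E}[\|\bar x_k-x^\ast\|_2^2]\le\mathcal{O}(1)+\frac{\mathcal{O}(1)}{(m+k)^{p}},\quad \mathbb{E}[\|\boldsymbol{x}_k-\boldsymbol{1}\bar x_k\|_2^2]\le\frac{\mathcal{O}(1)}{(m+k)^{2\min\{q,p\}}},\quad \mathbb{E}[\|\boldsymbol{y}_k-\boldsymbol{1}\bar y_k\|_2^2]\le\frac{\mathcal{O}(1)}{(m+k)^{2\min\{q,p\}}},$$ if $p>1$ and $q\ge\frac p2$.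
   Context: Setting: $n$ agents, agent $i$ holding a differentiable local objective $f_i:\mathbb{R}^r\to\mathbb{R}$; the goal is to minimize $f=\frac1n\sum_{i=1}^n f_i$. (F) Each $f_i$ is $\mu$-strongly convex with $L$-Lipschitz continuous gradient: for all $x,x'\in\mathbb{R}^r$, $\langle\nabla f_i(x)-\nabla f_i(x'),x-x'\rangle\ge\mu\|x-x'\|^2$ and $\|\nabla f_i(x)-\nabla f_i(x')\|\le L\|x-x'\|$. Then $f$ has a unique minimizer $x^\ast\in\mathbb{R}^r$. (W) $W=[w_{ij}]\in\mathbb{R}^{n\times n}$ is entrywise nonnegative, doubly stochastic and symmetric, $w_{ii}>0$ for all $i$, and the undirected graph on $\{1,\dots,n\}$ with an edge between $i$ and $j$ whenever $w_{ij}>0$ is connected. $W_o$ is $W$ with all diagonal entries replaced by $0$. (N) The elements of the random sequences $\{\boldsymbol\eta_k\}$ and $\{\boldsymbol\xi_k\}$ in $\mathbb{R}^{n\times r}$ are independent along iterations $k$, across agents $i$ (rows), and across state dimensions $j$ (columns), with $\mathbb{E}[\boldsymbol\eta_k]=\mathbb{E}[\boldsymbol\xi_k]=\boldsymbol 0$, $\mathbb{E}[\|\boldsymbol\eta_k\|^2]\le\sigma_\eta^2$ and $\mathbb{E}[\|\boldsymbol\xi_k\|^2]\le\sigma_\xi^2$ for some $\sigma_\eta,\sigma_\xi>0$. Algorithm: from arbitrary initial states $\boldsymbol{s}_0,\boldsymbol{x}_0\in\mathbb{R}^{n\times r}$ (row $i$ belongs to agent $i$), for $k\ge0$, $$\boldsymbol{s}_{k+1}=W\boldsymbol{s}_k+\beta_kW_o\boldsymbol\eta_k+\gamma_k\nabla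 F(\boldsymbol{x}_k),\qquad \boldsymbol{x}_{k+1}=W\boldsymbol{x}_k+\beta_kW_o\boldsymbol\xi_k-\alpha(\boldsymbol{s}_{k+1}-\boldsymbol{s}_k),$$ where $\nabla F(\boldsymbol{x})\in\mathbb{R}^{n\times r}$ has $i$-th row $\nabla f_i(x_i)^T$, with $x_i^T$ the $i$-th row of $\boldsymbol{x}$. Notation: $\boldsymbol{y}_k=\boldsymbol{s}_{k+1}-\boldsymbol{s}_k$; $\boldsymbol{1}\in\mathbb{R}^n$ is the all-ones vector; $\bar x_k=\frac1n\boldsymbol{1}^T\boldsymbol{x}_k$, $\bar y_k=\frac1n\boldsymbol{1}^T\boldsymbol{y}_k$ (row vectors; $x^\ast$ is identified with a row vector when needed). For matrices, $\|\cdot\|_2$ denotes the Euclidean norm of the vector of columnwise Euclidean norms. $d_I^2=\|I-\frac{\boldsymbol{1}\boldsymbol{1}^T}{n}\|_2^2$, $d_I\ge0$; $\rho_w=\rho(W-\frac{\boldsymbol{1}\boldsymbol{1}^T}{n})$ with $\rho(\cdot)$ the spectral radius; under (W), $\rho_w<1$. *)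

(* Defs.v *)
From HB Require Import structures.
From mathcomp Require Import all_boot all_order all_algebra.
From mathcomp Require Import complex.
From mathcomp Require Import all_classical all_reals all_analysis.

Set Implicit Arguments.
Unset Strict Implicit.
Unset Printing Implicit Defensive.

Import Order.TTheory GRing.Theory Num.Theory.
Import numFieldNormedType.Exports.

Local Open Scope classical_set_scope.
Local Open Scope ring_scope.

Section MatrixNotions.
Context {R : realType}.

Definition ones (n : nat) : 'cV[R]_n := const_mx 1.

Definition averaging (n : nat) : 'M[R]_n := n%:R^-1 *: (ones n *m (ones n)^T).

Definition row_mean (n r : nat) (A : 'M[R]_(n, r)) : 'rV[R]_r :=
  n%:R^-1 *: ((ones n)^T *m A).

Definition colnorm (n r : nat) (A : 'M[R]_(n, r)) (j : 'I_r) : R :=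
  Num.sqrt (\sum_(i < n) A i j ^+ 2).

(* The Euclidean norm of the vector of columnwise Euclidean norms; the norm
   that the library puts on matrices is the max norm. On row vectors this is
   the Euclidean norm. *)
Definition norm2 (n r : nat) (A : 'M[R]_(n, r)) : R :=
  Num.sqrt (\sum_(j < r) colnorm A j ^+ 2).

Definition inner (r : nat) (u v : 'rV[R]_r) : R := \sum_(j < r) u 0 j * v 0 j.

Definition spectral_radius (n : nat) (A : 'M[R]_n) : R :=
  sup [set ComplexField.Normc.normc z | z in [set z : R[i] |
        eigenvalue (map_mx (real_complex R) A) z]].

Definition offdiag (n : nat) (W : 'M[R]_n) : 'M[R]_n :=
  \matrix_(i, j) (if i == j then 0 else W i j).

Definition coupling_matrix (n : nat) (W : 'M[R]_n) : Prop :=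
  [/\ forall i j, 0 <= W i j,
      W *m ones n = ones n /\ (ones n)^T *m W = (ones n)^T,
      W^T = W,
      forall i, 0 < W i i &
      forall i j, connect (fun k l => 0 < W k l) i j].

End MatrixNotions.

Section Objectives.
Context {R : realType}.

Definition grad (r : nat) (f : 'rV[R]_r -> R) (x : 'rV[R]_r) : 'rV[R]_r :=
  \row_(j < r) 'D_(delta_mx 0 j) f x.

Definition objective_class (r : nat) (mu L : R) (f : 'rV[R]_r -> R) : Prop :=
  [/\ forall x, differentiable f x,
      forall x x', mu * norm2 (x - x') ^+ 2
                   <= inner (grad f x - grad f x') (x - x') &
      forall x x', norm2 (grad f x - grad f x') <= L * norm2 (x - x')].

Definition global_objective (n r : nat) (f : 'I_n -> 'rV[R]_r -> R)
    (x : 'rV[R]_r) : R :=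
  n%:R^-1 * \sum_(i < n) f i x.

Definition stacked_grad (n r : nat) (f : 'I_n -> 'rV[R]_r -> R)
    (x : 'M[R]_(n, r)) : 'M[R]_(n, r) :=
  \matrix_(i < n) grad (f i) (row i x).

End Objectives.

Section Noise.
Context {d : measure_display} {Omega : measurableType d} {R : realType}.
Variable P : probability Omega R.

Definition mutually_independent (I : choiceType) (d' : measure_display)
    (T : measurableType d') (X : I -> Omega -> T) : Prop :=
  forall (s : seq I) (B : I -> set T), uniq s ->
    (forall i, measurable (B i)) ->
    P (\bigcap_(i in [set` s]) X i @^-1` B i)
    = (\prod_(i <- s) P (X i @^-1` B i))%E.

Definition noise_mx (n r : nat) (eta : nat -> 'I_n -> 'I_r -> {RV P >-> R})
    (k : nat) (w : Omega) : 'M[R]_(n, r) :=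
  \matrix_(i, j) eta k i j w.

Definition centered_bounded (n r : nat)
    (eta : nat -> 'I_n -> 'I_r -> {RV P >-> R}) (sigma : R) : Prop :=
  forall k, (forall i j, ('E_P[eta k i j] = 0)%E) /\
    ('E_P[fun w => (norm2 (noise_mx eta k w) ^+ 2)%R] <= (sigma ^+ 2)%:E)%E.

(* Independence is over the index (iteration, agent, coordinate). The two
   noises carried by the same index enter as one R^2-valued variable, so no
   independence between them is required. *)
Definition noise_class (n r : nat)
    (eta xi : nat -> 'I_n -> 'I_r -> {RV P >-> R}) (sigma_eta sigma_xi : R)
    : Prop :=
  [/\ mutually_independent
        (fun (l : nat * 'I_n * 'I_r) w =>
           (eta l.1.1 l.1.2 l.2 w, xi l.1.1 l.1.2 l.2 w)),
      centered_bounded eta sigma_eta &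
      centered_bounded xi sigma_xi].

End Noise.

Section Algorithm.
Context {R : realType}.
Variables (n r : nat) (f : 'I_n -> 'rV[R]_r -> R) (W : 'M[R]_n).
Variables (alpha : R) (beta gamma : nat -> R).
Variables (s0 x0 : 'M[R]_(n, r)) (eta xi : nat -> 'M[R]_(n, r)).

Fixpoint iterate (k : nat) : 'M[R]_(n, r) * 'M[R]_(n, r) :=
  if k is k'.+1 then
    let: (s, x) := iterate k' in
    let s' := W *m s + beta k' *: (offdiag W *m eta k')
              + gamma k' *: stacked_grad f x in
    (s', W *m x + beta k' *: (offdiag W *m xi k') - alpha *: (s' - s))
  else (s0, x0).

Definition s_iter (k : nat) : 'M[R]_(n, r) := (iterate k).1.
Definition x_iter (k : nat) : 'M[R]_(n, r) := (iterate k).2.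
Definition y_iter (k : nat) : 'M[R]_(n, r) := s_iter k.+1 - s_iter k.

End Algorithm.

Definition consensus_error {R : realType} (n r : nat) (A : 'M[R]_(n, r)) : R :=
  norm2 (A - ones n *m row_mean A).

Section Constants.
Context {R : realType}.
Variables (n : nat) (W : 'M[R]_n) (mu L : R).

Definition rho_w : R := spectral_radius (W - averaging n).
Definition d_I : R := norm2 (1%:M - averaging n : 'M[R]_n).

Definition c41 : R :=
  (64 * (1 + rho_w ^+ 2) * (3 * mu + L) * L ^+ 6 * d_I ^+ 2)
  / ((1 - rho_w ^+ 2) ^+ 4 * (mu + L)).

Definition c42 : R :=
  (64 * (1 + rho_w ^+ 2) * (mu + L + 2 * L ^+ 2) * L ^+ 2 * d_I ^+ 2)
  / ((1 - rho_w ^+ 2) ^+ 4 * (mu + L)).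

(* The quotients are taken in the extended reals, where a / 0 = +oo for a > 0:
   for a single agent d_I = c41 = c42 = 0 and only the first bound remains. *)
Definition stepsize_bound : \bar R :=
  mine (2%:E / (mu + L)%:E)%E
    (mine ((1 - rho_w ^+ 2)%:E / (4 * Num.sqrt 2 * L * d_I)%:E)%E
       (sqrte (2%:E / (c42 + Num.sqrt (c42 ^+ 2 + 4 * c41))%:E)%E)).

End Constants.

(* Main.v *)
Require Import Defs.
From HB Require Import structures.
From mathcomp Require Import all_boot all_order all_algebra.
From mathcomp Require Import complex ring lra.
From mathcomp Require Import all_classical all_reals all_analysis.
From mathcomp Require Import measurable_realfun.
Import Order.TTheory GRing.Theory Num.Theory.
Import numFieldNormedType.Exports.
Local Open Scope ring_scope.

(** Let [z] be the matrix with rows [x_i - x*], [J] the averaging projector,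
    [Q = 1 - J], [u] the deviation of the stacked gradient from its value [u*]
    at the optimum, and [h = alpha gamma_k].  Since [J (W - 1) = 0] and the local
    gradients at [x*] sum to zero, the average makes an inexact gradient step
    [J z -> J z - h J u + noise], while the disagreement [Q z] is contracted by
    [W - J], whose norm is [rho_w < 1], and is driven by the increments of [s].
    All iterates are square integrable, so a finite number of initial terms can
    be absorbed in the constants and [m = 1] works; only the asymptotic decay
    has to be proved.

    Constant step size.  Put [B = alpha (W - 1) s + h Q u*].  Then
    [Q z -> (W - J) Q z - B - h Q u] and [B -> (W - J) B - h (1 - (W - J)) Q u],
    so the disagreement is the output of a stable linear system with input
    [Q u], of gain at most [2 h / (1 - rho)^2].  The average only yields
    [- 2 h <J z, J u> = - 2 h <z, u> + 2 h <Q z, Q u>].  By cocoercivity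
    [<z, u> >= |u|^2 / L], and the small-gain inequality
    [2 h L / (1 - rho)^2 <= 1 / sqrt 2], which follows from the step-size bound
    when there are at least two agents, pays for the last term.  Hence, however
    large [L / mu] is, a quadratic function of [(J z, Q z, B)] contracts by a
    constant factor up to noise of order [beta_k^2] ([tracking_contraction], [geometric_step],
    [geometric_moments]).

    Decreasing step size.  The noise at time [k] is independent of the iterates
    at time [k] and centred, so its cross term with the gradient step of the
    average has mean zero ([zero_cross]) and it enters the second moment of
    [J z] with weight [beta_k^2] only.  A weighted sum of the second moments of
    [J z], [Q z] and [Q s] is then bounded ([lyapunov_recursion]); this makes
    the gradients bounded in mean square, so [Q s], its increments and [Q z]
    are of order [max(gamma_k, beta_k)] ([consensus_rates]).  Inserting this in
    the recursion of [J z] gives its rate ([optimality_rate]).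

    Every rate comes from one comparison lemma, [rate_recursion]: a contraction
    [1 - c / t^p] with forcing [C / t^(p + s)] yields [O(t^(- s))]. *)

Set Implicit Arguments.
Unset Strict Implicit.
Unset Printing Implicit Defensive.

(** * Independence of the past and present noise *)

Section Independence.
Local Open Scope classical_set_scope.
Context {d : measure_display} {Omega : measurableType d} {R : realType}.
Variable P : probability Omega R.

(** By independence the law of [(X, Y)] is the product of the laws, so Fubini
    allows integrating in [Y] first. *)
Lemma independent_product_mean0 (X Y : {RV P >-> R}) :
  (forall A B, measurable A -> measurable B ->
     P (X @^-1` A `&` Y @^-1` B) = (P (X @^-1` A) * P (Y @^-1` B))%E) ->
  P.-integrable setT (fun w => (X w * Y w)%:E) ->
  P.-integrable setT (EFin \o Y) -> ('E_P[Y] = 0)%E ->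
  \int[P]_w (X w * Y w) = 0.
Proof.
move=> indep iXY iY Y0.
pose phi w := (X w, Y w).
have mphi : measurable_fun setT phi by apply/measurable_fun_pairP; split.
pose g (z : measurableTypeR R * measurableTypeR R) := (z.1 * z.2)%:E.
have mg : @measurable_fun _ _ (measurableTypeR R * measurableTypeR R)%type (\bar R) setT g.
  by apply/measurable_EFinP; apply: measurable_funM.
have lawE : forall C, measurable C ->
    (distribution P X \x distribution P Y)%E C = pushforward P phi C.
  move=> C mC; exact: product_measure_unique.
have ig : (distribution P X \x distribution P Y)%E.-integrable setT g.
  have := @integrable_pushforward _ _ _ _ _ _ mphi P setT g mg iXY measurableT.
  move=> /integrableP[_ fin]; apply/integrableP; split=> //.
  rewrite (eq_measure_integral (pushforward P phi))// => D mD _.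
  exact: lawE.
rewrite /Rintegral.
have -> : (\int[P]_w (X w * Y w)%:E = \int[pushforward P phi]_z g z)%E.
  by rewrite integral_pushforward.
rewrite (eq_measure_integral (distribution P X \x distribution P Y)%E)//; last first.
  by move=> D mD _; apply/esym; exact: lawE.
rewrite -integral12_prod_meas1//= /fubini_F /=.
rewrite integral0_eq// => x _.
under eq_integral do rewrite /g /= EFinM.
have iid : (distribution P Y).-integrable setT (fun y : R => y%:E).
  have mY : measurable_fun setT Y by [].
  have mid : measurable_fun setT (fun y : R => y%:E) by exact/measurable_EFinP.
  exact: (@integrable_pushforward _ _ _ _ _ Y mY P setT _ mid iY measurableT).
rewrite integralZl// integral_distribution//.
by move: Y0; rewrite unlock => ->; rewrite mule0.
Qed.

(** A pi-system generating the sigma-algebra of the variables indexed by [s].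
    Each index of [s] constrains every cylinder, possibly by the full set, which
    makes the family closed under intersection. *)
Definition cylinders (I : choiceType) (d' : measure_display)
    (T : measurableType d') (X : I -> Omega -> T) (s : seq I) : set (set Omega) :=
  [set E | exists2 B : I -> set T, forall i, measurable (B i) &
     E = \bigcap_(i in [set` s]) X i @^-1` B i].

(** Both sides are finite measures in [E], and the product rule makes them agree
    on the generating pi-system. *)
Lemma independent_of_past (I : choiceType) (d' : measure_display)
    (T : measurableType d') (X : I -> Omega -> T) (s : seq I) (i0 : I)
    (E : set Omega) (B : set T) :
  mutually_independent P X -> (forall i, measurable_fun setT (X i)) ->
  uniq s -> i0 \notin s -> measurable B ->
  <<s cylinders X s >> E ->
  P (E `&` X i0 @^-1` B) = (P E * P (X i0 @^-1` B))%E.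
Proof.
move=> indep mX us i0s mB sE.
have mpre i C : measurable C -> measurable (X i @^-1` C).
  by move=> mC; rewrite -[_ @^-1` _]setTI; exact: mX.
pose A := X i0 @^-1` B.
have mA : measurable A := mpre _ _ mB.
have PA : P A \is a fin_num by rewrite fin_num_measure.
pose r : {nonneg R} := NngNum (fine_ge0 (measure_ge0 P A)).
have -> : P (E `&` A) = mrestr P mA E by [].
have scaleE F : (mscale r P F = P F * P A)%E.
  by rewrite /mscale /= fineK// muleC.
rewrite -scaleE.
apply: (g_sigma_algebra_measure_unique (cylinders X s) _ (fun=> setT)) => //.
- move=> _ [C mC ->].
  by apply: fin_bigcap_measurable => //= i _; exact: mpre.
- move=> _; exists (fun=> setT) => //.
  by apply/seteqP; split.
- by apply: bigcup_const; exists 0%N.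
- move=> _ _ [C mC ->] [D mD ->]; exists (fun i => C i `&` D i).
    by move=> i; exact: measurableI.
  by rewrite -bigcapI; apply: eq_bigcapr.
- move=> _ [C mC ->]; apply: etrans (esym (scaleE _)).
  change (P (\bigcap_(i in [set` s]) X i @^-1` C i `&` A)
          = P (\bigcap_(i in [set` s]) X i @^-1` C i) * P A)%E.
  (* the event about the new index extends the cylinder by one constraint *)
pose C' i := if i == i0 then B else C i.
  have C'E i : i \in s -> C' i = C i.
    by rewrite /C'; case: eqP => // ->; rewrite (negPf i0s).
  have -> : \bigcap_(i in [set` s]) X i @^-1` C i `&` A
            = \bigcap_(i in [set` i0 :: s]) X i @^-1` C' i.
    apply/seteqP; split=> [w [sC Aw] i /=|w all_s].
      rewrite inE => /predU1P[->|si]; first by rewrite /C' eqxx.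
      by rewrite C'E//; exact: sC.
    split=> [i /= si|]; last first.
      by have := all_s i0; rewrite /= mem_head /C' eqxx; exact.
    by rewrite -C'E//; apply: all_s; rewrite /= inE si orbT.
  rewrite indep /=; last first.
  - by move=> i; rewrite /C'; case: ifP.
  - by rewrite i0s.
  rewrite indep// big_cons muleC /C' eqxx; congr (_ * _)%E.
  by apply: eq_big_seq => i si; rewrite -/(C' i) C'E.
- by move=> k; rewrite /mrestr (le_lt_trans (probability_le1 _ _)) ?ltry//; exact: measurableI.
Qed.

End Independence.

(** * Measurability and square integrability *)

Section Measurability.
Local Open Scope classical_set_scope.
Context {d : measure_display} {T : measurableType d} {R : realType}.

(** A Lipschitz function is the infimum of the cones of slope [c] standing on its
    values at the rational points; these are countably many functions, each
    measurable in the coordinates. *)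
Lemma measurable_lipschitz (r : nat) (g : 'rV[R]_r -> R) (c : R)
    (X : T -> 'rV[R]_r) : 0 <= c ->
  (forall x y, g x - g y <= c * \sum_j `|x 0 j - y 0 j|) ->
  (forall j, measurable_fun setT (fun t => X t 0 j)) ->
  measurable_fun setT (fun t => g (X t)).
Proof.
move=> c_ge0 g_lip mX.
(* an enumeration of the rational points *)
pose q (n : nat) : 'rV[R]_r :=
  map_mx ratr (odflt 0 (unpickle n) : 'rV[rat]_r).
pose h n t := g (q n) + c * \sum_j `|X t 0 j - q n 0 j|.
have g_le n t : g (X t) <= h n t by rewrite -lerBlDl.
have mh n : measurable_fun setT (h n).
  apply: measurable_funD => //; apply: measurable_funM => //.
  apply: measurable_sum => j; apply: measurableT_comp => //.
  exact: measurable_funB.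
have lb t : has_lbound (range (h ^~ t)).
  by exists (g (X t)) => _ [n _ <-].
suff -> : (fun t => g (X t)) = (fun t => infs (h ^~ t) 0%N).
  by apply: measurable_fun_infs => // t _; exact: lb.
apply/funext => t; apply/eqP; rewrite eq_le; apply/andP; split.
  apply: lb_le_inf; first by exists (h 0%N t), 0%N.
  by move=> _ [n _ <-].
apply/ler_addgt0Pr => e e_gt0.
pose e' := e / (2 * (c + 1) * r.+1%:R).
have den_gt0 : 0 < 2 * (c + 1) * r.+1%:R :> R.
  by rewrite !mulr_gt0// ltr_wpDl.
have e'_gt0 : 0 < e' by rewrite divr_gt0.
have approx j : exists z : rat, `|X t 0 j - ratr z| < e'.
  have [|z /[!in_itv]/= /andP[z1 z2]] := @rat_in_itvoo R (X t 0 j - e') (X t 0 j + e').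
    by rewrite ltrBlDr -addrA ltrDl addr_gt0.
  by exists z; rewrite ltr_distlC z1 z2.
have [z hz] := choice approx.
pose n := pickle (\row_j z j : 'rV[rat]_r).
have qn j : q n 0 j = ratr (z j).
  by rewrite /q /n pickleK /= !mxE.
have sum_le : \sum_j `|X t 0 j - q n 0 j| <= r.+1%:R * e'.
  apply: (@le_trans _ _ (\sum_(j < r) e')).
    by apply: ler_sum => j _; rewrite qn; exact: ltW.
  by rewrite sumr_const card_ord -[leLHS]mulr_natl ler_pM2r ?ler_nat.
(* the cone based at a rational point [e']-close to [X t] is within [e] of [g] *)
apply: (@le_trans _ _ (h n t)).
  by apply: ge_inf; [case: (lb t) => M hM; exists M => _ [m _ <-]; apply: hM; exists m|exists n].
have gq : g (q n) <= g (X t) + c * \sum_j `|X t 0 j - q n 0 j|.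
  by rewrite -lerBlDl; under eq_bigr do rewrite distrC; exact: g_lip.
have ce : c * \sum_j `|X t 0 j - q n 0 j| <= c * (r.+1%:R * e') by exact: ler_wpM2l.
have ce2 : c * (r.+1%:R * e') <= e / 2.
  rewrite /e' mulrCA -mulrA invfM invfM.
  rewrite [leLHS](_ : _ = (c / (c + 1)) * (e / 2)); last first.
    by field; rewrite /= !gt_eqF// ltr_wpDl.
  by rewrite ler_piMl ?divr_ge0 ?(ltW e_gt0)// ler_pdivrMr ?ltr_wpDl// mul1r lerDl.
rewrite /h; lra.
Qed.

End Measurability.

Section SquareIntegrable.
Local Open Scope classical_set_scope.
Context {d : measure_display} {T : measurableType d} {R : realType}.
Variable P : probability T R.

Definition intble (X : T -> R) := P.-integrable setT (EFin \o X).

Definition sqint (X : T -> R) :=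
  measurable_fun setT X /\ intble (fun w => X w ^+ 2).

Lemma le_intble (X Y : T -> R) : measurable_fun setT X -> intble Y ->
  (forall w, `|X w| <= Y w) -> intble X.
Proof.
move=> mX iY XY; apply: le_integrable iY => //; first exact/measurable_EFinP.
move=> w _ /=; rewrite lee_fin; apply: le_trans (XY w) _; exact: ler_norm.
Qed.

Lemma intbleD X Y : intble X -> intble Y -> intble (fun w => X w + Y w).
Proof. by move=> iX iY; exact: (integrableD measurableT iX iY). Qed.

Lemma intbleZ a X : intble X -> intble (fun w => a * X w).
Proof. by move=> iX; exact: (integrableZl measurableT a iX). Qed.

Lemma intble_cst c : intble (fun=> c).
Proof. exact: finite_measure_integrable_cst. Qed.

Lemma intble_sum (I : Type) (s : seq I) (X : I -> T -> R) :
  (forall i, intble (X i)) -> intble (fun w => \sum_(i <- s) X i w).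
Proof.
move=> iX; elim: s => [|i s IH].
  by under eq_fun do rewrite big_nil; exact: intble_cst.
by under eq_fun do rewrite big_cons; exact: intbleD.
Qed.

Lemma sqint_mul X Y : sqint X -> sqint Y -> intble (fun w => X w * Y w).
Proof.
move=> [mX iX] [mY iY]; apply: le_intble (intbleD iX iY) _.
  exact: measurable_funM.
move=> w; rewrite normrM -(real_normK (num_real (X w))) -(real_normK (num_real (Y w))).
have := sqr_ge0 (`|X w| - `|Y w|); have := normr_ge0 (X w); have := normr_ge0 (Y w); nra.
Qed.

Lemma le_sqint (X Y : T -> R) : measurable_fun setT X -> intble Y ->
  (forall w, X w ^+ 2 <= Y w) -> sqint X.
Proof.
move=> mX iY XY; split=> //; apply: le_intble iY _.
  exact: measurable_funX.
by move=> w; rewrite ger0_norm ?sqr_ge0.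
Qed.

Lemma sqintD X Y : sqint X -> sqint Y -> sqint (fun w => X w + Y w).
Proof.
move=> [mX iX] [mY iY]; apply: le_sqint (intbleZ 2 (intbleD iX iY)) _.
  exact: measurable_funD.
move=> w; have := sqr_ge0 (X w - Y w); nra.
Qed.

Lemma sqintZ a X : sqint X -> sqint (fun w => a * X w).
Proof.
move=> [mX iX]; split; first exact: measurable_funM.
by under eq_fun do rewrite exprMn; exact: intbleZ.
Qed.

Lemma sqint_cst c : sqint (fun=> c).
Proof. by split=> //; exact: intble_cst. Qed.

Lemma sqint_sum (I : Type) (s : seq I) (X : I -> T -> R) :
  (forall i, sqint (X i)) -> sqint (fun w => \sum_(i <- s) X i w).
Proof.
move=> iX; elim: s => [|i s IH].
  by under eq_fun do rewrite big_nil; exact: sqint_cst.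
by under eq_fun do rewrite big_cons; exact: sqintD.
Qed.

Lemma sqint_intble X : sqint X -> intble X.
Proof. by move=> /sqint_mul /(_ (sqint_cst 1)); under eq_fun do rewrite mulr1. Qed.

(** The real-valued mean, linear and monotone on integrable functions. *)
Definition Ex (X : T -> R) : R := \int[P]_w X w.

Lemma expectationE X : intble X -> ('E_P[X] = (Ex X)%:E)%E.
Proof. by move=> iX; rewrite unlock /Ex /Rintegral fineK//; exact: integrable_fin_num. Qed.

Lemma Ex_le X Y : intble X -> intble Y -> (forall w, X w <= Y w) -> Ex X <= Ex Y.
Proof. by move=> iX iY XY; exact: le_Rintegral. Qed.

Lemma ExD X Y : intble X -> intble Y -> Ex (fun w => X w + Y w) = Ex X + Ex Y.
Proof. by move=> iX iY; exact: RintegralD. Qed.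

Lemma ExZ a X : intble X -> Ex (fun w => a * X w) = a * Ex X.
Proof. by move=> iX; exact: RintegralZl. Qed.

Lemma Ex_cst c : Ex (fun=> c) = c.
Proof. by rewrite /Ex Rintegral_cst// [X in fine X](_ : _ = 1%E) ?mulr1//; exact: probability_setT. Qed.

Lemma Ex_ge0 X : (forall w, 0 <= X w) -> 0 <= Ex X.
Proof. by move=> X0; exact: Rintegral_ge0. Qed.

Lemma Ex_sum (I : Type) (s : seq I) (X : I -> T -> R) :
  (forall i, intble (X i)) ->
  Ex (fun w => \sum_(i <- s) X i w) = \sum_(i <- s) Ex (X i).
Proof.
move=> iX; elim: s => [|i s IH].
  by under eq_fun do rewrite big_nil; rewrite big_nil Ex_cst.
under eq_fun do rewrite big_cons.
by rewrite big_cons ExD ?IH//; exact: intble_sum.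
Qed.

End SquareIntegrable.

(** * Frobenius geometry and the spectral radius *)

Section Frobenius.
Context {R : realType}.
Implicit Types (n r : nat).

(** The inner product whose norm is [norm2]. *)
Definition ip n r (A B : 'M[R]_(n, r)) : R := \tr (A^T *m B).

Lemma ipE n r (A B : 'M[R]_(n, r)) : ip A B = \sum_j \sum_i A i j * B i j.
Proof.
rewrite /ip /mxtrace; apply: eq_bigr => j _; rewrite mxE.
by apply: eq_bigr => i _; rewrite mxE.
Qed.

Lemma ip_rows n r (A B : 'M[R]_(n, r)) :
  ip A B = \sum_i inner (row i A) (row i B).
Proof.
rewrite ipE exchange_big; apply: eq_bigr => i _.
by apply: eq_bigr => j _; rewrite !mxE.
Qed.

Lemma ip_inner r (u v : 'rV[R]_r) : inner u v = ip u v.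
Proof. by rewrite ip_rows big_ord1 !row_id. Qed.

Lemma ipC n r (A B : 'M[R]_(n, r)) : ip A B = ip B A.
Proof. by rewrite !ipE; do 2!apply: eq_bigr => ? _; rewrite mulrC. Qed.

Lemma ipDl n r (A B C : 'M[R]_(n, r)) : ip (A + B) C = ip A C + ip B C.
Proof. by rewrite /ip linearD mulmxDl linearD. Qed.

Lemma ipDr n r (A B C : 'M[R]_(n, r)) : ip C (A + B) = ip C A + ip C B.
Proof. by rewrite ipC ipDl !(ipC C). Qed.

Lemma ipZl n r a (A B : 'M[R]_(n, r)) : ip (a *: A) B = a * ip A B.
Proof. by rewrite /ip linearZ -scalemxAl linearZ. Qed.

Lemma ipZr n r a (A B : 'M[R]_(n, r)) : ip A (a *: B) = a * ip A B.
Proof. by rewrite ipC ipZl ipC. Qed.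

Lemma ipNl n r (A B : 'M[R]_(n, r)) : ip (- A) B = - ip A B.
Proof. by rewrite -scaleN1r ipZl mulN1r. Qed.

Lemma ipNr n r (A B : 'M[R]_(n, r)) : ip A (- B) = - ip A B.
Proof. by rewrite ipC ipNl ipC. Qed.

Lemma ip0l n r (A : 'M[R]_(n, r)) : ip 0 A = 0.
Proof. by rewrite -(scale0r 0) ipZl mul0r. Qed.

Lemma ip0r n r (A : 'M[R]_(n, r)) : ip A 0 = 0.
Proof. by rewrite ipC ip0l. Qed.

Definition ip_lin := (ipDl, ipDr, ipNl, ipNr, ipZl, ipZr).

Lemma ip_mull m n r (M : 'M[R]_(m, n)) (A : 'M[R]_(n, r)) (B : 'M[R]_(m, r)) :
  ip (M *m A) B = ip A (M^T *m B).
Proof. by rewrite /ip trmx_mul mulmxA. Qed.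

Lemma ip_mulr m n r (A : 'M[R]_(m, n)) (M : 'M[R]_(n, r)) (B : 'M[R]_(m, r)) :
  ip (A *m M) B = ip A (B *m M^T).
Proof. by rewrite /ip trmx_mul -mulmxA mxtrace_mulC mulmxA. Qed.

Lemma ip_ge0 n r (A : 'M[R]_(n, r)) : 0 <= ip A A.
Proof. by rewrite ipE; do 2!apply: sumr_ge0 => ? _; rewrite -expr2 sqr_ge0. Qed.

Lemma norm2_sqr n r (A : 'M[R]_(n, r)) : norm2 A ^+ 2 = ip A A.
Proof.
have col_ge0 j : 0 <= \sum_i A i j ^+ 2 by apply: sumr_ge0 => i _; exact: sqr_ge0.
rewrite /norm2 sqr_sqrtr; last by apply: sumr_ge0 => j _; exact: sqr_ge0.
by rewrite ipE; apply: eq_bigr => j _; rewrite sqr_sqrtr.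
Qed.

Lemma norm2_ge0 n r (A : 'M[R]_(n, r)) : 0 <= norm2 A.
Proof. exact: sqrtr_ge0. Qed.
Hint Resolve norm2_ge0 ip_ge0 : core.

Lemma norm2E n r (A : 'M[R]_(n, r)) : norm2 A = Num.sqrt (ip A A).
Proof. by rewrite -norm2_sqr sqrtr_sqr ger0_norm. Qed.

Lemma ip_eq0 n r (A : 'M[R]_(n, r)) : ip A A = 0 -> A = 0.
Proof.
rewrite ipE => /eqP; rewrite psumr_eq0; last first.
  by move=> j _; apply: sumr_ge0 => i _; rewrite -expr2 sqr_ge0.
move=> /allP col0; apply/matrixP => i j; rewrite mxE.
have := col0 j (mem_index_enum j); rewrite /= psumr_eq0; last first.
  by move=> k _; rewrite -expr2 sqr_ge0.
by move=> /allP /(_ i (mem_index_enum i)) /=; rewrite -expr2 sqrf_eq0 => /eqP.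
Qed.

Lemma cauchy_schwarz n r (A B : 'M[R]_(n, r)) : ip A B <= norm2 A * norm2 B.
Proof.
have [/ip_eq0 ->|B0] := eqVneq (ip B B) 0; first by rewrite ip0r mulr_ge0.
have Bp : 0 < ip B B by rewrite lt_neqAle eq_sym B0 ip_ge0.
have := ip_ge0 (ip B B *: A - ip A B *: B).
rewrite !ip_lin (ipC B A) => H.
have {}H : ip A B ^+ 2 <= ip A A * ip B B.
  rewrite -subr_ge0 -(pmulr_rge0 _ Bp); apply: le_trans H _.
  by rewrite le_eqVlt; apply/orP; left; apply/eqP; ring.
apply: le_trans (ler_norm _) _; rewrite -(@ler_pXn2r _ 2) ?nnegrE ?mulr_ge0//.
by rewrite real_normK ?num_real// exprMn !norm2_sqr.
Qed.

Lemma norm2D n r (A B : 'M[R]_(n, r)) : norm2 (A + B) <= norm2 A + norm2 B.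
Proof.
rewrite -(@ler_pXn2r _ 2) ?nnegrE ?addr_ge0// norm2_sqr !ip_lin (ipC B A).
have := cauchy_schwarz A B; rewrite sqrrD !norm2_sqr; lra.
Qed.

Lemma norm2N n r (A : 'M[R]_(n, r)) : norm2 (- A) = norm2 A.
Proof. by rewrite !norm2E ipNl ipNr opprK. Qed.

Lemma norm2B n r (A B : 'M[R]_(n, r)) : norm2 (A - B) <= norm2 A + norm2 B.
Proof. by rewrite -(norm2N B) norm2D. Qed.

Lemma norm2Z n r a (A : 'M[R]_(n, r)) : norm2 (a *: A) = `|a| * norm2 A.
Proof. by rewrite !norm2E ipZl ipZr mulrA -expr2 sqrtrM ?sqr_ge0// sqrtr_sqr. Qed.

Lemma norm2_0 n r : norm2 (0 : 'M[R]_(n, r)) = 0.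
Proof. by rewrite norm2E ip0l sqrtr0. Qed.

Lemma norm2_eq0 n r (A : 'M[R]_(n, r)) : norm2 A = 0 -> A = 0.
Proof. by move=> A0; apply: ip_eq0; rewrite -norm2_sqr A0 expr0n. Qed.

Lemma norm2_tr n r (A : 'M[R]_(n, r)) : norm2 A^T = norm2 A.
Proof.
rewrite !norm2E !ipE exchange_big; congr Num.sqrt.
by do 2!apply: eq_bigr => ? _; rewrite !mxE.
Qed.

Lemma norm2_rows n r (A : 'M[R]_(n, r)) :
  norm2 A ^+ 2 = \sum_i norm2 (row i A) ^+ 2.
Proof.
by rewrite norm2_sqr ip_rows; apply: eq_bigr => i _; rewrite norm2_sqr ip_inner.
Qed.

Lemma normr_entry n r (A : 'M[R]_(n, r)) i j : `|A i j| <= norm2 A.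
Proof.
rewrite -(@ler_pXn2r _ 2) ?nnegrE// norm2_sqr real_normK ?num_real// ipE.
rewrite (bigD1 j)//= (bigD1 i)//= expr2 -addrA lerDl addr_ge0//.
  by apply: sumr_ge0 => k _; rewrite -expr2 sqr_ge0.
by do 2!apply: sumr_ge0 => ? _; rewrite -expr2 sqr_ge0.
Qed.

Lemma norm2_le_sum r (v : 'rV[R]_r) : norm2 v <= \sum_j `|v 0 j|.
Proof.
rewrite -(@ler_pXn2r _ 2) ?nnegrE ?sumr_ge0//.
rewrite norm2_sqr ipE expr2 mulr_suml; apply: ler_sum => j _.
rewrite big_ord1 -expr2 -(real_normK (num_real _)) expr2 ler_wpM2l//.
by rewrite (bigD1 j)//= lerDl sumr_ge0.
Qed.

Lemma norm2Z_sqr m k a (X : 'M[R]_(m, k)) : norm2 (a *: X) ^+ 2 = a ^+ 2 * norm2 X ^+ 2.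
Proof. by rewrite norm2Z exprMn (real_normK (num_real _)). Qed.

Lemma norm2_young (t : R) n r (A B : 'M[R]_(n, r)) : 0 < t ->
  norm2 (A + B) ^+ 2 <= (1 + t) * norm2 A ^+ 2 + (1 + t^-1) * norm2 B ^+ 2.
Proof.
move=> t0; rewrite -subr_ge0.
have h : ip (A + B) (A + B) = ip A A + 2 * ip A B + ip B B.
  by rewrite !ip_lin (ipC B A); ring.
have := ip_ge0 (t *: A - B); rewrite !ip_lin (ipC B A) !norm2_sqr h => pos.
have -> : (1 + t) * ip A A + (1 + t^-1) * ip B B - (ip A A + 2 * ip A B + ip B B)
  = t^-1 * (t * (t * ip A A - ip A B) - (t * ip A B - ip B B)).
  by field; rewrite gt_eqF.
by rewrite mulr_ge0 ?invr_ge0 ?(ltW t0).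
Qed.

Lemma norm2_sqrD m k (X Y : 'M[R]_(m, k)) :
  norm2 (X + Y) ^+ 2 <= 2 * norm2 X ^+ 2 + 2 * norm2 Y ^+ 2.
Proof. by have := norm2_young X Y (ltr01 : 0 < 1 :> R); rewrite invr1. Qed.

Lemma norm2_sqrB m k (X Y : 'M[R]_(m, k)) :
  norm2 (X - Y) ^+ 2 <= 2 * norm2 X ^+ 2 + 2 * norm2 Y ^+ 2.
Proof. by have := norm2_sqrD X (- Y); rewrite norm2N. Qed.

Lemma ler_sqr_norm (a c : R) : 0 <= a -> a <= c -> a ^+ 2 <= c ^+ 2.
Proof. by move=> a0 ac; apply: lerXn2r => //; rewrite nnegrE// (le_trans a0). Qed.

Lemma norm2_mulmx n m r (A : 'M[R]_(n, m)) (B : 'M[R]_(m, r)) :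
  norm2 (A *m B) <= norm2 A * norm2 B.
Proof.
have BE : norm2 B ^+ 2 = \sum_j norm2 (col j B) ^+ 2.
  by rewrite -norm2_tr norm2_rows; apply: eq_bigr => j _; rewrite -tr_col norm2_tr.
have ABE : norm2 (A *m B) ^+ 2 = \sum_i \sum_j (ip (row i A)^T (col j B)) ^+ 2.
  rewrite norm2_sqr ipE exchange_big; apply: eq_bigr => i _; apply: eq_bigr => j _.
  rewrite -expr2 ipE big_ord1 mxE; congr (_ ^+ 2).
  by apply: eq_bigr => k _; rewrite !mxE.
rewrite -(@ler_pXn2r _ 2) ?nnegrE ?mulr_ge0// exprMn ABE norm2_rows BE mulr_suml.
apply: ler_sum => i _; rewrite mulr_sumr; apply: ler_sum => j _.
rewrite -(real_normK (num_real (ip _ _))) -exprMn ler_pXn2r ?nnegrE ?mulr_ge0//.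
rewrite ler_norml; apply/andP; split; last first.
  by rewrite -(norm2_tr (row i A)); exact: cauchy_schwarz.
rewrite lerNl -ipNl -(norm2_tr (row i A)) -norm2N; exact: cauchy_schwarz.
Qed.

(** Convexity of the square: [rho x + y] is the mean of [x] and [y / (1 - rho)]
    with weights [rho] and [1 - rho]. *)
Lemma sqr_contractD (rho x y z : R) : 0 <= rho < 1 -> 0 <= z ->
  z <= rho * x + y -> z ^+ 2 <= rho * x ^+ 2 + (1 - rho)^-1 * y ^+ 2.
Proof.
move=> /andP[rho0 rho1] z0 zxy.
have rp : 0 < 1 - rho by rewrite subr_gt0.
apply: (@le_trans _ _ ((rho * x + y) ^+ 2)).
  by rewrite ler_pXn2r ?nnegrE//; exact: le_trans zxy.
rewrite -subr_ge0.
have -> : rho * x ^+ 2 + (1 - rho)^-1 * y ^+ 2 - (rho * x + y) ^+ 2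
          = rho * ((1 - rho) * x - y) ^+ 2 / (1 - rho).
  by field; rewrite gt_eqF.
by apply: divr_ge0; [apply: mulr_ge0 => //; exact: sqr_ge0|exact: ltW].
Qed.

End Frobenius.
#[global] Hint Extern 0 (is_true (0 <= norm2 _)) => exact: norm2_ge0 : core.
#[global] Hint Extern 0 (is_true (0 <= ip _ _)) => exact: ip_ge0 : core.

Section SpectralRadius.
Local Open Scope classical_set_scope.
Context {R : realType}.

Lemma continuous_ip_mul n (A : 'M[R]_n) :
  continuous (fun v : 'rV[R]_n => ip (v *m A) (v *m A)).
Proof.
move=> v; rewrite (_ : (fun u => _) = (fun u : 'rV[R]_n =>
    \sum_j (\sum_k u 0 k * A k j) * (\sum_k u 0 k * A k j))); last first.
  apply/funext => u; rewrite ipE; apply: eq_bigr => j _.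
  by rewrite big_ord1 mxE.
apply: (cvg_big _ (nbhs_filter v)) => [|j _]; first exact: add_continuous.
have cj : (\sum_k u 0 k * A k j)%R @[u --> v] --> (\sum_k v 0 k * A k j)%R.
  apply: (cvg_big _ (nbhs_filter v)) => [|k _]; first exact: add_continuous.
  apply: cvgM; last exact: cvg_cst.
  exact: coord_continuous.
exact: cvgM.
Qed.

Lemma eigenvalue_real_complex n (A : 'M[R]_n) (v : 'rV[R]_n) a :
  v != 0 -> v *m A = a *: v ->
  eigenvalue (map_mx (real_complex R) A) (real_complex R a).
Proof.
move=> v0 vA; apply/eigenvalueP; exists (map_mx (real_complex R) v).
  by rewrite -map_mxM vA map_mxZ.
by rewrite map_mx_eq0.
Qed.

(** A real matrix acts separately on the real and imaginary parts of a complex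
    eigenvector, so a bound on real vectors bounds all complex eigenvalues. *)
Lemma normc_eigenvalue_le n (A : 'M[R]_n) (M : R) (z : R[i]) : 0 <= M ->
  (forall v : 'rV[R]_n, norm2 (v *m A) <= M * norm2 v) ->
  eigenvalue (map_mx (real_complex R) A) z ->
  ComplexField.Normc.normc z <= M.
Proof.
move=> M0 bound /eigenvalueP[v vA v0].
pose p := map_mx (@complex.Re R) v; pose q := map_mx (@complex.Im R) v.
have reA (w : 'rV[R[i]]_n) : map_mx (@complex.Re R) (w *m map_mx (real_complex R) A)
    = map_mx (@complex.Re R) w *m A.
  apply/rowP => j; rewrite !mxE raddf_sum; apply: eq_bigr => k _.
  by rewrite !mxE; case: (w 0 k) => x y /=; rewrite mulr0 subr0.
have imA (w : 'rV[R[i]]_n) : map_mx (@complex.Im R) (w *m map_mx (real_complex R) A)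
    = map_mx (@complex.Im R) w *m A.
  apply/rowP => j; rewrite !mxE raddf_sum; apply: eq_bigr => k _.
  by rewrite !mxE; case: (w 0 k) => x y /=; rewrite mulr0 add0r.
case: z vA => a b vA.
have pA : p *m A = a *: p - b *: q.
  by rewrite -reA vA; apply/rowP => j; rewrite !mxE; case: (v 0 j).
have qA : q *m A = a *: q + b *: p.
  by rewrite -imA vA; apply/rowP => j; rewrite !mxE; case: (v 0 j).
have pq0 : 0 < ip p p + ip q q.
  rewrite lt_neqAle addr_ge0 ?ip_ge0// andbT eq_sym; apply: contra_neq v0 => pq0.
  have p0 : ip p p = 0.
    by have := ip_ge0 p; have := ip_ge0 q; lra.
  have q0 : ip q q = 0 by rewrite -pq0 p0 add0r.
  apply/rowP => j; move/ip_eq0/rowP/(_ j): p0; move/ip_eq0/rowP/(_ j): q0.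
  by rewrite !mxE; case: (v 0 j) => x y /= -> ->.
have key : (a ^+ 2 + b ^+ 2) * (ip p p + ip q q) <= M ^+ 2 * (ip p p + ip q q).
  have -> : (a ^+ 2 + b ^+ 2) * (ip p p + ip q q)
          = norm2 (p *m A) ^+ 2 + norm2 (q *m A) ^+ 2.
    by rewrite !norm2_sqr pA qA !ip_lin (ipC q p); ring.
  have le2 (w : 'rV[R]_n) : norm2 (w *m A) ^+ 2 <= M ^+ 2 * ip w w.
    by rewrite -norm2_sqr -exprMn ler_pXn2r ?nnegrE ?mulr_ge0 ?norm2_ge0//.
  by rewrite mulrDr lerD.
rewrite ler_pM2r// in key.
by rewrite /= -(@ler_pXn2r _ 2) ?nnegrE ?sqrtr_ge0// sqr_sqrtr// addr_ge0 ?sqr_ge0.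
Qed.

(** Let [c] maximise [norm2 (v *m A)] over the unit sphere, with maximum [M].
    Expanding the square gives [norm2 (c A^2 - M^2 c) <= 0], so [c] is killed by
    [(A - M) (A + M)] and [M] or [- M] is an eigenvalue.  No eigenvalue is larger
    in modulus, hence [M] is the spectral radius.  The second part serves to show
    that the spectral radius is strictly below one. *)
Lemma spectral_radius_attained n (A : 'M[R]_n) : (0 < n)%N -> A^T = A ->
  (forall v : 'rV[R]_n, norm2 (v *m A) <= spectral_radius A * norm2 v) /\
  exists2 c : 'rV[R]_n, c != 0 & norm2 (c *m A) = spectral_radius A * norm2 c.
Proof.
move=> n_gt0 symA.
pose S := [set v : 'rV[R]_n | ip v v = 1].
have S0 : S !=set0.
  exists (delta_mx 0 (Ordinal n_gt0)); rewrite /S /= ipE (bigD1 (Ordinal n_gt0))//=.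
  rewrite big_ord1 !mxE !eqxx mulr1 big1 ?addr0// => j /negPf jn.
  by rewrite big_ord1 !mxE jn andbF mulr0.
have cS : compact S.
  apply: bounded_closed_compact.
    exists 1; split; first exact: num_real.
    move=> M M1 v Sv; rewrite /= [leLHS]/Num.Def.normr /= mx_normrE; apply: bigmax_le.
      by rewrite ltW// (lt_trans _ M1).
    move=> [i j] _ /=; apply: le_trans (normr_entry v i j) _.
    by rewrite norm2E [ip v v]Sv sqrtr1 ltW.
  have -> : S = (fun v : 'rV[R]_n => ip (v *m 1%:M) (v *m 1%:M)) @^-1` [set 1].
    by apply/seteqP; split=> v; rewrite /S /= mulmx1.
  apply: preimage_closed => // v _; exact: continuous_ip_mul.
have [c Sc cmax] : exists2 c, S c & forall v, S v -> ip (v *m A) (v *m A) <= ip (c *m A) (c *m A).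
  have [|c cS' H] := @EVT_max_rV R n (fun v => ip (v *m A) (v *m A)) S S0 cS.
    by apply: continuous_subspaceT; exact: continuous_ip_mul.
  exists c; first by move: cS'; rewrite inE.
  by move=> v Sv; apply: H; rewrite inE.
pose M := norm2 (c *m A).
have c1 : norm2 c = 1 by rewrite norm2E [ip c c]Sc sqrtr1.
have c0 : c != 0 by apply: contra_eq_neq c1 => ->; rewrite norm2_0 eq_sym oner_neq0.
have bound (v : 'rV[R]_n) : norm2 (v *m A) <= M * norm2 v.
  have [->|v0] := eqVneq v 0; first by rewrite mul0mx norm2_0 mulr0.
  have nv : 0 < norm2 v.
    by rewrite lt_neqAle norm2_ge0 andbT eq_sym; apply: contra_neq v0 => /norm2_eq0.
  have Su : S ((norm2 v)^-1 *: v).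
    by rewrite /S /= !ip_lin -norm2_sqr; field; rewrite gt_eqF.
  have := cmax _ Su; rewrite -!norm2_sqr ler_pXn2r ?nnegrE// -scalemxAl norm2Z.
  by rewrite ger0_norm ?invr_ge0// mulrC ler_pdivrMr.
have AAc : c *m A *m A = M ^+ 2 *: c.
  apply/eqP; rewrite -subr_eq0; apply/eqP/norm2_eq0/eqP.
  rewrite -sqrf_eq0 norm2_sqr eq_le ip_ge0 andbT !ip_lin.
  rewrite (ipC c (c *m A *m A)) (ip_mulr (c *m A) A c) symA -!norm2_sqr c1 -/M.
  have := bound (c *m A); rewrite -/M -(@ler_pXn2r _ 2) ?nnegrE ?mulr_ge0 ?norm2_ge0//.
  by nra.
pose S' := [set ComplexField.Normc.normc z | z in [set z : R[i] |
        eigenvalue (map_mx (real_complex R) A) z]].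
have ubS' : ubound S' M.
  by move=> _ [z ez <-]; apply: normc_eigenvalue_le ez => //; exact: norm2_ge0.
have S'M : S' M.
  have [u0|u0] := eqVneq (c *m A + M *: c) 0.
    exists (real_complex R (- M)); last first.
      by rewrite /= expr0n addr0 sqrtr_sqr normrN ger0_norm ?norm2_ge0.
    by apply: eigenvalue_real_complex c0 _; rewrite scaleNr -[RHS]add0r -u0 addrK.
  exists (real_complex R M); last first.
    by rewrite /= expr0n addr0 sqrtr_sqr ger0_norm ?norm2_ge0.
  apply: eigenvalue_real_complex u0 _.
  by rewrite mulmxDl AAc -scalemxAl scalerDr scalerA -expr2 addrC.
have -> : spectral_radius A = M.
  apply/eqP; rewrite eq_le; apply/andP; split.
    by apply: ge_sup => //; exists M.
  by apply: ub_le_sup S'M; exists M.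
by split=> //; exists c => //; rewrite c1 mulr1.
Qed.

Lemma spectral_radius_lt1 n (A : 'M[R]_n) : (0 < n)%N -> A^T = A ->
  (forall v : 'rV[R]_n, v != 0 -> norm2 (v *m A) < norm2 v) ->
  0 <= spectral_radius A < 1.
Proof.
move=> n0 symA contr; have [_ [c c0 cE]] := spectral_radius_attained n0 symA.
have nc : 0 < norm2 c.
  by rewrite lt_neqAle norm2_ge0 andbT eq_sym; apply: contra_neq c0 => /norm2_eq0.
rewrite -(ler_pM2r nc) mul0r -cE norm2_ge0 -(ltr_pM2r nc) mul1r -cE.
exact: contr.
Qed.

(** For a symmetric matrix, acting on the columns of [X] amounts to acting on the
    rows of its transpose. *)
Lemma norm2_mulmx_le n r (A : 'M[R]_n) (X : 'M[R]_(n, r)) : (0 < n)%N ->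
  A^T = A -> norm2 (A *m X) <= spectral_radius A * norm2 X.
Proof.
move=> n0 symA; have [bound [c c0 cE]] := spectral_radius_attained n0 symA.
have nc : 0 < norm2 c.
  by rewrite lt_neqAle norm2_ge0 andbT eq_sym; apply: contra_neq c0 => /norm2_eq0.
have rho0 : 0 <= spectral_radius A by rewrite -(ler_pM2r nc) mul0r -cE.
rewrite -norm2_tr trmx_mul symA -(norm2_tr X).
rewrite -(@ler_pXn2r _ 2) ?nnegrE ?mulr_ge0// exprMn !norm2_rows mulr_sumr.
apply: ler_sum => i _; rewrite row_mul -exprMn ler_pXn2r ?nnegrE ?mulr_ge0//.
Qed.

End SpectralRadius.

(** * The coupling matrix *)

Section Coupling.
Context {R : realType}.

Variables (n : nat).
Hypothesis n_gt0 : (0 < n)%N.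
Let n0 : n%:R != 0 :> R. Proof. by rewrite pnatr_eq0 -lt0n. Qed.
Notation J := (averaging n : 'M[R]_n).
Notation Q := (1%:M - averaging n : 'M[R]_n).

Lemma ones_sqr : (ones n)^T *m ones n = n%:R%:M :> 'M[R]_1.
Proof.
apply/matrixP => i j; rewrite !ord1 !mxE (eq_bigr (fun=> 1)).
  by rewrite sumr_const card_ord.
by move=> k _; rewrite !mxE mulr1.
Qed.

Lemma averaging_ones : J *m ones n = ones n.
Proof.
rewrite /averaging -scalemxAl -mulmxA ones_sqr mul_mx_scalar scalerA.
by rewrite mulVf// scale1r.
Qed.

Lemma averaging_idem : J *m J = J.
Proof. by rewrite {2}/averaging -scalemxAr mulmxA averaging_ones. Qed.

Lemma averaging_tr : J^T = J.
Proof. by rewrite /averaging linearZ /= trmx_mul trmxK. Qed.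

Lemma ones_row_mean r (X : 'M[R]_(n, r)) : ones n *m row_mean X = J *m X.
Proof. by rewrite /row_mean /averaging -scalemxAr -scalemxAl mulmxA. Qed.

Lemma disagreement_idem : Q *m Q = Q.
Proof. by rewrite mulmxBl mul1mx mulmxBr mulmx1 averaging_idem subrr subr0. Qed.

Lemma disagreement_tr : Q^T = Q.
Proof. by rewrite linearB /= trmx1 averaging_tr. Qed.

Lemma disagreement_ones : Q *m ones n = 0.
Proof. by rewrite mulmxBl mul1mx averaging_ones subrr. Qed.

Lemma ip_averaging r (X Y : 'M[R]_(n, r)) : ip (J *m X) (J *m Y) = ip (J *m X) Y.
Proof. by rewrite ipC ip_mull averaging_tr mulmxA averaging_idem ipC. Qed.

Lemma ip_disagreement r (X Y : 'M[R]_(n, r)) : ip (Q *m X) (Q *m Y) = ip (Q *m X) Y.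
Proof. by rewrite ipC ip_mull disagreement_tr mulmxA disagreement_idem ipC. Qed.

Lemma ip_split r (X Y : 'M[R]_(n, r)) :
  ip X Y = ip (J *m X) (J *m Y) + ip (Q *m X) (Q *m Y).
Proof. by rewrite ip_averaging ip_disagreement mulmxBl mul1mx ipDl ipNl addrC subrK. Qed.

Lemma norm2_split r (X : 'M[R]_(n, r)) :
  norm2 X ^+ 2 = norm2 (J *m X) ^+ 2 + norm2 (Q *m X) ^+ 2.
Proof. by rewrite !norm2_sqr ip_split. Qed.

Lemma norm2_averaging r (X : 'M[R]_(n, r)) : norm2 (J *m X) <= norm2 X.
Proof.
by rewrite -(@ler_pXn2r _ 2) ?nnegrE// (norm2_split X) lerDl sqr_ge0.
Qed.

Lemma norm2_disagreement r (X : 'M[R]_(n, r)) : norm2 (Q *m X) <= norm2 X.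
Proof.
by rewrite -(@ler_pXn2r _ 2) ?nnegrE// (norm2_split X) lerDr sqr_ge0.
Qed.

Lemma norm2_ones_mul r (v : 'rV[R]_r) : norm2 (ones n *m v) ^+ 2 = n%:R * norm2 v ^+ 2.
Proof.
rewrite !norm2_sqr ip_mull mulmxA ones_sqr mul_scalar_mx ipZr//.
Qed.

Lemma norm2_row_mean r (X : 'M[R]_(n, r)) (v : 'rV[R]_r) :
  norm2 (row_mean X - v) ^+ 2 = n%:R^-1 * norm2 (J *m (X - ones n *m v)) ^+ 2.
Proof.
rewrite mulmxBr mulmxA averaging_ones -ones_row_mean -mulmxBr norm2_ones_mul.
by rewrite mulKf.
Qed.

Lemma consensus_errorE r (X : 'M[R]_(n, r)) : consensus_error X = norm2 (Q *m X).
Proof. by rewrite /consensus_error ones_row_mean mulmxBl mul1mx. Qed.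

(** The squared Frobenius norm of an orthogonal projector is its rank. *)
Lemma d_I_sqr : d_I n ^+ 2 = n%:R - 1 :> R.
Proof.
rewrite /d_I norm2_sqr /ip disagreement_tr disagreement_idem linearB /=.
rewrite mxtrace1 /averaging linearZ /= mxtrace_mulC ones_sqr mxtrace_scalar mulr1n.
by rewrite mulVf.
Qed.

Variable W : 'M[R]_n.
Hypothesis WP : coupling_matrix W.
Notation A := (W - J).

Lemma averaging_coupling : J *m W = J.
Proof.
by case: WP => _ [_ e] _ _ _; rewrite /averaging -scalemxAl -mulmxA e.
Qed.

Lemma coupling_averaging : W *m J = J.
Proof.
by case: WP => _ [e _] _ _ _; rewrite /averaging -scalemxAr mulmxA e.
Qed.

Lemma contraction_tr : A^T = A.
Proof. by case: WP => _ _ e _ _; rewrite linearB /= averaging_tr e. Qed.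

(** The summand of index [i] is the variance of the entries of [u] under the
    weights [W j i]; column sums equal to one give the means, row sums the total. *)
Lemma coupling_energy (u : 'rV[R]_n) :
  norm2 u ^+ 2 - norm2 (u *m W) ^+ 2 =
  \sum_i \sum_j W j i * (u 0 j - (u *m W) 0 i) ^+ 2.
Proof.
have [_ [W1 oneW] _ _ _] := WP.
have rows j : \sum_i W j i = 1.
  have /matrixP /(_ j 0) := W1; rewrite !mxE => <-.
  by apply: eq_bigr => i _; rewrite mxE mulr1.
have cols i : \sum_j W j i = 1.
  have /matrixP /(_ 0 i) := oneW; rewrite !mxE => <-.
  by apply: eq_bigr => j _; rewrite !mxE mul1r.
have -> : norm2 u ^+ 2 = \sum_i \sum_j W j i * u 0 j ^+ 2.
  rewrite exchange_big norm2_sqr ipE; apply: eq_bigr => j _ /=.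
  by rewrite -mulr_suml rows mul1r big_ord1.
rewrite norm2_sqr ipE -sumrB; apply: eq_bigr => i _.
rewrite big_ord1; set m := (u *m W) 0 i.
have mE : \sum_j W j i * u 0 j = m.
  by rewrite /m mxE; apply: eq_bigr => j _; rewrite mulrC.
rewrite [RHS](eq_bigr (fun j => W j i * u 0 j ^+ 2 - 2 * m * (W j i * u 0 j) + m ^+ 2 * W j i)).
  by rewrite big_split sumrB /= -!mulr_sumr mE cols; ring.
by move=> j _; ring.
Qed.

(** Equality makes the energy of [u = v Q] vanish.  As [W i i > 0], this forces
    equal entries of [u] along edges, so [u] is constant by connectedness; its
    entries sum to zero, so it vanishes. *)
Lemma contraction_lt (v : 'rV[R]_n) : v != 0 -> norm2 (v *m A) < norm2 v.
Proof.
have [Wge0 _ _ Wd Wcon] := WP.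
move=> v0; pose u := v *m Q.
have vA : v *m A = u *m W.
  by rewrite /u -mulmxA mulmxBl mul1mx averaging_coupling.
have u_le : norm2 u <= norm2 v.
  by rewrite -norm2_tr trmx_mul disagreement_tr -(norm2_tr v) norm2_disagreement.
have en_ge0 : 0 <= norm2 u ^+ 2 - norm2 (u *m W) ^+ 2.
  rewrite coupling_energy; do 2!apply: sumr_ge0 => ? _.
  by rewrite mulr_ge0 ?sqr_ge0.
have uW_le : norm2 (u *m W) <= norm2 u.
  by rewrite -(@ler_pXn2r _ 2) ?nnegrE// -subr_ge0.
rewrite vA lt_neqAle (le_trans uW_le u_le) andbT; apply: contra_neq v0 => eqv.
have uW : norm2 (u *m W) = norm2 u by apply/eqP; rewrite eq_le uW_le eqv.
have uv : norm2 u = norm2 v by rewrite -uW.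
have en0 : \sum_i \sum_j W j i * (u 0 j - (u *m W) 0 i) ^+ 2 = 0.
  by rewrite -coupling_energy uW subrr.
have term0 i j : 0 < W j i -> u 0 j = (u *m W) 0 i.
  move=> Wji; move/eqP: en0; rewrite psumr_eq0; last first.
    by move=> k _; apply: sumr_ge0 => l _; rewrite mulr_ge0 ?sqr_ge0.
  move=> /allP /(_ i (mem_index_enum i)) /=; rewrite psumr_eq0; last first.
    by move=> l _; rewrite mulr_ge0 ?sqr_ge0.
  move=> /allP /(_ j (mem_index_enum j)) /=.
  by rewrite mulf_eq0 gt_eqF//= sqrf_eq0 subr_eq0 => /eqP.
have edge i j : 0 < W i j -> u 0 i = u 0 j.
  by move=> /term0 ->; rewrite (term0 _ _ (Wd j)).
have uc i j : u 0 i = u 0 j.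
  have /connectP[p + ->] := Wcon i j.
  by elim: p i => //= k p IH i /andP[/edge -> /IH].
have u1 : u *m ones n = 0 by rewrite /u -mulmxA disagreement_ones mulmx0.
have u0 : u = 0.
  apply/rowP => i; rewrite [RHS]mxE.
  have /matrixP /(_ 0 0) := u1; rewrite [LHS]mxE [RHS]mxE (eq_bigr (fun=> u 0 i)).
    by rewrite sumr_const card_ord => /eqP; rewrite -mulr_natl mulf_eq0 (negPf n0) => /eqP.
  by move=> j _; rewrite [X in _ * X]mxE mulr1; exact: uc.
by apply: norm2_eq0; rewrite -uv u0 norm2_0.
Qed.

Lemma rho_w_lt1 : 0 <= rho_w W < 1.
Proof. exact: spectral_radius_lt1 contraction_tr contraction_lt. Qed.

Lemma norm2_contraction r (X : 'M[R]_(n, r)) : norm2 (A *m X) <= rho_w W * norm2 X.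
Proof. exact: norm2_mulmx_le contraction_tr. Qed.

End Coupling.

(** * Smooth strongly convex objectives *)

Section SmoothConvex.
Context {R : realType} (r : nat).
Variables (mu L : R) (f : 'rV[R]_r -> R).
Hypothesis mu_gt0 : 0 < mu.
Hypothesis fP : objective_class mu L f.

Lemma derive_grad x v : 'D_v f x = inner (grad f x) v.
Proof.
have [df _ _] := fP.
rewrite deriveE// {1}(row_sum_delta v) linear_sum; apply: eq_bigr => j _.
by rewrite linearZ /= mxE -deriveE// mulrC.
Qed.

Lemma is_derive_line x v (t : R) :
  is_derive t 1 (fun t : R => f (t *: v + x)) (inner (grad f (t *: v + x)) v).
Proof.
have [df _ _] := fP.
have E : (fun h : R => h^-1 *: (((fun t : R => f (t *: v + x)) \o shift t) (h *: 1) - f (t *: v + x)))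
  = (fun h : R => h^-1 *: ((f \o shift (t *: v + x)) (h *: v) - f (t *: v + x))).
  by apply/funext => h; rewrite /= scalerDl addrA -[h *: 1]/(h * 1) mulr1.
apply: DeriveDef.
  by rewrite /derivable E; exact: diff_derivable.
by rewrite -derive_grad /derive E.
Qed.

Lemma continuous_line x v : continuous (fun t : R => f (t *: v + x)).
Proof.
move=> t; apply/differentiable_continuous/derivable1_diffP.
exact: (@ex_derive _ _ _ _ _ _ _ (is_derive_line x v t)).
Qed.

(** Mean value theorem on the segment, where monotonicity of the gradient
    compares the slope with the initial one. *)
Lemma convex_lower x v : f x + inner (grad f x) v <= f (v + x).
Proof.
have [_ mono _] := fP.
have [|||c /[!in_itv]/= /andP[c0 c1] /eqP] :=
  @MVT R (fun t : R => f (t *: v + x)) (fun t => inner (grad f (t *: v + x)) v) 0 1.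
- by [].
- by move=> t _; exact: is_derive_line.
- exact/continuous_subspaceT/continuous_line.
rewrite scale1r scale0r add0r subr0 mulr1 subr_eq => /eqP ->.
rewrite addrC lerD2r -subr_ge0.
have := mono (c *: v + x) x; rewrite addrK !ip_inner ipZr => H.
rewrite -ipNl -ipDl -(pmulr_rge0 _ c0); apply: le_trans H.
by rewrite mulr_ge0 ?sqr_ge0// ltW.
Qed.

(** Along the segment, [f] minus the right-hand side has nonpositive derivative by
    the Lipschitz bound. *)
Lemma descent_upper x v :
  f (v + x) <= f x + inner (grad f x) v + L / 2 * norm2 v ^+ 2.
Proof.
have [_ _ lip] := fP.
pose c1 := inner (grad f x) v; pose c2 := L / 2 * norm2 v ^+ 2.
pose psi := ((fun t : R => f (t *: v + x)) - (c1 \*: (id : R -> R) + c2 \*: ((id : R -> R) ^+ 2)))%R.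
have dpsi (t : R) : is_derive t 1 psi
    (inner (grad f (t *: v + x)) v - (c1 + c2 * (2 * t))).
  apply: is_deriveB; first exact: is_derive_line.
  apply: is_derive_eq.
  rewrite /= -[c1 *: 1]/(c1 * 1) -[_ *: 1]/(_ * _) -[c2 *: _]/(c2 * _).
  by rewrite !mulr1 expr1.
have [||c /[!in_itv]/= /andP[c0 cl1]] := @MVT R psi _ 0 1 _ (fun t _ => dpsi t).
- by [].
- apply: continuous_subspaceT => t; apply/differentiable_continuous/derivable1_diffP.
  exact: (@ex_derive _ _ _ _ _ _ _ (dpsi t)).
have psiE t : psi t = f (t *: v + x) - (c1 * t + c2 * t ^+ 2) by [].
have psi1 : psi 1 = f (v + x) - (c1 + c2).
  by rewrite psiE scale1r expr1n !mulr1.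
have psi0 : psi 0 = f x.
  by rewrite psiE scale0r add0r expr0n !mulr0 addr0 subr0.
rewrite psi1 psi0 subr0 mulr1 => E.
suff : inner (grad f (c *: v + x)) v - (c1 + c2 * (2 * c)) <= 0.
  by rewrite -E; rewrite /c1 /c2; lra.
have gl : inner (grad f (c *: v + x)) v - c1 <= L * (c * norm2 v) * norm2 v.
  rewrite /c1 !ip_inner -ipNl -ipDl; apply: le_trans (cauchy_schwarz _ _) _.
  apply: ler_wpM2r => //; apply: le_trans (lip _ _) _.
  by rewrite addrK norm2Z ger0_norm// ltW.
by rewrite /c2; lra.
Qed.

(** The Baillon-Haddad inequality: at the point [b - L^-1 (grad f b - grad f a)],
    compare the lower bound of [f] based at [a] with the upper bound based at [b],
    then add the result to the one with [a] and [b] exchanged. *)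
Lemma cocoercive x y : 0 < L ->
  L^-1 * norm2 (grad f x - grad f y) ^+ 2 <= inner (grad f x - grad f y) (x - y).
Proof.
move=> L0.
have bound a b : f a + inner (grad f a) (b - a)
    + (2 * L)^-1 * norm2 (grad f b - grad f a) ^+ 2 <= f b.
  move gE: (grad f b - grad f a) => g.
  have lo := convex_lower a (- L^-1 *: g + (b - a)).
  have up := descent_upper b (- L^-1 *: g).
  rewrite -addrA subrK in lo.
  have := le_trans lo up; rewrite !ip_inner !ip_lin norm2Z exprMn.
  rewrite (real_normK (num_real _)).
  have -> : ip (grad f b) g = ip (grad f a) g + norm2 g ^+ 2.
    by rewrite norm2_sqr -ipDl -{2}gE [grad f a + _]addrC subrK.
  set s := norm2 g ^+ 2; set A := ip (grad f a) g.
  have -> : L / 2 * ((- L^-1) ^+ 2 * s) = L^-1 * s / 2.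
    by field; rewrite gt_eqF.
  have -> : (2 * L)^-1 * s = L^-1 * s / 2 by field; rewrite gt_eqF.
  by rewrite !mulNr; nra.
have b1 := bound x y; have b2 := bound y x.
rewrite -(opprB (grad f x)) norm2N in b1.
have E1 : (2 * L)^-1 * norm2 (grad f x - grad f y) ^+ 2
       = L^-1 * norm2 (grad f x - grad f y) ^+ 2 / 2 by field; rewrite gt_eqF.
rewrite E1 in b1 b2.
move: b1 b2; rewrite -(opprB x y) !ip_inner !ip_lin; lra.
Qed.

Lemma modulus_le_lipschitz : (0 < r)%N -> mu <= L.
Proof.
case: r f fP => // r' g gP _; have [_ mono lip] := gP.
have e1 : norm2 (delta_mx 0 0 - 0 : 'rV[R]_r'.+1) = 1.
  rewrite subr0 norm2E ipE (bigD1 0)//= big_ord1 !mxE !eqxx mulr1.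
  rewrite big1 ?addr0 ?sqrtr1// => j /negPf j0.
  by rewrite big_ord1 !mxE j0 andbF mulr0.
have := mono (delta_mx 0 0) 0; rewrite ip_inner => H.
have := le_trans H (cauchy_schwarz _ _).
have := lip (delta_mx 0 0) 0; rewrite e1; lra.
Qed.

End SmoothConvex.

Section StackedGradient.
Context {R : realType} (n r : nat).
Variables (mu L : R) (f : 'I_n -> 'rV[R]_r -> R).
Hypothesis mu_gt0 : 0 < mu.
Hypothesis L_gt0 : 0 < L.
Hypothesis fP : forall i, objective_class mu L (f i).

Lemma row_stacked_grad (x : 'M[R]_(n, r)) i : row i (stacked_grad f x) = grad (f i) (row i x).
Proof. exact: rowK. Qed.

Lemma stacked_strong (x y : 'M[R]_(n, r)) :
  mu * norm2 (x - y) ^+ 2 <= ip (stacked_grad f x - stacked_grad f y) (x - y).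
Proof.
rewrite norm2_rows ip_rows mulr_sumr; apply: ler_sum => i _.
by rewrite !linearB /= !row_stacked_grad; case: (fP i).
Qed.

Lemma stacked_cocoercive (x y : 'M[R]_(n, r)) :
  L^-1 * norm2 (stacked_grad f x - stacked_grad f y) ^+ 2
  <= ip (stacked_grad f x - stacked_grad f y) (x - y).
Proof.
rewrite norm2_rows ip_rows mulr_sumr; apply: ler_sum => i _.
by rewrite !linearB /= !row_stacked_grad; exact: cocoercive (fP i) _ _ _.
Qed.

Lemma stacked_lipschitz (x y : 'M[R]_(n, r)) :
  norm2 (stacked_grad f x - stacked_grad f y) <= L * norm2 (x - y).
Proof.
have Lx : 0 <= L * norm2 (x - y) by rewrite mulr_ge0// ltW.
rewrite -(@ler_pXn2r _ 2) ?nnegrE// exprMn !norm2_rows mulr_sumr.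
apply: ler_sum => i _; rewrite !linearB /= !row_stacked_grad -exprMn.
have Li : 0 <= L * norm2 (row i x - row i y) by rewrite mulr_ge0// ltW.
by rewrite ler_pXn2r ?nnegrE//; case: (fP i).
Qed.

(** Otherwise the step [- (n L)^-1 g] along the sum [g] of the local gradients
    would decrease the sum of the objectives by at least [|g|^2 / (2 n L)]. *)
Lemma optimality (xs : 'rV[R]_r) : (0 < n)%N ->
  (forall x, global_objective f xs <= global_objective f x) ->
  averaging n *m stacked_grad f (ones n *m xs) = 0.
Proof.
move=> n_gt0 xsmin.
have np : 0 < n%:R :> R by rewrite ltr0n.
have rowE i : row i (ones n *m xs) = xs.
  apply/rowP => j; rewrite !mxE big_ord1 !mxE mul1r//.
pose g := \sum_i grad (f i) xs.
have gE : (ones n)^T *m stacked_grad f (ones n *m xs) = g.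
  apply/rowP => j; rewrite !mxE summxE; apply: eq_bigr => i _.
  rewrite [in LHS]mxE [(ones n) _ _]mxE mul1r.
  by have /rowP /(_ j) := row_stacked_grad (ones n *m xs) i; rewrite rowE mxE.
suff g0 : g = 0 by rewrite /averaging -scalemxAl -mulmxA gE g0 mulmx0 scaler0.
have up v : 0 <= ip g v + n%:R * (L / 2 * norm2 v ^+ 2).
  have := xsmin (v + xs); rewrite /global_objective ler_pM2l ?invr_gt0// => le1.
  have le2 : \sum_i f i (v + xs) <= \sum_i (f i xs + ip (grad (f i) xs) v + L / 2 * norm2 v ^+ 2).
    by apply: ler_sum => i _; rewrite -ip_inner; exact: descent_upper (fP i) _ _.
  have := le_trans le1 le2; rewrite !big_split /= sumr_const card_ord mulr_natl.
  suff -> : \sum_i ip (grad (f i) xs) v = ip g v by lra.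
  by rewrite /g (big_morph (fun u => ip u v) (fun a b => ipDl a b v) (ip0l v)).
have := up (- (n%:R * L)^-1 *: g); rewrite ipZr norm2Z exprMn (real_normK (num_real _)) norm2_sqr.
have -> : - (n%:R * L)^-1 * ip g g + n%:R * (L / 2 * ((- (n%:R * L)^-1) ^+ 2 * ip g g))
  = - ((2 * (n%:R * L))^-1 * ip g g) by field; rewrite !gt_eqF.
rewrite oppr_ge0 pmulr_rle0 ?invr_gt0 ?mulr_gt0// => le0.
by apply: ip_eq0; apply/eqP; rewrite eq_le le0 ip_ge0.
Qed.

End StackedGradient.

(** * Scalar recursions with power rates *)

Section PowerRates.
Context {R : realType}.

(** The denominator [m + k] of the step sizes, for [m = 1]. *)
Definition time (k : nat) : R := 1 + k%:R.

Lemma time_ge1 k : 1 <= time k. Proof. by rewrite lerDl. Qed.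
Lemma time_gt0 k : 0 < time k. Proof. exact: lt_le_trans (time_ge1 k). Qed.
Lemma timeS k : time k.+1 = time k + 1. Proof. by rewrite /time -natr1 addrA. Qed.

Lemma time_powR_sqr k x : (time k `^ x)^-1 ^+ 2 = (time k `^ (2 * x))^-1.
Proof. by rewrite exprVn mulrC powRrM powR_mulrn// powR_ge0. Qed.

Lemma time_powR_le k x y : x <= y -> (time k `^ y)^-1 <= (time k `^ x)^-1.
Proof. by move=> xy; rewrite lef_pV2 ?posrE ?powR_gt0 ?time_gt0// ler_powR ?time_ge1. Qed.

Lemma powR_succ (t s : R) : 0 < t ->
  (t + 1) `^ s = t `^ s * expR (s * ln (1 + t^-1)).
Proof.
move=> t0; have i0 : 0 < 1 + t^-1 by rewrite addr_gt0 ?invr_gt0.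
have -> : t + 1 = t * (1 + t^-1) by field; rewrite gt_eqF.
by rewrite powRM ?(ltW t0) ?(ltW i0)// /powR [1 + _ == 0]gt_eqF.
Qed.

(** The sequence [t^(- s)] loses at most the factor [1 - s / t] in one step. *)
Lemma powR_succ_le (t s : R) : 0 < t -> 0 <= s ->
  (1 - s / t) / t `^ s <= ((t + 1) `^ s)^-1.
Proof.
move=> t0 s0; rewrite powR_succ// invfM mulrC ler_pM2l ?invr_gt0 ?powR_gt0//.
rewrite -expRN; apply: le_trans (expR_ge1Dx _).
rewrite lerD2l lerN2 ler_wpM2l// le_ln1Dx// (lt_trans (ltrN10 _))//.
by rewrite invr_gt0.
Qed.

Lemma ln1Dinv_ge (t : R) : 0 < t -> (t + 1)^-1 <= ln (1 + t^-1).
Proof.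
move=> t0; have t1 : 0 < t + 1 by rewrite addr_gt0.
have i1 : (t + 1)^-1 < 1 by rewrite invf_lt1// ltrDr.
have -> : 1 + t^-1 = (1 - (t + 1)^-1)^-1.
  by field; rewrite addrK !gt_eqF.
rewrite lnV ?posrE ?subr_gt0// lerNr; apply: le_ln1Dx.
by rewrite ltrN2.
Qed.

(** The sequence [t^(- s)] decreases by at least a multiple of [t^(- s - 1)], which
    makes it a potential for the summation of such terms. *)
Lemma powR_succ_ge (t s : R) : 1 <= t -> 0 <= s ->
  (1 + s / 2) ^-1 * (s / 2) / t `^ (s + 1) <= (t `^ s)^-1 - ((t + 1) `^ s)^-1.
Proof.
move=> t1 s0; have t0 : 0 < t by exact: lt_le_trans t1.
have x0 : 0 <= s / 2 / t by rewrite !divr_ge0 ?(ltW t0).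
have le1 : 1 + s / 2 / t <= expR (s * ln (1 + t^-1)).
  apply: le_trans (expR_ge1Dx _); rewrite lerD2l -!mulrA ler_wpM2l//.
  apply: le_trans (ln1Dinv_ge t0); rewrite -invfM lef_pV2 ?posrE ?addr_gt0 ?mulr_gt0//.
  by lra.
rewrite powR_succ// powRD ?(gt_eqF t0) ?implybT// powRr1 ?(ltW t0)//.
rewrite !invfM -[X in _ <= X - _]mulr1 -mulrBr.
rewrite [leLHS](_ : _ = (t `^ s)^-1 * ((1 + s / 2)^-1 * (s / 2) * t^-1)); last by ring.
rewrite ler_pM2l ?invr_gt0 ?powR_gt0//.
apply: (@le_trans _ _ (1 - (1 + s / 2 / t)^-1)); last first.
  rewrite lerD2l lerN2 lef_pV2 ?posrE ?expR_gt0//.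
  by rewrite ltr_wpDr.
have x1 : 0 < 1 + s / 2 / t by lra.
have -> : 1 - (1 + s / 2 / t)^-1 = (1 + s / 2 / t)^-1 * (s / 2 / t).
  by rewrite -{1}(mulVf (lt0r_neq0 x1)) mulrDr mulr1 addrAC subrr add0r.
rewrite -mulrA ler_wpM2r// lef_pV2 ?posrE//; last by lra.
by rewrite lerD2l ler_pdivrMr// ler_peMr// divr_ge0.
Qed.

(** Used to absorb the times before an asymptotic recursion starts to hold. *)
Lemma initial_bound (a b : nat -> R) K : (forall k, 0 <= a k) ->
  (forall k, 0 < b k) -> exists2 M, 0 <= M & forall k, (k <= K)%N -> a k <= M * b k.
Proof.
move=> a0 b0; exists (\sum_(i < K.+1) a i / b i).
  by apply: sumr_ge0 => i _; rewrite divr_ge0// ltW.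
move=> k kK; rewrite -ler_pdivrMr// (bigD1 (Ordinal (kK : (k < K.+1)%N)))//= lerDl.
by apply: sumr_ge0 => i _; rewrite divr_ge0// ltW.
Qed.

Lemma eventually_time_ge (x : R) : exists K, forall k, (K <= k)%N -> x <= time k.
Proof.
exists (Num.bound x) => k Kk; rewrite /time.
have := archi_boundP (normr_ge0 x).
have [x0|x0] := lerP 0 x.
  have := archi_boundP x0; move=> h _.
  apply: le_trans (ltW h) _; apply: (@le_trans _ _ k%:R); first by rewrite ler_nat.
  by rewrite lerDr.
by move=> _; rewrite (le_trans (ltW x0))// addr_ge0.
Qed.

(** The relative decay [s / t] of the comparison sequence [t^(- s)] must be slower
    than the contraction [c / t^p]; for [p = 1] this is [s < c], and for [p < 1] it
    holds eventually. *)
Lemma rate_dominates (c p s : R) : 0 < c -> p <= 1 -> 0 <= s -> p < 1 \/ s < c ->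
  exists2 delta, 0 < delta & exists K, forall k, (K <= k)%N ->
    s / time k <= (c - delta) / time k `^ p.
Proof.
move=> c0 p1 s0 ps.
have E k delta : (s / time k <= (c - delta) / time k `^ p)
  = (s <= (c - delta) * time k `^ (1 - p)).
  have t0 := time_gt0 k.
  rewrite ler_pdivrMr// powRB ?(gt_eqF t0) ?implybT// powRr1 ?(ltW t0)//.
  by congr (_ <= _); rewrite mulrAC mulrA.
have [sc|cs] := ltP s c.
  exists (c - s); first by rewrite subr_gt0.
  exists 0%N => k _; rewrite E opprB addrC subrK ler_peMr//.
  by rewrite -[leLHS](powRr0 (time k)) ler_powR ?time_ge1// subr_ge0.
have {}p1 : p < 1 by case: ps => //; rewrite ltNge cs.
exists (c / 2); first by rewrite divr_gt0.
have [K hK] := eventually_time_ge ((2 * s / c) `^ (1 - p)^-1).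
exists K => k Kk; rewrite E.
have q0 : 0 < 1 - p by rewrite subr_gt0.
have sc0 : 0 <= 2 * s / c by rewrite divr_ge0 ?mulr_ge0 ?(ltW c0).
have : 2 * s / c <= time k `^ (1 - p).
  have -> : 2 * s / c = ((2 * s / c) `^ (1 - p)^-1) `^ (1 - p).
    by rewrite -powRrM mulVf ?gt_eqF// powRr1.
  by rewrite ge0_ler_powR ?nnegrE ?powR_ge0 ?hK ?(ltW (time_gt0 _)) ?(ltW q0).
rewrite ler_pdivrMr//; lra.
Qed.

(** For [M] large, [M / t^s] is a supersolution: in one step it loses at most the
    factor [1 - s / t], and the contraction exceeds this loss by [delta / t^p],
    which dominates the forcing term. *)
Lemma rate_recursion (a : nat -> R) (c C p s : R) (K : nat) :
  (forall k, 0 <= a k) -> 0 < c -> 0 <= C -> 0 <= p <= 1 -> 0 <= s ->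
  p < 1 \/ s < c ->
  (forall k, (K <= k)%N ->
     a k.+1 <= (1 - c / time k `^ p) * a k + C / (time k `^ p * time k `^ s)) ->
  exists2 M, 0 <= M & forall k, a k <= M / time k `^ s.
Proof.
move=> a0 c0 C0 /andP[p0 p1] s0 ps rec.
have [delta d0 [K1 dom]] := rate_dominates c0 p1 s0 ps.
have [K2 hK2] := eventually_time_ge (2 * s).
pose N := maxn K (maxn K1 K2).
have [M0 M00 init] := @initial_bound a (fun k => (time k `^ s)^-1) N a0
  (fun k => eq_ind_r is_true (powR_gt0 s (time_gt0 k)) (invr_gt0 _)).
pose M := M0 + C / delta + 2 * C.
have Cd : 0 <= C / delta by rewrite divr_ge0// ltW.
have M_ge0 : 0 <= M by rewrite /M; lra.
exists M => //; elim=> [|k IH].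
  apply: le_trans (init 0%N _) _ => //.
  by rewrite ler_wpM2r ?invr_ge0 ?powR_ge0// /M; lra.
have [kN|Nk] := ltnP k N.
  apply: le_trans (init k.+1 kN) _.
  by rewrite ler_wpM2r ?invr_ge0 ?powR_ge0// /M; lra.
have kK : (K <= k)%N by apply: leq_trans Nk; rewrite leq_maxl.
have kK1 : (K1 <= k)%N by apply: leq_trans Nk; rewrite leq_max leq_max leqnn orbT.
have kK2 : (K2 <= k)%N by apply: leq_trans Nk; rewrite leq_max leq_max leqnn !orbT.
apply: le_trans (rec k kK) _.
have t0 := time_gt0 k; have t1 := time_ge1 k.
rewrite timeS; have := powR_succ_le t0 s0.
have := dom k kK1; have := hK2 k kK2; move: IH; rewrite invfM mulrA.
set T := (time k `^ s)^-1; set S := ((time k + 1) `^ s)^-1.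
set x := (time k `^ p)^-1; set y := s / time k => IH hy domk bern.
have T0 : 0 < T by rewrite invr_gt0 powR_gt0.
have x0 : 0 < x by rewrite invr_gt0 powR_gt0.
have x1 : x <= 1.
  by rewrite invf_le1 ?powR_gt0// -[leLHS](powRr0 (time k)) ler_powR.
have y2 : y <= 1 / 2 by rewrite ler_pdivrMr//; lra.
(* with a negative factor the forcing term alone bounds the next value *)
have [neg|pos] := ltP (1 - c * x) 0.
  apply: (@le_trans _ _ (C * T)).
    have : (1 - c * x) * a k <= 0 by rewrite nmulr_rle0.
    have : C * x * T <= C * T by rewrite ler_pM2r// ler_piMr.
    lra.
  have : (1 / 2) * T <= S by apply: le_trans bern; rewrite ler_pM2r//; lra.
  have : 2 * C <= M by rewrite /M; lra.
  have : 0 <= C * T by rewrite mulr_ge0// ltW.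
  have : 0 <= S by rewrite invr_ge0 powR_ge0.
  nra.
apply: (@le_trans _ _ ((1 - c * x) * (M * T) + C * x * T)).
  by rewrite lerD2r ler_wpM2l.
apply: (@le_trans _ _ (M * ((1 - y) * T))); last by rewrite ler_wpM2l.
have Md : C <= M * delta.
  by rewrite -ler_pdivrMr// /M; lra.
have -> : (1 - c * x) * (M * T) + C * x * T = ((1 - c * x) * M + C * x) * T by ring.
rewrite mulrA ler_pM2r//.
have : M * y <= M * ((c - delta) * x) by rewrite ler_wpM2l.
have : C * x <= M * delta * x by rewrite ler_pM2r.
lra.
Qed.

(** The sum of [a] and of the potential [D / t^(s - 1)] is eventually nonincreasing. *)
Lemma bounded_recursion (a : nat -> R) (C s : R) (K : nat) :
  (forall k, 0 <= a k) -> 0 <= C -> 1 < s ->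
  (forall k, (K <= k)%N -> a k.+1 <= a k + C / time k `^ s) ->
  exists2 M, 0 <= M & forall k, a k <= M.
Proof.
move=> a0 C0 s1 rec.
pose e := s - 1; have e0 : 0 < e by rewrite subr_gt0.
pose D := C * ((1 + e / 2) / (e / 2)).
have D0 : 0 <= D by rewrite mulr_ge0// divr_ge0; lra.
pose b k := a k + D / time k `^ e.
have b_noninc k : (K <= k)%N -> b k.+1 <= b k.
  move=> kK; rewrite /b timeS.
  have := powR_succ_ge (time_ge1 k) (ltW e0); rewrite /e subrK -/e => h.
  have := rec k kK.
  suff : C / time k `^ s <= D * ((time k `^ e)^-1 - ((time k + 1) `^ e)^-1) by lra.
  apply: (@le_trans _ _ (D * ((1 + e / 2)^-1 * (e / 2) / time k `^ s))); last exact: ler_wpM2l.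
  rewrite le_eqVlt; apply/orP; left; apply/eqP; rewrite /D; field.
  by rewrite !gt_eqF ?powR_gt0 ?time_gt0//; lra.
have [M M0 init] := @initial_bound b (fun=> 1) K
  (fun k => addr_ge0 (a0 k) (mulr_ge0 D0 (eq_ind_r is_true (powR_ge0 _ _) (invr_ge0 _)))) (fun=> ltr01).
exists M => // k; apply: (@le_trans _ _ (b k)).
  by rewrite /b lerDl mulr_ge0// invr_ge0 powR_ge0.
elim: k => [|k IH]; first by rewrite -[leRHS]mulr1 init.
have [kK|Kk] := ltnP k K; first by rewrite -[leRHS]mulr1 init.
exact: le_trans (b_noninc k Kk) IH.
Qed.

End PowerRates.

(** * Coupled recursions for decreasing step sizes *)

(** Here [E], [X], [S] and [Y] stand for the second moments of the mean deviation,
    of the disagreements of [x] and of [s], and of the increments of [s]. *)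
Section CoupledRecursion.
Context {R : realType}.
Notation time := (@time R).
Variables (E X S Y : nat -> R) (rho c C p q : R).
Hypotheses (E_ge0 : forall k, 0 <= E k) (X_ge0 : forall k, 0 <= X k)
  (S_ge0 : forall k, 0 <= S k).
Hypotheses (rhoP : 0 <= rho < 1) (c_gt0 : 0 < c) (C_ge0 : 0 <= C).
Hypotheses (p_gt0 : 0 < p) (q_ge0 : 0 <= q).
Let g k := (time k `^ p)^-1.
Let b k := (time k `^ q)^-1.
Hypothesis SP : forall k,
  S k.+1 <= rho * S k + C * (b k ^+ 2 + g k ^+ 2 * (E k + X k + 1)).
Hypothesis YP : forall k,
  Y k <= C * (S k + b k ^+ 2 + g k ^+ 2 * (E k + X k + 1)).
Hypothesis XP : forall k,
  X k.+1 <= rho * X k + C * (S k + b k ^+ 2 + g k ^+ 2 * (E k + X k + 1)).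
Hypothesis EP : forall k,
  E k.+1 <= (1 - c * g k + C * g k ^+ 2) * E k + C * g k * X k + C * b k ^+ 2.

Let g_gt0 k : 0 < g k. Proof. by rewrite invr_gt0 powR_gt0// time_gt0. Qed.
Let b_gt0 k : 0 < b k. Proof. by rewrite invr_gt0 powR_gt0// time_gt0. Qed.

Let g_le1 k : g k <= 1.
Proof. by rewrite -[leRHS]invr1 -(powRr0 (time k)) time_powR_le// ltW. Qed.

Lemma eventually_small_step (e : R) : 0 < e ->
  exists K, forall k, (K <= k)%N -> g k <= e.
Proof.
move=> e0; have [K hK] := eventually_time_ge (e^-1 `^ p^-1).
exists K => k Kk; rewrite -[leRHS]invrK lef_pV2 ?posrE ?powR_gt0 ?time_gt0 ?invr_gt0//.
have -> : e^-1 = (e^-1 `^ p^-1) `^ p.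
  by rewrite -powRrM mulVf ?gt_eqF// powRr1// invr_ge0 ltW.
by rewrite ge0_ler_powR ?nnegrE ?powR_ge0 ?hK ?(ltW p_gt0) ?(ltW (time_gt0 _)).
Qed.

Let kappa := 2 * (C + 1) / (1 - rho).

Let kappa_gt0 : 0 < kappa.
Proof.
by case/andP: rhoP => _ r1; rewrite divr_gt0 ?subr_gt0// mulr_gt0// ltr_wpDl.
Qed.

Let Phi k := E k + X k + kappa * S k.

Let Phi_ge0 k : 0 <= Phi k.
Proof. by rewrite !addr_ge0// mulr_ge0// ltW. Qed.

Let D := 2 * C + kappa * C.

Let D_ge0 : 0 <= D.
Proof. by rewrite addr_ge0 ?(mulr_ge0 (ltW kappa_gt0) C_ge0) ?mulr_ge0. Qed.

(** The weight [kappa] is such that half of the decay [(1 - rho) kappa S] of the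
    last term pays for the contribution [C S] to [X]; the remaining couplings are
    small with the step size. *)
Lemma lyapunov_recursion : exists K, forall k, (K <= k)%N ->
  Phi k.+1 <= (1 - c / 2 / time k `^ p) * Phi k + D * (b k ^+ 2 + g k ^+ 2).
Proof.
have [r0 r1] := andP rhoP.
have e0 : 0 < Num.min (c / 2 / (D + 1)) (Num.min ((1 - rho) / 2 / (C + D + 1)) ((1 - rho) / c)).
  have D1 : 0 < D + 1 by rewrite ltr_wpDl.
  have CD1 : 0 < C + D + 1 by rewrite ltr_wpDl// addr_ge0.
  by rewrite !lt_min !divr_gt0 ?subr_gt0.
have [K hK] := eventually_small_step e0; exists K => k /hK.
have D1 : 0 < D + 1 by rewrite ltr_wpDl.
have CD1 : 0 < C + D + 1 by rewrite ltr_wpDl// addr_ge0.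
rewrite !le_min !ler_pdivlMr// => /andP[h1 /andP[h2 h3]].
rewrite -/(g k); move: (SP k) (XP k) (EP k) (g_gt0 k) (g_le1 k) (E_ge0 k) (X_ge0 k) (S_ge0 k).
rewrite /Phi; move: (E k.+1) (X k.+1) (S k.+1) (E k) (X k) (S k) (g k) (b k) h1 h2 h3.
move=> E' X' S' e x s gk bk h1 h2 h3 hS hX hE g0 g1 e_ge0 x_ge0 s_ge0.
have kS : kappa * S' <= kappa * (rho * s + C * (bk ^+ 2 + gk ^+ 2 * (e + x + 1))).
  by rewrite ler_pM2l.
have g2 : gk ^+ 2 <= gk by rewrite expr2 ler_piMl// ltW.
have coefE : (1 - c * gk + C * gk ^+ 2) + (C + kappa * C) * gk ^+ 2 <= 1 - c / 2 * gk.
  have : D * gk ^+ 2 <= c / 2 * gk by rewrite expr2 mulrA ler_pM2r//; lra.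
  by rewrite /D; lra.
have coefX : (rho + C * gk) + (C + kappa * C) * gk ^+ 2 <= 1 - c / 2 * gk.
  have : (C + kappa * C) * gk ^+ 2 <= (C + kappa * C) * gk.
    by rewrite ler_wpM2l// addr_ge0 ?(mulr_ge0 (ltW kappa_gt0) C_ge0) ?mulr_ge0.
  by rewrite /D in h2; have := mulr_ge0 C_ge0 (ltW g0); lra.
have coefS : kappa * rho + C <= kappa * (1 - c / 2 * gk).
  have : kappa * (1 - rho) = 2 * (C + 1) by rewrite /kappa; field; rewrite subr_eq0 gt_eqF.
  have : kappa * (c / 2 * gk) <= kappa * ((1 - rho) / 2) by rewrite ler_pM2l//; lra.
  lra.
have := ler_wpM2r e_ge0 coefE; have := ler_wpM2r x_ge0 coefX; have := ler_wpM2r s_ge0 coefS.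
have := mulr_ge0 C_ge0 (sqr_ge0 bk); have := mulr_ge0 C_ge0 (sqr_ge0 gk).
by rewrite /D; lra.
Qed.

Lemma bounded_large_step : p <= 1 -> p <= q ->
  exists2 M, 0 <= M & forall k, E k + X k + 1 <= M.
Proof.
move=> p1 pq; have [K rec] := lyapunov_recursion.
have [|||||k Kk|M M0 hM] := @rate_recursion R Phi (c / 2) (2 * D) p 0 K Phi_ge0.
- by rewrite divr_gt0.
- by rewrite mulr_ge0.
- by rewrite p1 ltW.
- by [].
- by right; rewrite divr_gt0.
- apply: le_trans (rec k Kk) _; rewrite lerD2l powRr0 mulr1 -/(g k).
  have bg : b k <= g k by exact: time_powR_le.
  have : b k ^+ 2 <= g k ^+ 2 by rewrite ler_pXn2r ?nnegrE// ltW.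
  have : g k ^+ 2 <= g k by rewrite expr2 ler_piMl// ltW.
  by move=> ? ?; rewrite [2 * D]mulrC -mulrA ler_wpM2l//; lra.
- exists (M + 1); first by rewrite addr_ge0.
  move=> k; rewrite lerD2r; apply: (@le_trans _ _ (Phi k)).
    by rewrite /Phi lerDl mulr_ge0// ltW.
  by have := hM k; rewrite powRr0 divr1.
Qed.

Lemma sqr_steps_le k s : s <= 2 * p -> s <= 2 * q ->
  b k ^+ 2 + g k ^+ 2 <= 2 / time k `^ s.
Proof.
move=> sp sq; rewrite /b /g !time_powR_sqr.
have := time_powR_le k sp; have := time_powR_le k sq; lra.
Qed.

(** The contraction is discarded here: the step sizes and noise levels are square
    summable. *)
Lemma bounded_small_step : 1 < 2 * p -> 1 < 2 * q ->
  exists2 M, 0 <= M & forall k, E k + X k + 1 <= M.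
Proof.
move=> p1 q1; have [K rec] := lyapunov_recursion.
pose s := Num.min (2 * p) (2 * q).
have [|||M M0 hM] := @bounded_recursion R Phi (2 * D) s K Phi_ge0.
- by rewrite mulr_ge0.
- by rewrite lt_min p1.
- move=> k Kk; apply: le_trans (rec k Kk) _; apply: lerD.
    by rewrite ler_piMl// gerBl !divr_ge0 ?powR_ge0 ?(ltW c_gt0).
  have : b k ^+ 2 + g k ^+ 2 <= 2 / time k `^ s.
    by apply: sqr_steps_le; rewrite /s ge_min lexx ?orbT.
  by move=> h; rewrite [2 * D]mulrC -mulrA ler_wpM2l.
- exists (M + 1); first by rewrite addr_ge0.
  move=> k; rewrite lerD2r; apply: le_trans (hM k).
  by rewrite /Phi lerDl mulr_ge0// ltW.
Qed.

(** Once the iterates are bounded, [S], then [X], obey recursions with a constant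
    contraction and a forcing of order [max(b, g)^2]. *)
Lemma consensus_rates : (exists2 M, 0 <= M & forall k, E k + X k + 1 <= M) ->
  exists2 M, 0 <= M & forall k,
    X k <= M / time k `^ (2 * Num.min q p) /\ Y k <= M / time k `^ (2 * Num.min q p).
Proof.
move=> [M M0 hM]; have [r0 r1] := andP rhoP.
set s := 2 * Num.min q p.
have s_ge0 : 0 <= s by rewrite mulr_ge0// le_min q_ge0 ltW.
have sp : s <= 2 * p by rewrite ler_pM2l// ge_min lexx orbT.
have sq : s <= 2 * q by rewrite ler_pM2l// ge_min lexx.
have forcing k : b k ^+ 2 + g k ^+ 2 * (E k + X k + 1) <= 2 * (1 + M) / time k `^ s.
  apply: (@le_trans _ _ ((1 + M) * (b k ^+ 2 + g k ^+ 2))); last first.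
    by rewrite [2 * _]mulrC -mulrA ler_wpM2l ?sqr_steps_le// addr_ge0.
  have : g k ^+ 2 * (E k + X k + 1) <= g k ^+ 2 * M by rewrite ler_wpM2l ?sqr_ge0.
  have := sqr_ge0 (g k); have := mulr_ge0 M0 (sqr_ge0 (b k)); lra.
have M1 : 0 <= 2 * (1 + M) by rewrite mulr_ge0// addr_ge0.
have onem : 0 < 1 - rho by rewrite subr_gt0.
have [||||k _|MS MS0 hS] := @rate_recursion R S (1 - rho) (C * (2 * (1 + M))) 0 s 0 S_ge0 onem.
- by rewrite mulr_ge0.
- by rewrite lexx ler01.
- by [].
- by left.
- apply: le_trans (SP k) _; rewrite powRr0 divr1 mul1r subKr.
  by rewrite lerD2l -mulrA ler_wpM2l.
have forcingS k : S k + b k ^+ 2 + g k ^+ 2 * (E k + X k + 1) <= (MS + 2 * (1 + M)) / time k `^ s.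
  by have := forcing k; have := hS k; rewrite mulrDl; lra.
have MSM : 0 <= MS + 2 * (1 + M) by rewrite addr_ge0.
have [||||k _|MX MX0 hX] := @rate_recursion R X (1 - rho) (C * (MS + 2 * (1 + M))) 0 s 0 X_ge0 onem.
- by rewrite mulr_ge0.
- by rewrite lexx ler01.
- by [].
- by left.
- apply: le_trans (XP k) _; rewrite powRr0 divr1 mul1r subKr.
  by rewrite lerD2l -mulrA ler_wpM2l.
exists (MX + C * (MS + 2 * (1 + M))); first by rewrite addr_ge0 ?mulr_ge0.
move=> k; have T0 : 0 <= (time k `^ s)^-1 by rewrite invr_ge0 powR_ge0.
split.
  apply: le_trans (hX k) _; rewrite ler_wpM2r// lerDl mulr_ge0//.
apply: le_trans (YP k) _; apply: (@le_trans _ _ (C * (MS + 2 * (1 + M)) / time k `^ s)).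
  by rewrite -mulrA ler_wpM2l.
by rewrite ler_wpM2r// lerDr.
Qed.

(** The disagreement enters with weight [g], hence with order [t^(- 3 p)], and the
    noise with [t^(- 2 q)]; relative to the contraction [c / t^p] this leaves the
    two exponents of the minimum. *)
Lemma optimality_rate : p <= 1 -> p < q -> Num.min (2 * q - p) (2 * p) < c ->
  exists2 M, 0 <= M & forall k, E k <= M / time k `^ (Num.min (2 * q - p) (2 * p)).
Proof.
move=> p1 pq sc.
have [M M0 hM] := consensus_rates (bounded_large_step p1 (ltW pq)).
have {}hM k : X k <= M / time k `^ (2 * p).
  by have [+ _] := hM k; rewrite (min_r (ltW pq)).
move: sc; set s : R := Num.min _ _ => sc.
have s0 : 0 <= s.
  rewrite le_min subr_ge0 mulr_ge0 ?(ltW p_gt0)// andbT.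
  by apply: le_trans (ltW pq) _; rewrite ler_peMl// ler1n.
pose c' := (s + c) / 2.
have sc' : s < c' by rewrite /c'; lra.
have C1 : 0 < C + 1 by rewrite ltr_wpDl.
have e0 : 0 < (c - c') / (C + 1) by rewrite divr_gt0// subr_gt0 /c'; lra.
have [K hK] := eventually_small_step e0.
have [|||||k Kk|M' M'0 hM'] := @rate_recursion R E c' (C * M + C) p s K E_ge0.
- exact: le_lt_trans sc'.
- by rewrite addr_ge0 ?mulr_ge0.
- by rewrite p1 ltW.
- by [].
- by right.
- apply: le_trans (EP k) _; rewrite -addrA; apply: lerD.
    rewrite ler_wpM2r// -/(g k).
    have := hK k Kk; rewrite ler_pdivlMr// => h.
    have : C * g k ^+ 2 <= (c - c') * g k.
      rewrite expr2 mulrA ler_pM2r//; have := g_gt0 k; lra.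
    lra.
  have t0 := time_gt0 (R := R) k.
  have ps : time k `^ p * time k `^ s = time k `^ (p + s).
    by rewrite powRD// (gt_eqF t0) implybT.
  have h1 : C * g k * X k <= C * M / time k `^ (p + s).
    apply: (@le_trans _ _ (C * g k * (M / time k `^ (2 * p)))).
      by rewrite ler_wpM2l ?mulr_ge0// ltW.
    have -> : C * g k * (M / time k `^ (2 * p)) = C * M / time k `^ (p + 2 * p).
      rewrite powRD ?(gt_eqF t0) ?implybT// /g; field.
      by rewrite !gt_eqF ?powR_gt0.
    by rewrite ler_wpM2l ?mulr_ge0// time_powR_le// lerD2l ge_min lexx orbT.
  have h2 : C * b k ^+ 2 <= C / time k `^ (p + s).
    rewrite ler_wpM2l// /b time_powR_sqr time_powR_le//.
    by rewrite -lerBrDl ge_min lexx.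
  by rewrite ps mulrDl; exact: lerD.
by exists M'.
Qed.

End CoupledRecursion.

(** * Contraction for a constant step size *)

Section ContractionStep.
Context {R : realType}.

(** One step of the system with state [b] and input [g], in norms.  With the weight
    [2 / (1 - rho^2)], the energy spent on the output [b + g] beyond the decrease of
    the stored energy is at most [4 / (1 - rho)^2 * g^2]; keeping [b^2 / 4] as a
    margin multiplies this gain by [4 / 3]. *)
Lemma consensus_gain (rho b g : R) : 0 <= rho < 1 ->
  2 / (1 - rho ^+ 2) * (rho * b + (1 + rho) * g) ^+ 2 + (b + g) ^+ 2
  <= (2 / (1 - rho ^+ 2) - 1 / 4) * b ^+ 2 + 16 / 3 / (1 - rho) ^+ 2 * g ^+ 2.
Proof.
move=> /andP[r0 r1]; rewrite -subr_ge0.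
have d0 : 1 - rho != 0 by rewrite subr_eq0 gt_eqF.
have d1 : 1 + rho != 0 by rewrite gt_eqF// ltr_wpDr.
have -> : 1 - rho ^+ 2 = (1 - rho) * (1 + rho) by ring.
have -> : (2 / ((1 - rho) * (1 + rho)) - 1 / 4) * b ^+ 2 + 16 / 3 / (1 - rho) ^+ 2 * g ^+ 2 -
   (2 / ((1 - rho) * (1 + rho)) * (rho * b + (1 + rho) * g) ^+ 2 + (b + g) ^+ 2)
  = 3 / 4 * (b - 4 / 3 * (1 + rho) / (1 - rho) * g) ^+ 2
    + (4 - (1 + rho) ^+ 2) / (3 * (1 - rho) ^+ 2) * g ^+ 2.
  by field; rewrite d0 d1.
apply: addr_ge0; first by rewrite mulr_ge0 ?sqr_ge0 ?divr_ge0.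
rewrite mulr_ge0 ?sqr_ge0// divr_ge0 ?mulr_ge0 ?sqr_ge0//; nra.
Qed.

Variables (n : nat) (W : 'M[R]_n).
Hypotheses (n_gt0 : (0 < n)%N) (WP : coupling_matrix W).
Notation J := (averaging n : 'M[R]_n).
Notation Q := (1%:M - averaging n : 'M[R]_n).
Notation A := (W - averaging n).
Notation rho := (rho_w W).

(** A small-gain argument.  The disagreement part of the quadratic function stores
    the energy of the linear system from [Q u] to [Q z], of squared gain
    [4 h^2 / (1 - rho)^4], which is at most [(2 L^2)^-1] by hypothesis.  The mean
    part loses [2 h <u, z>], of which cocoercivity makes [2 h |u|^2 / L]; this
    covers both the energy fed in by [Q u] and the cross term [2 h <Q u, Q z>].
    If [Q = 0] there is a single agent and only the gradient step remains. *)
Lemma tracking_contraction (mu L h : R) : 0 < mu -> 0 < L -> 0 < h -> h * L < 2 ->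
  Q = 0 \/ 8 * (h * L) ^+ 2 <= (1 - rho) ^+ 4 ->
  exists kappa1 kappa2 delta : R, [/\ 0 < kappa1, 0 < kappa2, 0 < delta < 1 &
    forall r (z u B : 'M[R]_(n, r)),
    L^-1 * norm2 u ^+ 2 <= ip u z -> mu * norm2 z ^+ 2 <= ip u z ->
    norm2 (J *m z - h *: (J *m u)) ^+ 2
    + kappa1 * norm2 (A *m (Q *m z) - B - h *: (Q *m u)) ^+ 2
    + kappa2 * norm2 (A *m B - h *: ((1%:M - A) *m (Q *m u))) ^+ 2
    <= (1 - delta) * (norm2 (J *m z) ^+ 2 + kappa1 * norm2 (Q *m z) ^+ 2
                      + kappa2 * norm2 B ^+ 2)].
Proof.
move=> mu0 L0 h0 hL2 small; have rhoP := rho_w_lt1 n_gt0 WP; have [r0 r1] := andP rhoP.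
pose d := 1 - rho; have d0 : 0 < d by rewrite subr_gt0.
pose c := 2 / (1 - rho ^+ 2).
have rr0 : 0 < 1 - rho ^+ 2 by rewrite subr_gt0 expr_lt1.
have c0 : 0 < c by rewrite divr_gt0.
(* [h L] pays for the cross term, a quarter of it is the margin kept on [Q z] *)
pose kap := 5 / 4 * (h * L).
have kap0 : 0 < kap by rewrite !mulr_gt0// invr_gt0.
(* the share of strong monotonicity mixed into cocoercivity: [1 / 12] is what
   the terms in [|Q u|^2] leave, the other bound what those in [|J u|^2] leave *)
pose eps := Num.min (1 / 12) ((2 - h * L) / 2).
have eps0 : 0 < eps by rewrite lt_min !divr_gt0// subr_gt0.
have eps12 : eps <= 1 / 12 by rewrite ge_min lexx.
have epsL : h * L <= 2 * (1 - eps).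
  have : eps <= (2 - h * L) / 2 by rewrite ge_min lexx orbT.
  lra.
pose delta := Num.min (1 / 2) (Num.min (2 * h * eps * mu) (Num.min (d / 5) (1 / (4 * c)))).
have delta0 : 0 < delta.
  rewrite !lt_min; apply/and4P; split; [by rewrite divr_gt0|by rewrite !mulr_gt0
    |by rewrite divr_gt0|by apply: divr_gt0 => //; exact: mulr_gt0].
have delta1 : delta <= 1 / 2 by rewrite ge_min lexx.
have delta2 : delta <= 2 * h * eps * mu by rewrite !ge_min lexx !orbT.
have delta3 : delta <= d / 5 by rewrite !ge_min lexx !orbT.
have delta4 : delta <= 1 / (4 * c) by rewrite !ge_min lexx !orbT.
exists (kap / d), (kap * c / d ^+ 2), delta; split.
- by rewrite divr_gt0.
- exact: divr_gt0 (mulr_gt0 kap0 c0) (exprn_gt0 2 d0).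
- by rewrite delta0; lra.
move=> r z u B coco strong.
set x1 := norm2 (A *m (Q *m z) - B - h *: (Q *m u)).
set b1 := norm2 (A *m B - h *: ((1%:M - A) *m (Q *m u))).
pose x := norm2 (Q *m z); pose b := norm2 B; pose G := norm2 (Q *m u).
pose e := norm2 (J *m z); pose j := norm2 (J *m u).
rewrite -/x -/b -/e.
have gap : G ^+ 2 * (8 * (h * L) ^+ 2) <= G ^+ 2 * d ^+ 4.
  case: small => [Q0|]; last by move=> ?; rewrite ler_wpM2l ?sqr_ge0.
  by rewrite /G Q0 mul0mx norm2_0 expr0n !mul0r.
have x1_le : x1 <= rho * x + (b + h * G).
  apply: le_trans (norm2B _ _) _; rewrite norm2Z (gtr0_norm h0) addrA lerD2r.
  by apply: le_trans (norm2B _ _) _; rewrite lerD2r norm2_contraction.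
have b1_le : b1 <= rho * b + (1 + rho) * (h * G).
  apply: le_trans (norm2B _ _) _; apply: lerD; first exact: norm2_contraction.
  rewrite norm2Z (gtr0_norm h0) mulrCA ler_pM2l// mulmxBl mul1mx.
  apply: le_trans (norm2B _ _) _; rewrite mulrDl mul1r lerD2l.
  exact: norm2_contraction.
have x1sq : x1 ^+ 2 <= rho * x ^+ 2 + d^-1 * (b + h * G) ^+ 2.
  exact: sqr_contractD rhoP (norm2_ge0 _) x1_le.
have b1sq : b1 ^+ 2 <= (rho * b + (1 + rho) * (h * G)) ^+ 2.
  have b1_ge0 : 0 <= b1 by exact: norm2_ge0.
  by apply: lerXn2r; rewrite ?nnegrE// (le_trans b1_ge0).
have gain := consensus_gain b (h * G) rhoP; rewrite -/c -/d in gain.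
have zE : norm2 z ^+ 2 = e ^+ 2 + x ^+ 2 by exact: norm2_split.
have uE : norm2 u ^+ 2 = j ^+ 2 + G ^+ 2 by exact: norm2_split.
have E1 : norm2 (J *m z - h *: (J *m u)) ^+ 2
    = e ^+ 2 - 2 * h * ip u z + 2 * h * ip (Q *m u) (Q *m z) + h ^+ 2 * j ^+ 2.
  rewrite (ip_split n_gt0 u z) /e /j !norm2_sqr !ip_lin (ipC (J *m z)); ring.
have cross : 2 * h * ip (Q *m u) (Q *m z) <= h * (L * x ^+ 2 + L^-1 * G ^+ 2).
  rewrite [2 * h]mulrC -mulrA ler_pM2l//.
  have := cauchy_schwarz (Q *m u) (Q *m z); rewrite -/x -/G => cs.
  have := sqr_ge0 (L * x - G); rewrite -(pmulr_rge0 _ (_ : 0 < L^-1)) ?invr_gt0//.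
  have -> : L^-1 * (L * x - G) ^+ 2 = L * x ^+ 2 - 2 * (G * x) + L^-1 * G ^+ 2.
    by field; rewrite gt_eqF.
  lra.
have mix : (1 - eps) * (L^-1 * (j ^+ 2 + G ^+ 2)) + eps * (mu * (e ^+ 2 + x ^+ 2)) <= ip u z.
  rewrite -uE -zE; have -> : ip u z = (1 - eps) * ip u z + eps * ip u z by ring.
  by apply: lerD; rewrite ler_wpM2l//; lra.
have V1 : kap / d * x1 ^+ 2 + kap * c / d ^+ 2 * b1 ^+ 2
  <= kap / d * x ^+ 2 - kap * x ^+ 2 + kap * c / d ^+ 2 * b ^+ 2
     - kap / (4 * d ^+ 2) * b ^+ 2 + 16 / 3 * kap / d ^+ 4 * (h * G) ^+ 2.
  have s1 : kap / d * x1 ^+ 2 <= kap / d * (rho * x ^+ 2 + d^-1 * (b + h * G) ^+ 2).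
    by apply: ler_wpM2l x1sq; apply/ltW/divr_gt0.
  have s2 : kap / d ^+ 2 * (c * b1 ^+ 2 + (b + h * G) ^+ 2) <=
      kap / d ^+ 2 * ((c - 1 / 4) * b ^+ 2 + 16 / 3 / d ^+ 2 * (h * G) ^+ 2).
    apply: ler_wpM2l; first exact/ltW/(divr_gt0 kap0 (exprn_gt0 2 d0)).
    by apply: le_trans gain; rewrite lerD2r ler_pM2l.
  have e1 : kap / d * (rho * x ^+ 2 + d^-1 * (b + h * G) ^+ 2)
      = kap / d * x ^+ 2 - kap * x ^+ 2 + kap / d ^+ 2 * (b + h * G) ^+ 2.
    have -> : rho = 1 - d by rewrite /d; ring.
    by field; rewrite gt_eqF.
  have e2 : kap / d ^+ 2 * ((c - 1 / 4) * b ^+ 2 + 16 / 3 / d ^+ 2 * (h * G) ^+ 2)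
     = kap * c / d ^+ 2 * b ^+ 2 - kap / (4 * d ^+ 2) * b ^+ 2
       + 16 / 3 * kap / d ^+ 4 * (h * G) ^+ 2 by field; rewrite gt_eqF.
  have e3 : kap / d ^+ 2 * (c * b1 ^+ 2 + (b + h * G) ^+ 2)
    = kap * c / d ^+ 2 * b1 ^+ 2 + kap / d ^+ 2 * (b + h * G) ^+ 2 by ring.
  rewrite e1 in s1; rewrite e2 e3 in s2; lra.
(* this is where the small-gain hypothesis enters *)
have GG : 16 / 3 * kap / d ^+ 4 * (h * G) ^+ 2 <= 5 / 6 * (h * (L^-1 * G ^+ 2)).
  have -> : 16 / 3 * kap / d ^+ 4 * (h * G) ^+ 2
      = 5 / 6 * (h * (L^-1 * (G ^+ 2 * (8 * (h * L) ^+ 2) / d ^+ 4))).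
    by rewrite /kap; field; rewrite !gt_eqF.
  rewrite ler_pM2l ?divr_gt0// ler_pM2l// ler_pM2l ?invr_gt0//.
  by rewrite ler_pdivrMr ?exprn_gt0.
have jj : h ^+ 2 * j ^+ 2 <= 2 * h * (1 - eps) * (L^-1 * j ^+ 2).
  have -> : 2 * h * (1 - eps) * (L^-1 * j ^+ 2) = h * (L^-1 * (2 * (1 - eps))) * j ^+ 2 by ring.
  rewrite ler_wpM2r ?sqr_ge0// expr2 ler_pM2l// mulrC ler_pdivlMr//.
have Geps : eps * (h * (L^-1 * G ^+ 2)) <= 1 / 12 * (h * (L^-1 * G ^+ 2)).
  apply: ler_wpM2r eps12; apply: mulr_ge0 (ltW h0) (mulr_ge0 _ (sqr_ge0 _)).
  by rewrite invr_ge0 ltW.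
have main : norm2 (J *m z - h *: (J *m u)) ^+ 2 + (kap / d * x1 ^+ 2 + kap * c / d ^+ 2 * b1 ^+ 2)
  <= e ^+ 2 + kap / d * x ^+ 2 + kap * c / d ^+ 2 * b ^+ 2
     - 2 * h * eps * mu * e ^+ 2 - h * L / 4 * x ^+ 2 - kap / (4 * d ^+ 2) * b ^+ 2.
  have := ler_wpM2l (ltW h0) mix.
  have := mulr_ge0 (ltW h0) (mulr_ge0 (ltW eps0) (mulr_ge0 (ltW mu0) (sqr_ge0 x))).
  rewrite E1; move: V1 GG jj Geps cross.
  set P1 := kap / d * x1 ^+ 2; set P2 := kap * c / d ^+ 2 * b1 ^+ 2.
  have -> : kap * x ^+ 2 = 5 / 4 * (h * L * x ^+ 2) by rewrite /kap; ring.
  lra.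
have pe : delta * e ^+ 2 <= 2 * h * eps * mu * e ^+ 2 by rewrite ler_wpM2r ?sqr_ge0.
have px : delta * (kap / d * x ^+ 2) <= h * L / 4 * x ^+ 2.
  have -> : h * L / 4 * x ^+ 2 = d / 5 * (kap / d * x ^+ 2).
    by rewrite /kap; field; rewrite gt_eqF.
  by apply: ler_wpM2r delta3; apply: mulr_ge0 (sqr_ge0 _); apply/ltW/divr_gt0.
have pb : delta * (kap * c / d ^+ 2 * b ^+ 2) <= kap / (4 * d ^+ 2) * b ^+ 2.
  have -> : kap / (4 * d ^+ 2) * b ^+ 2 = 1 / (4 * c) * (kap * c / d ^+ 2 * b ^+ 2).
    by field; rewrite !gt_eqF.
  apply: ler_wpM2r delta4; apply: mulr_ge0 (sqr_ge0 _).
  exact/ltW/(divr_gt0 (mulr_gt0 kap0 c0) (exprn_gt0 2 d0)).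
move: main pe px pb.
set P1 := kap / d * x1 ^+ 2; set P2 := kap * c / d ^+ 2 * b1 ^+ 2.
set P3 := kap / d * x ^+ 2; set P4 := kap * c / d ^+ 2 * b ^+ 2.
lra.
Qed.

(** The last bound on [h] says that [c41 h^4 + c42 h^2 < 1].  For two agents or more
    [d_I >= 1], so [c42 h^2 < 1] gives
    [64 (1 + rho^2) (h L)^2 < (1 - rho^2)^4], and [(1 + rho)^4 <= 8 (1 + rho^2)]. *)
Lemma stepsize_condition (mu L h : R) : 0 < mu -> mu <= L -> 0 < h ->
  (h%:E < stepsize_bound W mu L)%E ->
  h * L < 2 /\ (Q = 0 \/ 8 * (h * L) ^+ 2 <= (1 - rho) ^+ 4).
Proof.
move=> mu0 muL h0; have L0 := lt_le_trans mu0 muL.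
have rhoP := rho_w_lt1 n_gt0 WP; have [r0 r1] := andP rhoP.
rewrite /stepsize_bound !lt_min => /and3P[h1 _ h3].
have muL0 : 0 < mu + L by rewrite addr_gt0.
have hmuL : h * (mu + L) < 2.
  by move: h1; rewrite inver (gt_eqF muL0) -EFinM lte_fin ltr_pdivlMr.
split; first by apply: le_lt_trans hmuL; rewrite ler_pM2l// lerDr ltW.
have [n1|n_gt1] := leqP n 1.
  left; have {n1} n1 : n = 1%N by apply/eqP; rewrite eqn_leq n1.
  apply: norm2_eq0; apply/eqP; rewrite -sqrf_eq0.
  by have := d_I_sqr (R := R) n_gt0; rewrite /d_I => ->; rewrite n1 subrr.
right.
have dI1 : 1 <= d_I n ^+ 2 :> R.
  by rewrite d_I_sqr// lerBrDr -[leLHS]/(2%:R) ler_nat.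
have rr0 : 0 < 1 - rho ^+ 2 by rewrite subr_gt0 expr_lt1.
pose d4 := (1 - rho ^+ 2) ^+ 4; have d40 : 0 < d4 by rewrite exprn_gt0.
pose c42' := 64 * (1 + rho ^+ 2) * L ^+ 2 / d4.
have c42'_gt0 : 0 < c42' by rewrite divr_gt0// !mulr_gt0 ?exprn_gt0// ltr_wpDr ?sqr_ge0.
have c42_ge : c42' <= c42 W mu L.
  have -> : c42 W mu L = c42' * ((mu + L + 2 * L ^+ 2) / (mu + L)) * d_I n ^+ 2.
    by rewrite /c42 /c42' /d4; field; rewrite !gt_eqF.
  rewrite -mulrA ler_peMr ?(ltW c42'_gt0)// -[leLHS]mulr1 ler_pM//.
  by rewrite ler_pdivlMr// mul1r lerDl mulr_ge0 ?sqr_ge0.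
have c42_gt0 : 0 < c42 W mu L by exact: lt_le_trans c42_ge.
have c41_ge0 : 0 <= c41 W mu L.
  have n1 : 0 <= 1 + rho ^+ 2 by rewrite addr_ge0 ?sqr_ge0.
  have n2 : 0 <= 3 * mu + L by rewrite addr_ge0 ?(ltW L0) ?mulr_ge0 ?(ltW mu0).
  apply: divr_ge0; last exact: mulr_ge0 (exprn_ge0 4 (ltW rr0)) (ltW muL0).
  apply: mulr_ge0 (sqr_ge0 _); apply: mulr_ge0 (exprn_ge0 6 (ltW L0)).
  by rewrite !mulr_ge0.
pose D := c42 W mu L + Num.sqrt (c42 W mu L ^+ 2 + 4 * c41 W mu L).
have D_ge : 2 * c42 W mu L <= D.
  rewrite /D mulr_natl mulr2n lerD2l.
  rewrite -[leLHS]ger0_norm ?(ltW c42_gt0)// -sqrtr_sqr ler_wsqrtr//.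
  by rewrite lerDl mulr_ge0.
have D0 : 0 < D by apply: lt_le_trans D_ge; rewrite mulr_gt0.
have h2D : h ^+ 2 * D < 2.
  move: h3; rewrite -/D inver (gt_eqF D0) -EFinM /= lte_fin => h3.
  rewrite -ltr_pdivlMr// -(@sqr_sqrtr _ (2 / D)) ?divr_ge0 ?(ltW D0)//.
  by rewrite ltr_pXn2r ?nnegrE ?sqrtr_ge0 ?(ltW h0).
have h2c : h ^+ 2 * c42' < 1.
  have : h ^+ 2 * (2 * c42') <= h ^+ 2 * D.
    by rewrite ler_wpM2l ?sqr_ge0//; apply: le_trans D_ge; rewrite ler_pM2l.
  lra.
have key : 64 * (1 + rho ^+ 2) * (h * L) ^+ 2 < d4.
  have -> : 64 * (1 + rho ^+ 2) * (h * L) ^+ 2 = (h ^+ 2 * c42') * d4.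
    by rewrite /c42'; field; rewrite gt_eqF.
  by rewrite -[ltRHS]mul1r ltr_pM2r.
have d4E : d4 = (1 - rho) ^+ 4 * (1 + rho) ^+ 4 by rewrite /d4; ring.
have p4 : (1 + rho) ^+ 4 <= 8 * (1 + rho ^+ 2).
  have a1 : (1 + rho) ^+ 2 <= 4 by nra.
  have a2 : (1 + rho) ^+ 2 <= 2 * (1 + rho ^+ 2) by have := sqr_ge0 (1 - rho); lra.
  have -> : (1 + rho) ^+ 4 = (1 + rho) ^+ 2 * (1 + rho) ^+ 2 by ring.
  have -> : 8 * (1 + rho ^+ 2) = 4 * (2 * (1 + rho ^+ 2)) by ring.
  by rewrite ler_pM ?sqr_ge0.
have one : 0 < 8 * (1 + rho ^+ 2) by rewrite mulr_gt0// ltr_wpDr ?sqr_ge0.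
rewrite -(ler_pM2l one); apply: (@le_trans _ _ d4).
  by apply: le_trans (ltW key); rewrite le_eqVlt; apply/orP; left; apply/eqP; ring.
by rewrite d4E mulrC ler_wpM2r ?exprn_ge0 ?subr_ge0 ?(ltW r1).
Qed.

End ContractionStep.

(** * One step of the algorithm *)

Section AlgorithmStep.
Context {R : realType} (n r : nat).
Variables (f : 'I_n -> 'rV[R]_r -> R) (mu L alpha : R) (W : 'M[R]_n).
Variable xs : 'rV[R]_r.
Hypotheses (n_gt0 : (0 < n)%N) (WP : coupling_matrix W).
Hypotheses (mu_gt0 : 0 < mu) (L_gt0 : 0 < L) (alpha_gt0 : 0 < alpha).
Hypothesis fP : forall i, objective_class mu L (f i).
Hypothesis xsP : averaging n *m stacked_grad f (ones n *m xs) = 0.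
Notation J := (averaging n : 'M[R]_n).
Notation Q := (1%:M - averaging n : 'M[R]_n).
Notation A := (W - averaging n).
Notation rho := (rho_w W).
Notation Wo := (offdiag W).
Notation us := (stacked_grad f (ones n *m xs)).

Definition deviation (x : 'M[R]_(n, r)) := x - ones n *m xs.
Definition grad_deviation (x : 'M[R]_(n, r)) := stacked_grad f x - us.
Local Notation z := deviation.
Local Notation u := grad_deviation.

Definition next_s (b g : R) (s x e : 'M[R]_(n, r)) :=
  W *m s + b *: (Wo *m e) + g *: stacked_grad f x.
Definition next_x (b g : R) (s x e v : 'M[R]_(n, r)) :=
  W *m x + b *: (Wo *m v) - alpha *: (next_s b g s x e - s).

Let QW : Q *m W = A.
Proof. by rewrite mulmxBl mul1mx (averaging_coupling WP). Qed.
Let AQ : A *m Q = A.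
Proof.
rewrite mulmxBr mulmx1 mulmxBl (coupling_averaging WP) averaging_idem//.
by rewrite subrr subr0.
Qed.
Let stacked_gradE x : stacked_grad f x = u x + us.
Proof. by rewrite /u subrK. Qed.

Let M_ones (M : 'M[R]_n) : M *m ones n = 0 -> M *m (ones n *m xs) = 0.
Proof. by move=> M0; rewrite mulmxA M0 mul0mx. Qed.

Lemma mean_step b g s x e v :
  J *m z (next_x b g s x e v) =
  J *m z x - (alpha * g) *: (J *m u x) + b *: (J *m (Wo *m v - alpha *: (Wo *m e))).
Proof.
rewrite /next_x /next_s {1}/z stacked_gradE; move: (u x) => ux.
rewrite !(mulmxBr, mulmxDr, mulmxN, =^~ scalemxAr) !mulmxA.
rewrite (averaging_coupling WP) xsP.
move: (J *m x) (J *m ux) (J *m Wo *m v) (J *m Wo *m e) (J *m ones n *m xs) (J *m s).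
by move=> *; apply/matrixP => i j; rewrite !mxE; ring.
Qed.

Lemma tracker_step b g s x e :
  Q *m next_s b g s x e
  = A *m (Q *m s) + (b *: (Q *m (Wo *m e)) + g *: (Q *m (u x + us))).
Proof.
rewrite /next_s stacked_gradE !(mulmxDr, =^~ scalemxAr) !mulmxA QW AQ addrA.
by [].
Qed.

Lemma consensus_step b g s x e v :
  Q *m z (next_x b g s x e v) =
  A *m (Q *m z x) + (b *: (Q *m (Wo *m v)) - alpha *: (Q *m (next_s b g s x e - s))).
Proof.
rewrite /next_x {1}/z; move: (next_s b g s x e - s) => y.
rewrite !(mulmxBr Q) !mulmxDr -!scalemxAr (M_ones (disagreement_ones n_gt0)) subr0.
rewrite (mulmxA Q W x) QW (mulmxA A Q) AQ oppr0 mulmx0 addr0 addrA.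
by [].
Qed.

(** The increment of [alpha s] splits into [alpha (W - 1) s], whose value at
    equilibrium is [- h Q us], and the fresh gradient; this is the deviation of the
    former from that value. *)
Definition tracking_error (h : R) (s : 'M[R]_(n, r)) :=
  alpha *: ((W - 1%:M) *m s) + h *: (Q *m us).
Local Notation B := tracking_error.

Let QWm1 : Q *m (W - 1%:M) = W - 1%:M.
Proof. by rewrite mulmxBr QW mulmx1; apply/matrixP => i j; rewrite !mxE; ring. Qed.

Lemma increment_tracking b g s x e :
  alpha *: (Q *m (next_s b g s x e - s)) =
  B (alpha * g) s + (alpha * g) *: (Q *m u x) + (alpha * b) *: (Q *m (Wo *m e)).
Proof.
have -> : next_s b g s x e - s
  = (W - 1%:M) *m s + b *: (Wo *m e) + g *: (u x + us).
  rewrite /next_s stacked_gradE mulmxBl mul1mx.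
  by move: (W *m s) (Wo *m e) => *; apply/matrixP => i j; rewrite !mxE; ring.
rewrite /B !mulmxDr -!scalemxAr !mulmxDr (mulmxA Q (W - 1%:M)) QWm1.
move: ((W - 1%:M) *m s) (Q *m u x) (Q *m us) (Q *m (Wo *m e)).
by move=> *; apply/matrixP => i j; rewrite !mxE; ring.
Qed.

Lemma consensus_step_tracking b g s x e v :
  Q *m z (next_x b g s x e v) =
  (A *m (Q *m z x) - B (alpha * g) s - (alpha * g) *: (Q *m u x))
  + b *: (Q *m (Wo *m v - alpha *: (Wo *m e))).
Proof.
rewrite consensus_step increment_tracking; move: (z x) (u x) => zx ux.
rewrite mulmxBr -scalemxAr.
move: (A *m (Q *m zx)) (B _ _) (Q *m ux) (Q *m (Wo *m e)) (Q *m (Wo *m v)).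
by move=> *; apply/matrixP => i j; rewrite !mxE; ring.
Qed.

Lemma tracking_step b g s x e :
  B (alpha * g) (next_s b g s x e) =
  (A *m B (alpha * g) s - (alpha * g) *: ((1%:M - A) *m (Q *m u x)))
  + b *: (alpha *: ((W - 1%:M) *m (Wo *m e))).
Proof.
have Aus M : A *m (Q *m M) = A *m M :> 'M[R]_(n, r) by rewrite mulmxA AQ.
have Ws : A *m ((W - 1%:M) *m s) = (W - 1%:M) *m (W *m s).
  rewrite !mulmxA; congr (_ *m _).
  rewrite !(mulmxBl, mulmxBr) !mulmx1 !mul1mx (averaging_coupling WP).
  by move: (W *m W) J => WW J'; apply/matrixP => i j; rewrite !mxE; ring.
have Jus M : J *m M = M - Q *m M :> 'M[R]_(n, r) by rewrite mulmxBl mul1mx subKr.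
have W1 M : (W - 1%:M) *m M = A *m M - Q *m M :> 'M[R]_(n, r).
  rewrite -mulmxBl; congr (_ *m _).
  by apply/matrixP => i j; rewrite !mxE; ring.
have Qus : Q *m us = us by rewrite mulmxBl mul1mx xsP subr0.
rewrite /B /next_s stacked_gradE; move: (u x) => ux.
rewrite [in LHS]mulmxDr [in LHS]mulmxDr.
rewrite -[in LHS](scalemxAr b) -[in LHS](scalemxAr g) -Ws.
rewrite [(W - 1%:M) *m (ux + us)]W1 !mulmxDr -!scalemxAr Qus.
have -> : (1%:M - A) *m (Q *m ux) = Q *m ux - A *m ux.
  by rewrite mulmxBl mul1mx Aus.
move: (A *m ((W - 1%:M) *m s)) (Q *m ux) (A *m us) (A *m ux) ((W - 1%:M) *m (Wo *m e)).
by move=> ? ? ? ? ?; move: us => ?; apply/matrixP => i j; rewrite !mxE; ring.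
Qed.

Lemma norm2_offdiag (e : 'M[R]_(n, r)) :
  norm2 (Wo *m e) ^+ 2 <= norm2 Wo ^+ 2 * norm2 e ^+ 2.
Proof. by rewrite -exprMn; apply: ler_sqr_norm => //; exact: norm2_mulmx. Qed.

Definition noise_gain := 2 * (1 + alpha ^+ 2) * norm2 Wo ^+ 2.

Lemma noise_gain_ge0 : 0 <= noise_gain.
Proof. by rewrite mulr_ge0 ?sqr_ge0// mulr_ge0// addr_ge0 ?sqr_ge0. Qed.

Lemma noise_le (e v : 'M[R]_(n, r)) :
  norm2 (Wo *m v - alpha *: (Wo *m e)) ^+ 2
  <= noise_gain * (norm2 e ^+ 2 + norm2 v ^+ 2).
Proof.
apply: le_trans (norm2_sqrB _ _) _; rewrite norm2Z_sqr.
have h1 := norm2_offdiag v; have h2 := norm2_offdiag e.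
have := ler_wpM2l (sqr_ge0 alpha) h2.
have := mulr_ge0 (sqr_ge0 (norm2 Wo)) (sqr_ge0 (norm2 e)).
have := mulr_ge0 (sqr_ge0 alpha) (mulr_ge0 (sqr_ge0 (norm2 Wo)) (sqr_ge0 (norm2 v))).
rewrite /noise_gain; lra.
Qed.

Lemma offdiag_noise_le (e v : 'M[R]_(n, r)) :
  norm2 (Wo *m e) ^+ 2 <= norm2 Wo ^+ 2 * (norm2 e ^+ 2 + norm2 v ^+ 2).
Proof.
by apply: le_trans (norm2_offdiag _) _; rewrite ler_wpM2l ?sqr_ge0// lerDl sqr_ge0.
Qed.

Lemma norm2_disagreement_sqr (X : 'M[R]_(n, r)) : norm2 (Q *m X) ^+ 2 <= norm2 X ^+ 2.
Proof. by apply: ler_sqr_norm => //; exact: norm2_disagreement. Qed.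

Lemma norm2_averaging_sqr (X : 'M[R]_(n, r)) : norm2 (J *m X) ^+ 2 <= norm2 X ^+ 2.
Proof. by apply: ler_sqr_norm => //; exact: norm2_averaging. Qed.

Lemma grad_deviation_le x : norm2 (u x) ^+ 2 <= L ^+ 2 * norm2 (z x) ^+ 2.
Proof. by rewrite -exprMn; apply: ler_sqr_norm => //; exact: stacked_lipschitz fP _ _. Qed.

Lemma increment_bound h b g s x e : h = alpha * g -> 
  norm2 (Q *m (next_s b g s x e - s)) ^+ 2 <=
  4 / alpha ^+ 2 * (norm2 (B h s) ^+ 2 + h ^+ 2 * L ^+ 2 * norm2 (z x) ^+ 2
                    + alpha ^+ 2 * norm2 Wo ^+ 2 * (b ^+ 2 * norm2 e ^+ 2)).
Proof.
move=> hE; have a2 : 0 < alpha ^+ 2 by rewrite exprn_gt0.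
rewrite -(ler_pM2l a2) -(norm2Z_sqr alpha (Q *m _)) increment_tracking -hE.
rewrite [leRHS]mulrA [alpha ^+ 2 * (4 / _)]mulrC divfK ?gt_eqF//.
apply: le_trans (norm2_sqrD _ _) _.
have h1 := norm2_sqrD (B h s) (h *: (Q *m u x)).
have h2 : norm2 (h *: (Q *m u x)) ^+ 2 <= h ^+ 2 * (L ^+ 2 * norm2 (z x) ^+ 2).
  rewrite norm2Z_sqr ler_wpM2l ?sqr_ge0//.
  by apply: le_trans (norm2_disagreement_sqr _) _; exact: grad_deviation_le.
have h3 : norm2 ((alpha * b) *: (Q *m (Wo *m e))) ^+ 2
    <= (alpha * b) ^+ 2 * (norm2 Wo ^+ 2 * norm2 e ^+ 2).
  rewrite norm2Z_sqr ler_wpM2l ?sqr_ge0//.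
  by apply: le_trans (norm2_disagreement_sqr _) _; exact: norm2_offdiag.
have := mulr_ge0 (sqr_ge0 (alpha * b)) (mulr_ge0 (sqr_ge0 (norm2 Wo)) (sqr_ge0 (norm2 e))).
move: h1 h2 h3; move: (norm2 _) (norm2 _) (norm2 _) (norm2 _) (norm2 _) (norm2 _) (norm2 _) => *.
lra.
Qed.

Lemma geometric_step h g : 0 < g -> h = alpha * g -> h * L < 2 ->
  Q = 0 \/ 8 * (h * L) ^+ 2 <= (1 - rho) ^+ 4 ->
  exists kappa1 kappa2 delta C : R,
    [/\ 0 < kappa1, 0 < kappa2, 0 < delta < 1, 0 <= C &
    forall b s x e v,
    norm2 (J *m z (next_x b g s x e v)) ^+ 2
    + kappa1 * norm2 (Q *m z (next_x b g s x e v)) ^+ 2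
    + kappa2 * norm2 (B h (next_s b g s x e)) ^+ 2
    <= (1 - delta) * (norm2 (J *m z x) ^+ 2 + kappa1 * norm2 (Q *m z x) ^+ 2
                      + kappa2 * norm2 (B h s) ^+ 2)
       + C * (b ^+ 2 * (norm2 e ^+ 2 + norm2 v ^+ 2))].
Proof.
move=> g0 hE hL small; have h0 : 0 < h by rewrite hE mulr_gt0.
have [k1 [k2 [dl [k10 k20 dlP contr]]]] := tracking_contraction n_gt0 WP mu_gt0 L_gt0 h0 hL small.
have [d0 d1] := andP dlP.
pose K := noise_gain + k1 * noise_gain + k2 * (alpha ^+ 2 * norm2 (W - 1%:M) ^+ 2 * norm2 Wo ^+ 2).
have K0 : 0 <= K.
  rewrite /K; apply: addr_ge0; first apply: addr_ge0.
  - exact: noise_gain_ge0.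
  - exact: mulr_ge0 (ltW k10) noise_gain_ge0.
  - exact: mulr_ge0 (ltW k20) (mulr_ge0 (mulr_ge0 (sqr_ge0 _) (sqr_ge0 _)) (sqr_ge0 _)).
have di : 0 <= 1 + dl^-1 by rewrite addr_ge0// invr_ge0 ltW.
exists k1, k2, (dl ^+ 2), ((1 + dl^-1) * K); split=> //.
- by rewrite exprn_gt0//= expr_lt1// ltW.
- exact: mulr_ge0.
move=> b s x e v; rewrite mean_step consensus_step_tracking hE tracking_step -hE.
set N := norm2 e ^+ 2 + norm2 v ^+ 2.
have N0 : 0 <= N by rewrite addr_ge0 ?sqr_ge0.
have := contr r (z x) (u x) (B h s) (stacked_cocoercive mu_gt0 L_gt0 fP _ _) (stacked_strong fP _ _).
set E1 := J *m z x - _; set X1 := A *m (Q *m z x) - B h s - _; set B1 := A *m B h s - _.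
set V := norm2 (J *m z x) ^+ 2 + _ + _ => main.
have nJ : norm2 (b *: (J *m (Wo *m v - alpha *: (Wo *m e)))) ^+ 2 <= b ^+ 2 * (noise_gain * N).
  rewrite norm2Z_sqr ler_wpM2l ?sqr_ge0//.
  by apply: le_trans (norm2_averaging_sqr _) _; exact: noise_le.
have nQ : norm2 (b *: (Q *m (Wo *m v - alpha *: (Wo *m e)))) ^+ 2 <= b ^+ 2 * (noise_gain * N).
  rewrite norm2Z_sqr ler_wpM2l ?sqr_ge0//.
  by apply: le_trans (norm2_disagreement_sqr _) _; exact: noise_le.
have nB : norm2 (b *: (alpha *: ((W - 1%:M) *m (Wo *m e)))) ^+ 2
    <= b ^+ 2 * (alpha ^+ 2 * norm2 (W - 1%:M) ^+ 2 * norm2 Wo ^+ 2 * N).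
  rewrite !norm2Z_sqr ler_wpM2l ?sqr_ge0//.
  rewrite [leRHS](_ : _ = alpha ^+ 2 * (norm2 (W - 1%:M) ^+ 2 * (norm2 Wo ^+ 2 * N))); last by ring.
  rewrite ler_wpM2l ?sqr_ge0//.
  apply: le_trans (_ : norm2 (W - 1%:M) ^+ 2 * norm2 (Wo *m e) ^+ 2 <= _).
    by rewrite -exprMn; apply: ler_sqr_norm => //; exact: norm2_mulmx.
  by rewrite ler_wpM2l ?sqr_ge0//; exact: offdiag_noise_le.
have yE := norm2_young E1 (b *: (J *m (Wo *m v - alpha *: (Wo *m e)))) d0.
have yX := norm2_young X1 (b *: (Q *m (Wo *m v - alpha *: (Wo *m e)))) d0.
have yB := norm2_young B1 (b *: (alpha *: ((W - 1%:M) *m (Wo *m e)))) d0.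
have yE' := le_trans yE (lerD (lexx _) (ler_wpM2l di nJ)).
have yX' := ler_wpM2l (ltW k10) (le_trans yX (lerD (lexx _) (ler_wpM2l di nQ))).
have yB' := ler_wpM2l (ltW k20) (le_trans yB (lerD (lexx _) (ler_wpM2l di nB))).
apply: le_trans (lerD (lerD yE' yX') yB') _.
have d1' : 0 <= 1 + dl by rewrite addr_ge0// ltW.
have := ler_wpM2l d1' main.
clear; rewrite /K; move: (norm2 E1 ^+ 2) (norm2 X1 ^+ 2) (norm2 B1 ^+ 2).
move: noise_gain (norm2 Wo ^+ 2) (norm2 (W - 1%:M) ^+ 2) dl^-1 => *; lra.
Qed.

(** Strong monotonicity holds for the pair [(u, z)] only; replacing [z] by its mean
    costs the cross term with the disagreement, which Young's inequality splits
    between [mu |z|^2] and [|Q z|^2]. *)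
Lemma mean_contraction h x : 0 < h ->
  norm2 (J *m z x - h *: (J *m u x)) ^+ 2 <=
  (1 - h * mu + h ^+ 2 * L ^+ 2) * norm2 (J *m z x) ^+ 2
  + (h * (L ^+ 2 / mu) + h ^+ 2 * L ^+ 2) * norm2 (Q *m z x) ^+ 2.
Proof.
move=> h0; have strong := stacked_strong fP x (ones n *m xs).
rewrite -/(z x) -/(u x) in strong.
have zE : norm2 (z x) ^+ 2 = norm2 (J *m z x) ^+ 2 + norm2 (Q *m z x) ^+ 2.
  exact: norm2_split.
have E1 : norm2 (J *m z x - h *: (J *m u x)) ^+ 2 = norm2 (J *m z x) ^+ 2
   - 2 * h * ip (u x) (z x) + 2 * h * ip (Q *m u x) (Q *m z x) + h ^+ 2 * norm2 (J *m u x) ^+ 2.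
  move: (z x) (u x) => zx ux.
  rewrite (ip_split n_gt0 ux zx) !norm2_sqr !ip_lin (ipC (J *m zx) (J *m ux)); ring.
have ju : norm2 (J *m u x) ^+ 2 <= L ^+ 2 * norm2 (z x) ^+ 2.
  by apply: le_trans (norm2_averaging_sqr _) _; exact: grad_deviation_le.
have cross : 2 * ip (Q *m u x) (Q *m z x) <=
    mu * norm2 (z x) ^+ 2 + L ^+ 2 / mu * norm2 (Q *m z x) ^+ 2.
  have cs := cauchy_schwarz (Q *m u x) (Q *m z x).
  have qu : norm2 (Q *m u x) <= L * norm2 (z x).
    by apply: le_trans (norm2_disagreement n_gt0 _) _; exact: stacked_lipschitz fP _ _.
  have := le_trans cs (ler_wpM2r (norm2_ge0 (Q *m z x)) qu).
  have i0 : 0 <= mu^-1 by rewrite invr_ge0 ltW.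
  have := mulr_ge0 i0 (sqr_ge0 (mu * norm2 (z x) - L * norm2 (Q *m z x))).
  move: (norm2 (z x)) (norm2 (Q *m z x)) (ip _ _) => a c t.
  have -> : mu^-1 * (mu * a - L * c) ^+ 2
      = mu * a ^+ 2 - 2 * (L * a * c) + L ^+ 2 / mu * c ^+ 2 by field; rewrite gt_eqF.
  lra.
have := ler_wpM2l (sqr_ge0 h) ju; have := ler_wpM2l (ltW h0) cross.
have := ler_wpM2l (ltW h0) strong.
have := mulr_ge0 (ltW h0) (mulr_ge0 (ltW mu_gt0) (sqr_ge0 (norm2 (Q *m z x)))).
rewrite E1 zE; lra.
Qed.

Lemma diminishing_step gam : 0 < gam -> exists2 C, 0 <= C &
  forall b t s x e v, 0 < t <= 1 ->
  let N := norm2 e ^+ 2 + norm2 v ^+ 2 in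
  let Em := norm2 (J *m z x) ^+ 2 in let Xm := norm2 (Q *m z x) ^+ 2 in
  let Sm := norm2 (Q *m s) ^+ 2 in
  let T := b ^+ 2 * N + t ^+ 2 * (Em + Xm + 1) in
  [/\ norm2 (Q *m next_s b (gam * t) s x e) ^+ 2 <= rho * Sm + C * T,
      norm2 (Q *m (next_s b (gam * t) s x e - s)) ^+ 2 <= C * (Sm + T),
      norm2 (Q *m z (next_x b (gam * t) s x e v)) ^+ 2 <= rho * Xm + C * (Sm + T),
      norm2 (J *m z x - (alpha * (gam * t)) *: (J *m u x)) ^+ 2
        <= (1 - alpha * gam * mu * t + C * t ^+ 2) * Em + C * t * Xm &
      norm2 (J *m (Wo *m v - alpha *: (Wo *m e))) ^+ 2 <= C * N].
Proof.
move=> gam0; have rhoP := rho_w_lt1 n_gt0 WP; have [r0 r1] := andP rhoP.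
have di0 : 0 <= (1 - rho)^-1 by rewrite invr_ge0 subr_ge0 ltW.
pose om := norm2 Wo ^+ 2; have om0 : 0 <= om by exact: sqr_ge0.
have ag0 : 0 < alpha * gam by exact: mulr_gt0.
pose c1 := (1 - rho)^-1 * (2 * om + 4 * gam ^+ 2 * (L ^+ 2 + norm2 us ^+ 2)).
pose c2 := 4 + 2 * c1.
pose c3 := (1 - rho)^-1 * (2 * om + 2 * alpha ^+ 2 * c2).
pose c4 := alpha * gam * (L ^+ 2 / mu) + (alpha * gam) ^+ 2 * L ^+ 2.
have c10 : 0 <= c1.
  apply: mulr_ge0 => //; rewrite addr_ge0 ?(mulr_ge0 _ om0)//.
  by apply: mulr_ge0; [rewrite mulr_ge0 ?sqr_ge0|rewrite addr_ge0 ?sqr_ge0].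
have c20 : 0 <= c2 by rewrite /c2; lra.
have c30 : 0 <= c3.
  apply: mulr_ge0 => //; rewrite addr_ge0 ?(mulr_ge0 _ om0)//.
  by rewrite mulr_ge0// mulr_ge0 ?sqr_ge0.
have c40 : 0 <= c4.
  rewrite addr_ge0//; last by rewrite mulr_ge0 ?sqr_ge0.
  by rewrite mulr_ge0 ?(ltW ag0)// divr_ge0 ?sqr_ge0 ?(ltW mu_gt0).
have c50 := noise_gain_ge0.
pose C := c1 + c2 + c3 + c4 + noise_gain.
have C1 : c1 <= C by rewrite /C; lra.
have C2 : c2 <= C by rewrite /C; lra.
have C3 : c3 <= C by rewrite /C; lra.
have C4 : c4 <= C by rewrite /C; lra.
have C5 : noise_gain <= C by rewrite /C; lra.
exists C; first by apply: le_trans C5.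
move=> b t s x e v /andP[t0 t1] N Em Xm Sm T.
have N0 : 0 <= N by rewrite addr_ge0 ?sqr_ge0.
have Em0 : 0 <= Em by exact: sqr_ge0.
have Xm0 : 0 <= Xm by exact: sqr_ge0.
have Sm0 : 0 <= Sm by exact: sqr_ge0.
have bN0 : 0 <= b ^+ 2 * N by rewrite mulr_ge0 ?sqr_ge0.
have tE0 : 0 <= t ^+ 2 * (Em + Xm + 1) by rewrite mulr_ge0 ?sqr_ge0 ?addr_ge0.
have T0 : 0 <= T by rewrite addr_ge0.
have ST0 : 0 <= Sm + T by rewrite addr_ge0.
have zE : norm2 (z x) ^+ 2 = Em + Xm by exact: norm2_split.
have bNT : b ^+ 2 * N <= T by rewrite lerDl.
have tET : t ^+ 2 * (Em + Xm + 1) <= T by rewrite lerDr.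
pose D := b *: (Q *m (Wo *m e)) + (gam * t) *: (Q *m (u x + us)).
have bWe (w w' : 'M[R]_(n, r)) : norm2 w ^+ 2 + norm2 w' ^+ 2 = N ->
    norm2 (b *: (Q *m (Wo *m w))) ^+ 2 <= om * T.
  move=> wE; rewrite norm2Z_sqr; apply: le_trans (_ : om * (b ^+ 2 * N) <= _).
    rewrite [leRHS]mulrCA ler_wpM2l ?sqr_ge0//; apply: le_trans (norm2_disagreement_sqr _) _.
    by rewrite -wE; exact: offdiag_noise_le.
  by rewrite ler_wpM2l.
have bWe1 := bWe e v erefl; have bWe2 := bWe v e (addrC _ _).
have Dle : norm2 D ^+ 2 <= (2 * om + 4 * gam ^+ 2 * (L ^+ 2 + norm2 us ^+ 2)) * T.
  apply: le_trans (norm2_sqrD _ _) _.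
  have : norm2 ((gam * t) *: (Q *m (u x + us))) ^+ 2
      <= 2 * (gam ^+ 2 * (L ^+ 2 + norm2 us ^+ 2)) * T.
    rewrite norm2Z_sqr exprMn.
    have h1 : norm2 (Q *m (u x + us)) ^+ 2 <= 2 * (L ^+ 2 * (Em + Xm)) + 2 * norm2 us ^+ 2.
      apply: le_trans (norm2_disagreement_sqr _) _.
      apply: le_trans (norm2_sqrD _ _) _.
      by rewrite lerD2r ler_pM2l// -zE; exact: grad_deviation_le.
    have h2 : 2 * (L ^+ 2 * (Em + Xm)) + 2 * norm2 us ^+ 2
        <= 2 * (L ^+ 2 + norm2 us ^+ 2) * (Em + Xm + 1).
      have := sqr_ge0 L; have := mulr_ge0 (sqr_ge0 (norm2 us)) (addr_ge0 Em0 Xm0); lra.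
    have h3 := ler_wpM2l (mulr_ge0 (sqr_ge0 gam) (sqr_ge0 t)) (le_trans h1 h2).
    apply: le_trans h3 _.
    have h4 : 0 <= 2 * (gam ^+ 2 * (L ^+ 2 + norm2 us ^+ 2)).
      by apply: mulr_ge0 => //; apply: mulr_ge0 (sqr_ge0 _) (addr_ge0 (sqr_ge0 _) (sqr_ge0 _)).
    apply: le_trans (ler_wpM2l h4 tET); rewrite le_eqVlt; apply/orP; left; apply/eqP; ring.
  move: bWe1; lra.
have SP : norm2 (Q *m next_s b (gam * t) s x e) ^+ 2 <= rho * Sm + c1 * T.
  rewrite tracker_step -/D.
  have le1 : norm2 (A *m (Q *m s) + D) <= rho * norm2 (Q *m s) + norm2 D.
    by apply: le_trans (norm2D _ _) _; rewrite lerD2r; exact: norm2_contraction.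
  apply: le_trans (sqr_contractD rhoP (norm2_ge0 _) le1) _.
  by rewrite lerD2l -mulrA ler_wpM2l.
have rS : rho * Sm <= Sm by rewrite ler_piMl// ltW.
have YP : norm2 (Q *m (next_s b (gam * t) s x e - s)) ^+ 2 <= c2 * (Sm + T).
  rewrite mulmxBr; apply: le_trans (norm2_sqrB _ _) _.
  rewrite -/Sm; have := mulr_ge0 c10 Sm0; rewrite /c2; lra.
have XP : norm2 (Q *m z (next_x b (gam * t) s x e v)) ^+ 2 <= rho * Xm + c3 * (Sm + T).
  rewrite consensus_step; move: YP; set y := Q *m (next_s _ _ _ _ _ - s) => YP.
  set F := _ - alpha *: y.
  have le1 : norm2 (A *m (Q *m z x) + F) <= rho * norm2 (Q *m z x) + norm2 F.
    by apply: le_trans (norm2D _ _) _; rewrite lerD2r; exact: norm2_contraction.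
  apply: le_trans (sqr_contractD rhoP (norm2_ge0 _) le1) _.
  rewrite lerD2l -mulrA ler_wpM2l//; apply: le_trans (norm2_sqrB _ _) _.
  rewrite (norm2Z_sqr alpha); have := ler_wpM2l (sqr_ge0 alpha) YP; have := mulr_ge0 om0 Sm0.
  move: bWe2; lra.
split.
- by apply: le_trans SP _; rewrite lerD2l ler_wpM2r.
- by apply: le_trans YP _; rewrite ler_wpM2r.
- by apply: le_trans XP _; rewrite lerD2l ler_wpM2r.
- have hp : 0 < alpha * (gam * t) by rewrite mulrA mulr_gt0.
  apply: le_trans (mean_contraction x hp) _; rewrite -/Em -/Xm.
  have tt : t ^+ 2 <= t by rewrite expr2 ler_piMl// ltW.
  have k1 : 0 <= (alpha * gam) ^+ 2 * L ^+ 2 by rewrite mulr_ge0 ?sqr_ge0.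
  have k2 : 0 <= alpha * gam * (L ^+ 2 / mu).
    by rewrite mulr_ge0 ?(ltW ag0)// divr_ge0 ?sqr_ge0 ?(ltW mu_gt0).
  apply: lerD; apply: ler_wpM2r => //.
    have -> : alpha * (gam * t) * mu = alpha * gam * mu * t by ring.
    rewrite lerD2l.
    have -> : (alpha * (gam * t)) ^+ 2 * L ^+ 2 = (alpha * gam) ^+ 2 * L ^+ 2 * t ^+ 2 by ring.
    rewrite ler_wpM2r ?sqr_ge0//; by apply: le_trans C4; rewrite /c4 lerDr.
  apply: le_trans (_ : c4 * t <= _); last by rewrite ler_pM2r.
  have := ler_wpM2l k1 tt; rewrite /c4; lra.
- apply: le_trans (norm2_averaging_sqr _) _; apply: le_trans (noise_le _ _) _.
  by rewrite ler_wpM2r.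
Qed.

End AlgorithmStep.

(** * Random iterates and noise *)

Section MatrixMeasurability.
Local Open Scope classical_set_scope.
Context {d : measure_display} {T : measurableType d} {R : realType}.

Definition mx_measurable n r (X : T -> 'M[R]_(n, r)) :=
  forall i j, measurable_fun setT (fun t => X t i j).

Lemma mx_measurableD n r (X Y : T -> 'M[R]_(n, r)) :
  mx_measurable X -> mx_measurable Y -> mx_measurable (fun t => X t + Y t).
Proof.
by move=> mX mY i j; under eq_fun do rewrite mxE; exact: measurable_funD.
Qed.

Lemma mx_measurableZ n r a (X : T -> 'M[R]_(n, r)) :
  mx_measurable X -> mx_measurable (fun t => a *: X t).
Proof.
by move=> mX i j; under eq_fun do rewrite mxE; exact: measurable_funM.
Qed.

Lemma mx_measurableB n r (X Y : T -> 'M[R]_(n, r)) :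
  mx_measurable X -> mx_measurable Y -> mx_measurable (fun t => X t - Y t).
Proof.
move=> mX mY i j; under eq_fun do rewrite !mxE; exact: measurable_funB.
Qed.

Lemma mx_measurable_mulmx m n r (M : 'M[R]_(m, n)) (X : T -> 'M[R]_(n, r)) :
  mx_measurable X -> mx_measurable (fun t => M *m X t).
Proof.
move=> mX i j; under eq_fun do rewrite mxE.
by apply: measurable_sum => k; exact: measurable_funM.
Qed.

Lemma mx_measurable_cst n r (M : 'M[R]_(n, r)) : mx_measurable (fun=> M).
Proof. by move=> i j; exact: measurable_cst. Qed.

Lemma mx_measurable_norm2_sqr n r (X : T -> 'M[R]_(n, r)) :
  mx_measurable X -> measurable_fun setT (fun t => norm2 (X t) ^+ 2).
Proof.
move=> mX; under eq_fun do rewrite norm2_sqr ipE.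
by apply: measurable_sum => j; apply: measurable_sum => i; exact: measurable_funM.
Qed.

Lemma mx_measurable_stacked_grad n r mu L (f : 'I_n -> 'rV[R]_r -> R)
    (X : T -> 'M[R]_(n, r)) : 0 <= L -> (forall i, objective_class mu L (f i)) ->
  mx_measurable X -> mx_measurable (fun t => stacked_grad f (X t)).
Proof.
move=> L0 fP mX i j; under eq_fun do rewrite mxE.
apply: (@measurable_lipschitz _ _ _ _ (fun x => grad (f i) x 0 j) L) => //.
  move=> x y; have [_ _ lip] := fP i.
  apply: le_trans (ler_norm _) _; have := normr_entry (grad (f i) x - grad (f i) y) 0 j.
  have entryB (a b : 'rV[R]_r) : (a - b) 0 j = a 0 j - b 0 j by rewrite !mxE.
  rewrite entryB => h; apply: le_trans h _.
  apply: le_trans (lip x y) _; rewrite ler_wpM2l//.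
  apply: le_trans (norm2_le_sum _) _; rewrite le_eqVlt; apply/orP; left; apply/eqP.
  by apply: eq_bigr => k _; rewrite !mxE.
by move=> k; under eq_fun do rewrite mxE; exact: mX.
Qed.

End MatrixMeasurability.

Section MatrixSquareIntegrable.
Local Open Scope classical_set_scope.
Context {d : measure_display} {T : measurableType d} {R : realType}.
Variable P : probability T R.

Definition mx_sqint n r (X : T -> 'M[R]_(n, r)) :=
  forall i j, sqint P (fun t => X t i j).

Lemma mx_sqintD n r (X Y : T -> 'M[R]_(n, r)) :
  mx_sqint X -> mx_sqint Y -> mx_sqint (fun t => X t + Y t).
Proof. by move=> mX mY i j; under eq_fun do rewrite mxE; exact: sqintD. Qed.

Lemma mx_sqintZ n r a (X : T -> 'M[R]_(n, r)) :
  mx_sqint X -> mx_sqint (fun t => a *: X t).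
Proof. by move=> mX i j; under eq_fun do rewrite mxE; exact: sqintZ. Qed.

Lemma mx_sqintB n r (X Y : T -> 'M[R]_(n, r)) :
  mx_sqint X -> mx_sqint Y -> mx_sqint (fun t => X t - Y t).
Proof.
move=> mX mY; under eq_fun do rewrite -scaleN1r.
by apply: mx_sqintD => //; exact: mx_sqintZ.
Qed.

Lemma mx_sqint_mulmx m n r (M : 'M[R]_(m, n)) (X : T -> 'M[R]_(n, r)) :
  mx_sqint X -> mx_sqint (fun t => M *m X t).
Proof.
move=> mX i j; under eq_fun do rewrite mxE.
by apply: sqint_sum => k; exact: sqintZ.
Qed.

Lemma mx_sqint_cst n r (M : 'M[R]_(n, r)) : mx_sqint (fun=> M).
Proof. by move=> i j; exact: sqint_cst. Qed.

Lemma mx_sqint_measurable n r (X : T -> 'M[R]_(n, r)) :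
  mx_sqint X -> mx_measurable X.
Proof. by move=> iX i j; have [] := iX i j. Qed.

Lemma intble_ip n r (X Y : T -> 'M[R]_(n, r)) :
  mx_sqint X -> mx_sqint Y -> intble P (fun t => ip (X t) (Y t)).
Proof.
move=> iX iY; under eq_fun do rewrite ipE.
by apply: intble_sum => j; apply: intble_sum => i; exact: sqint_mul.
Qed.

Lemma intble_norm2_sqr n r (X : T -> 'M[R]_(n, r)) :
  mx_sqint X -> intble P (fun t => norm2 (X t) ^+ 2).
Proof. by move=> iX; under eq_fun do rewrite norm2_sqr; exact: intble_ip. Qed.

Lemma mx_sqint_stacked_grad n r mu L (f : 'I_n -> 'rV[R]_r -> R)
    (X : T -> 'M[R]_(n, r)) : 0 < L -> (forall i, objective_class mu L (f i)) ->
  mx_sqint X -> mx_sqint (fun t => stacked_grad f (X t)).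
Proof.
move=> L0 fP iX i j.
have mG := mx_measurable_stacked_grad (ltW L0) fP (mx_sqint_measurable iX).
pose g0 := norm2 (stacked_grad f 0).
apply: (@le_sqint _ _ _ P _ (fun t => 2 * L ^+ 2 * norm2 (X t) ^+ 2 + 2 * g0 ^+ 2)).
- exact: mG.
- by apply: intbleD; [exact/intbleZ/intble_norm2_sqr|exact: intble_cst].
move=> t; have h1 : stacked_grad f (X t) i j ^+ 2 <= norm2 (stacked_grad f (X t)) ^+ 2.
  by rewrite -(real_normK (num_real _)); apply: ler_sqr_norm => //; exact: normr_entry.
apply: le_trans h1 _; rewrite -[stacked_grad f (X t)](subrK (stacked_grad f 0)).
apply: le_trans (norm2_sqrD _ _) _; rewrite lerD2r -mulrA ler_pM2l//.
rewrite -exprMn; apply: ler_sqr_norm => //.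
by have := stacked_lipschitz L0 fP (X t) 0; rewrite subr0.
Qed.

End MatrixSquareIntegrable.

Section Iterates.
Local Open Scope classical_set_scope.
Context {R : realType} (n r : nat).
Variables (f : 'I_n -> 'rV[R]_r -> R) (mu L alpha : R) (W : 'M[R]_n).
Variables (b g : nat -> R) (s0 x0 : 'M[R]_(n, r)).

Lemma s_iterS e v k :
  s_iter f W alpha b g s0 x0 e v k.+1 =
  next_s f W (b k) (g k) (s_iter f W alpha b g s0 x0 e v k)
    (x_iter f W alpha b g s0 x0 e v k) (e k).
Proof. by rewrite /s_iter /x_iter /=; case: (iterate _ _ _ _ _ _ _ _ _ k). Qed.

Lemma x_iterS e v k :
  x_iter f W alpha b g s0 x0 e v k.+1 =
  next_x f alpha W (b k) (g k) (s_iter f W alpha b g s0 x0 e v k)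
    (x_iter f W alpha b g s0 x0 e v k) (e k) (v k).
Proof. by rewrite /s_iter /x_iter /=; case: (iterate _ _ _ _ _ _ _ _ _ k). Qed.

Hypotheses (L_gt0 : 0 < L) (fP : forall i, objective_class mu L (f i)).

Lemma iterate_measurable (d : measure_display) (T : measurableType d)
    (e v : nat -> T -> 'M[R]_(n, r)) k :
  (forall l, (l < k)%N -> mx_measurable (e l) /\ mx_measurable (v l)) ->
  mx_measurable (fun t => s_iter f W alpha b g s0 x0 (fun l => e l t) (fun l => v l t) k) /\
  mx_measurable (fun t => x_iter f W alpha b g s0 x0 (fun l => e l t) (fun l => v l t) k).
Proof.
elim: k => [_|k IH mev]; first by split; exact: mx_measurable_cst.
have [|ms mx] := IH; first by move=> l lk; apply: mev; exact: ltnW.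
have [me mv] := mev k (ltnSn k).
have mS : mx_measurable (fun t => s_iter f W alpha b g s0 x0 (fun l => e l t) (fun l => v l t) k.+1).
  under eq_fun do rewrite s_iterS; apply: mx_measurableD.
    by apply: mx_measurableD; [exact: mx_measurable_mulmx|exact/mx_measurableZ/mx_measurable_mulmx].
  exact/mx_measurableZ/(mx_measurable_stacked_grad (ltW L_gt0) fP).
split=> //; under eq_fun do rewrite x_iterS /next_x -s_iterS; apply: mx_measurableB.
  by apply: mx_measurableD; [exact: mx_measurable_mulmx|exact/mx_measurableZ/mx_measurable_mulmx].
by apply/mx_measurableZ/mx_measurableB.
Qed.

Lemma iterate_sqint (d : measure_display) (T : measurableType d)
    (P : probability T R) (e v : nat -> T -> 'M[R]_(n, r)) k :
  (forall l, mx_sqint P (e l) /\ mx_sqint P (v l)) ->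
  mx_sqint P (fun t => s_iter f W alpha b g s0 x0 (fun l => e l t) (fun l => v l t) k) /\
  mx_sqint P (fun t => x_iter f W alpha b g s0 x0 (fun l => e l t) (fun l => v l t) k).
Proof.
move=> iev; elim: k => [|k [is_ ix]]; first by split; exact: mx_sqint_cst.
have [ie iv] := iev k.
have iS : mx_sqint P (fun t => s_iter f W alpha b g s0 x0 (fun l => e l t) (fun l => v l t) k.+1).
  under eq_fun do rewrite s_iterS; apply: mx_sqintD.
    by apply: mx_sqintD; [exact: mx_sqint_mulmx|exact/mx_sqintZ/mx_sqint_mulmx].
  exact/mx_sqintZ/(mx_sqint_stacked_grad L_gt0 fP).
split=> //; under eq_fun do rewrite x_iterS /next_x -s_iterS; apply: mx_sqintB.
  by apply: mx_sqintD; [exact: mx_sqint_mulmx|exact/mx_sqintZ/mx_sqint_mulmx].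
by apply/mx_sqintZ/mx_sqintB.
Qed.

End Iterates.

Section NoiseMoments.
Local Open Scope classical_set_scope.
Context {d : measure_display} {Omega : measurableType d} {R : realType}.
Variables (P : probability Omega R) (n r : nat).
Variables (eta xi : nat -> 'I_n -> 'I_r -> {RV P >-> R}) (sigma_eta sigma_xi : R).
Hypothesis noiseP : noise_class eta xi sigma_eta sigma_xi.

Lemma noise_measurable (zeta : nat -> 'I_n -> 'I_r -> {RV P >-> R}) k :
  mx_measurable (noise_mx zeta k).
Proof. by move=> i j; under eq_fun do rewrite mxE; exact: measurable_funP. Qed.

Lemma centered_noise (zeta : nat -> 'I_n -> 'I_r -> {RV P >-> R}) sigma k :
  centered_bounded zeta sigma ->
  mx_sqint P (noise_mx zeta k) /\ Ex P (fun w => norm2 (noise_mx zeta k w) ^+ 2) <= sigma ^+ 2.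
Proof.
move=> /(_ k) [_ bound].
have mN := mx_measurable_norm2_sqr (noise_measurable zeta k).
have iN : intble P (fun w => norm2 (noise_mx zeta k w) ^+ 2).
  apply/integrableP; split; first exact/measurable_EFinP.
  apply: le_lt_trans (ltry (sigma ^+ 2)); apply: le_trans bound.
  rewrite unlock le_eqVlt; apply/orP; left; apply/eqP.
  by apply: eq_integral => w _ /=; rewrite ger0_norm ?sqr_ge0.
split; last by rewrite -lee_fin -expectationE.
move=> i j; apply: le_sqint (noise_measurable zeta k i j) iN _ => w.
by rewrite -(real_normK (num_real _)); apply: ler_sqr_norm => //; exact: normr_entry.
Qed.

Let index := (nat * 'I_n * 'I_r)%type.
Let pair_noise (l : index) w := (eta l.1.1 l.1.2 l.2 w, xi l.1.1 l.1.2 l.2 w).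

Definition past (k : nat) : seq (nat * 'I_n * 'I_r) :=
  [seq (p, j) | p <- [seq (l, i) | l <- iota 0 k, i <- enum 'I_n], j <- enum 'I_r].

Lemma mem_past k l i j : ((l, i, j) \in past k) = (l < k)%N.
Proof.
apply/idP/idP.
  move=> /allpairsP[[p j'] [/= /allpairsP[[l' i'] [/= l'k _ ->]] _ [-> _ _]]].
  by move: l'k; rewrite mem_iota add0n.
move=> lk; apply: allpairs_f; last by rewrite mem_enum.
by apply: allpairs_f; rewrite ?mem_enum// mem_iota.
Qed.

Lemma uniq_past k : uniq (past k).
Proof.
apply: allpairs_uniq; [apply: allpairs_uniq| |].
- exact: iota_uniq.
- exact: enum_uniq.
- by move=> [? ?] [? ?] _ _ [-> ->].
- exact: enum_uniq.
- by move=> [? ?] [? ?] _ _ [-> ->].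
Qed.

(** The sample space with the sigma-algebra of the noise before time [k]. *)
Definition past_type k := g_sigma_algebraType (cylinders pair_noise (past k)).

Lemma past_measurable k l : (l < k)%N ->
  @mx_measurable _ (past_type k) R n r (noise_mx eta l) /\
  @mx_measurable _ (past_type k) R n r (noise_mx xi l).
Proof.
move=> lk.
have mpair i j : @measurable_fun _ _ (past_type k) (R * R)%type setT (pair_noise (l, i, j)).
  move=> _ B mB; rewrite setTI; apply: sub_sigma_algebra.
  exists (fun m => if m == (l, i, j) then B else setT).
    by move=> m; case: ifP.
  apply/seteqP; split=> [w Bw m /= _|w /(_ (l, i, j))].
    by case: eqP => // ->.
  by rewrite eqxx; apply; rewrite /= mem_past.
split=> i j; under eq_fun do rewrite mxE.
  by have := measurableT_comp measurable_fst (mpair i j).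
by have := measurableT_comp measurable_snd (mpair i j).
Qed.

End NoiseMoments.

(** * Second moments of the errors *)

Section ZeroCross.
Local Open Scope classical_set_scope.
Context {d : measure_display} {Omega : measurableType d} {R : realType}.
Variables (P : probability Omega R) (n r : nat).
Variables (eta xi : nat -> 'I_n -> 'I_r -> {RV P >-> R}) (sigma_eta sigma_xi : R).
Hypothesis noiseP : noise_class eta xi sigma_eta sigma_xi.
Notation past_of k := (past_type eta xi k).

Let pair_noise (l : nat * 'I_n * 'I_r) w := (eta l.1.1 l.1.2 l.2 w, xi l.1.1 l.1.2 l.2 w).

Lemma independent_cross (psi : Omega -> R) (Y : {RV P >-> R}) (k : nat) i j
    (embed : set R -> set (R * R)) :
  @measurable_fun _ _ (past_of k) R setT psi -> sqint P psi -> sqint P Y ->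
  ('E_P[Y] = 0)%E ->
  (forall B, measurable B -> measurable (embed B) /\
     Y @^-1` B = pair_noise (k, i, j) @^-1` (embed B)) ->
  Ex P (fun w => psi w * Y w) = 0.
Proof.
move=> mpsi ipsi iY Y0 embedP; have [indep _ _] := noiseP.
have [mpsiO _] := ipsi.
pose mixin := isMeasurableFun.Build _ _ _ _ _ mpsiO.
pose X : {RV P >-> R} := HB.pack psi mixin.
apply: (@independent_product_mean0 _ _ _ P X Y) => //.
- move=> A B mA mB; have [mB' ->] := embedP B mB.
  apply: (independent_of_past (i0 := (k, i, j)) indep _ (uniq_past n r k) _ mB').
  + by move=> l; apply/measurable_fun_pairP; split.
  + by rewrite mem_past ltnn.
  + by have := mpsi measurableT A mA; rewrite setTI.
- exact: sqint_mul.
- exact: sqint_intble.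
Qed.

(** An integrand measurable in the past is independent of the centred noise at
    time [k], so each entry of the inner product has mean zero. *)
Lemma zero_cross (Psi : Omega -> 'M[R]_(n, r)) k :
  @mx_measurable _ (past_of k) R n r Psi -> mx_sqint P Psi ->
  Ex P (fun w => ip (Psi w) (noise_mx eta k w)) = 0 /\
  Ex P (fun w => ip (Psi w) (noise_mx xi k w)) = 0.
Proof.
move=> mPsi iPsi; have [_ ceta cxi] := noiseP.
have [ieta _] := centered_noise k ceta; have [ixi _] := centered_noise k cxi.
have [eta0 _] := ceta k; have [xi0 _] := cxi k.
have main (zeta : nat -> 'I_n -> 'I_r -> {RV P >-> R}) : mx_sqint P (noise_mx zeta k) ->
    (forall i j, Ex P (fun w => Psi w i j * zeta k i j w) = 0) ->
    Ex P (fun w => ip (Psi w) (noise_mx zeta k w)) = 0.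
  move=> iz z0; have izij i j : intble P (fun w => Psi w i j * noise_mx zeta k w i j).
    exact: sqint_mul.
  under eq_fun do rewrite ipE.
  rewrite Ex_sum; last by move=> j; exact: intble_sum.
  rewrite big1// => j _; rewrite Ex_sum// big1// => i _.
  by under eq_fun do rewrite mxE; exact: z0.
have entry (zeta : nat -> 'I_n -> 'I_r -> {RV P >-> R}) i j :
    mx_sqint P (noise_mx zeta k) -> sqint P (zeta k i j).
  by move=> /(_ i j); under eq_fun do rewrite mxE.
split; apply: main => // i j.
  apply: (@independent_cross (fun w => Psi w i j) (eta k i j) k i j (fun B => B `*` setT)) => //.
  - exact: entry ieta.
  - move=> B mB; split; first exact: measurableX.
    by apply/seteqP; split=> w //= [].
apply: (@independent_cross (fun w => Psi w i j) (xi k i j) k i j (fun B => setT `*` B)) => //.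
- exact: entry ixi.
- move=> B mB; split; first exact: measurableX.
  by apply/seteqP; split=> w //= [].
Qed.

End ZeroCross.

Section Scalars.
Context {R : realType}.

Lemma forcing_bound (a N s v : R) : 0 <= a -> 0 <= s -> 0 <= v -> N <= s ->
  a * N + v <= (1 + s) * (a + v).
Proof.
move=> a0 s0 v0 Ns; have := ler_wpM2l a0 Ns; have := mulr_ge0 s0 v0.
by lra.
Qed.

Lemma collect_bound (U V E X c C C0 C1 t a : R) :
  U <= (1 - c + C0 * t ^+ 2) * E + C0 * t * X -> V <= C1 -> C0 <= C -> C1 <= C ->
  0 <= t -> 0 <= a -> 0 <= E -> 0 <= X ->
  U + a * V <= (1 - c + C * t ^+ 2) * E + C * t * X + C * a.
Proof.
move=> hU hV C0C C1C t0 a0 E0 X0.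
have := ler_wpM2l a0 (le_trans hV C1C).
have := ler_wpM2r (mulr_ge0 (sqr_ge0 t) E0) C0C.
have := ler_wpM2r (mulr_ge0 t0 X0) C0C.
by lra.
Qed.

End Scalars.

Section ErrorMoments.
Local Open Scope classical_set_scope.
Context {d : measure_display} {Omega : measurableType d} {R : realType}.
Variables (P : probability Omega R) (n r : nat).
Variables (f : 'I_n -> 'rV[R]_r -> R) (mu L alpha : R) (W : 'M[R]_n) (xs : 'rV[R]_r).
Variables (eta xi : nat -> 'I_n -> 'I_r -> {RV P >-> R}) (sigma_eta sigma_xi : R).
Hypotheses (n_gt0 : (0 < n)%N) (WP : coupling_matrix W).
Hypotheses (mu_gt0 : 0 < mu) (L_gt0 : 0 < L) (alpha_gt0 : 0 < alpha).
Hypothesis fP : forall i, objective_class mu L (f i).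
Hypothesis xsP : averaging n *m stacked_grad f (ones n *m xs) = 0.
Hypothesis noiseP : noise_class eta xi sigma_eta sigma_xi.
Variables (b g : nat -> R) (s0 x0 : 'M[R]_(n, r)).
Notation J := (averaging n : 'M[R]_n).
Notation Q := (1%:M - averaging n : 'M[R]_n).
Notation rho := (rho_w W).
Notation z := (deviation xs).
Notation u := (grad_deviation f xs).
Notation sigma2 := (sigma_eta ^+ 2 + sigma_xi ^+ 2).

Definition s_proc k w := s_iter f W alpha b g s0 x0
  (fun l => noise_mx eta l w) (fun l => noise_mx xi l w) k.
Definition x_proc k w := x_iter f W alpha b g s0 x0
  (fun l => noise_mx eta l w) (fun l => noise_mx xi l w) k.
Definition noise_power k w := norm2 (noise_mx eta k w) ^+ 2 + norm2 (noise_mx xi k w) ^+ 2.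

Definition mean_moment k := Ex P (fun w => norm2 (J *m z (x_proc k w)) ^+ 2).
Definition disagreement_moment k := Ex P (fun w => norm2 (Q *m z (x_proc k w)) ^+ 2).
Definition state_moment k := Ex P (fun w => norm2 (Q *m s_proc k w) ^+ 2).
Definition increment_moment k := Ex P (fun w => norm2 (Q *m (s_proc k.+1 w - s_proc k w)) ^+ 2).

Let s_procS k w : s_proc k.+1 w = next_s f W (b k) (g k) (s_proc k w) (x_proc k w) (noise_mx eta k w).
Proof. exact: s_iterS. Qed.
Let x_procS k w : x_proc k.+1 w
  = next_x f alpha W (b k) (g k) (s_proc k w) (x_proc k w) (noise_mx eta k w) (noise_mx xi k w).
Proof. exact: x_iterS. Qed.

Let isq_noise l : mx_sqint P (noise_mx eta l) /\ mx_sqint P (noise_mx xi l).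
Proof.
have [_ ceta cxi] := noiseP.
by have [? _] := centered_noise l ceta; have [? _] := centered_noise l cxi.
Qed.

Lemma s_proc_sqint k : mx_sqint P (s_proc k).
Proof. by have [] := iterate_sqint alpha W b g s0 x0 L_gt0 fP k isq_noise. Qed.

Lemma x_proc_sqint k : mx_sqint P (x_proc k).
Proof. by have [] := iterate_sqint alpha W b g s0 x0 L_gt0 fP k isq_noise. Qed.

Lemma deviation_sqint k : mx_sqint P (fun w => z (x_proc k w)).
Proof. by apply: mx_sqintB; [exact: x_proc_sqint|exact: mx_sqint_cst]. Qed.

Lemma grad_deviation_sqint k : mx_sqint P (fun w => u (x_proc k w)).
Proof.
apply: mx_sqintB; last exact: mx_sqint_cst.
exact: (mx_sqint_stacked_grad L_gt0 fP (x_proc_sqint k)).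
Qed.

Let intE k : intble P (fun w => norm2 (J *m z (x_proc k w)) ^+ 2).
Proof. exact/intble_norm2_sqr/mx_sqint_mulmx/deviation_sqint. Qed.
Let intX k : intble P (fun w => norm2 (Q *m z (x_proc k w)) ^+ 2).
Proof. exact/intble_norm2_sqr/mx_sqint_mulmx/deviation_sqint. Qed.
Let intS k : intble P (fun w => norm2 (Q *m s_proc k w) ^+ 2).
Proof. exact/intble_norm2_sqr/mx_sqint_mulmx/s_proc_sqint. Qed.
Let intY k : intble P (fun w => norm2 (Q *m (s_proc k.+1 w - s_proc k w)) ^+ 2).
Proof.
apply/intble_norm2_sqr/mx_sqint_mulmx; apply: mx_sqintB; exact: s_proc_sqint.
Qed.
Let intN k : intble P (noise_power k).
Proof.
by have [ie iv] := isq_noise k; apply: intbleD; exact: intble_norm2_sqr.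
Qed.

Lemma noise_power_le k : Ex P (noise_power k) <= sigma2.
Proof.
have [_ ceta cxi] := noiseP; have [ie iv] := isq_noise k.
rewrite ExD; [|exact: intble_norm2_sqr|exact: intble_norm2_sqr].
by apply: lerD; [have [] := centered_noise k ceta|have [] := centered_noise k cxi].
Qed.

Lemma mean_moment_ge0 k : 0 <= mean_moment k.
Proof. by apply: Ex_ge0 => w; exact: sqr_ge0. Qed.
Lemma disagreement_moment_ge0 k : 0 <= disagreement_moment k.
Proof. by apply: Ex_ge0 => w; exact: sqr_ge0. Qed.
Lemma state_moment_ge0 k : 0 <= state_moment k.
Proof. by apply: Ex_ge0 => w; exact: sqr_ge0. Qed.
Lemma opt_errE k :
  ('E_P[fun w => (norm2 (row_mean (x_proc k w) - xs) ^+ 2)%R] = (n%:R^-1 * mean_moment k)%:E)%E.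
Proof.
under eq_fun do rewrite norm2_row_mean//.
rewrite expectationE; last exact/intbleZ/intE.
by rewrite ExZ; last exact: intE.
Qed.

Lemma x_errE k :
  ('E_P[fun w => (consensus_error (x_proc k w) ^+ 2)%R] = (disagreement_moment k)%:E)%E.
Proof.
under eq_fun => w.
  rewrite consensus_errorE// (_ : Q *m x_proc k w = Q *m z (x_proc k w)); last first.
    by rewrite /z mulmxBr mulmxA disagreement_ones// mul0mx subr0.
  over.
by rewrite expectationE; last exact: intX.
Qed.

Lemma y_errE k :
  ('E_P[fun w => (consensus_error (s_proc k.+1 w - s_proc k w) ^+ 2)%R]
   = (increment_moment k)%:E)%E.
Proof.
under eq_fun do rewrite consensus_errorE//.
by rewrite expectationE; last exact: intY.
Qed.

(** Moving the constant matrices to the other side of the inner product reduces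
    this to [zero_cross]: the iterates at time [k] depend on earlier noise only. *)
Lemma mean_cross k :
  Ex P (fun w => ip (J *m z (x_proc k w) - (alpha * g k) *: (J *m u (x_proc k w)))
    (J *m (offdiag W *m noise_mx xi k w - alpha *: (offdiag W *m noise_mx eta k w)))) = 0.
Proof.
have [ms mx] : @mx_measurable _ (past_type eta xi k) R n r (s_proc k) /\
    @mx_measurable _ (past_type eta xi k) R n r (x_proc k).
  apply: (iterate_measurable alpha W b g s0 x0 L_gt0 fP (T := past_type eta xi k)) => l lk.
  exact: past_measurable.
pose Psi w := J *m z (x_proc k w) - (alpha * g k) *: (J *m u (x_proc k w)).
have mPsi : @mx_measurable _ (past_type eta xi k) R n r Psi.
  apply: mx_measurableB; first apply: mx_measurable_mulmx.
    by apply: mx_measurableB => //; exact: mx_measurable_cst.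
  apply/mx_measurableZ/mx_measurable_mulmx/mx_measurableB; last exact: mx_measurable_cst.
  exact: (mx_measurable_stacked_grad (ltW L_gt0) fP mx).
have iPsi : mx_sqint P Psi.
  apply: mx_sqintB; first exact/mx_sqint_mulmx/deviation_sqint.
  exact/mx_sqintZ/mx_sqint_mulmx/grad_deviation_sqint.
pose M := (J *m offdiag W)^T.
have mM : @mx_measurable _ (past_type eta xi k) R n r (fun w => M *m Psi w).
  exact: mx_measurable_mulmx.
have iM : mx_sqint P (fun w => M *m Psi w) by exact: mx_sqint_mulmx.
have [c1 c2] := zero_cross noiseP mM iM.
have [ie iv] := isq_noise k.
have adjoint (X Y : 'M[R]_(n, r)) : ip X (J *m offdiag W *m Y) = ip (M *m X) Y.
  by rewrite ipC ip_mull ipC.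
have splitE w : ip (J *m z (x_proc k w) - (alpha * g k) *: (J *m u (x_proc k w)))
    (J *m (offdiag W *m noise_mx xi k w - alpha *: (offdiag W *m noise_mx eta k w)))
  = ip (M *m Psi w) (noise_mx xi k w) + - alpha * ip (M *m Psi w) (noise_mx eta k w).
  rewrite -/(Psi w) mulmxBr -scalemxAr !mulmxA ipDr ipNr ipZr mulNr.
  by rewrite !adjoint.
under eq_fun do rewrite splitE.
rewrite ExD ?ExZ ?c1 ?c2 ?mulr0 ?addr0//; first exact: intble_ip.
- exact: intble_ip.
- exact/intbleZ/intble_ip.
Qed.

Lemma mean_moment_step k : mean_moment k.+1 =
  Ex P (fun w => norm2 (J *m z (x_proc k w) - (alpha * g k) *: (J *m u (x_proc k w))) ^+ 2)
  + b k ^+ 2 * Ex P (fun w => norm2 (J *m (offdiag W *m noise_mx xi k w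
                              - alpha *: (offdiag W *m noise_mx eta k w))) ^+ 2).
Proof.
have [ie iv] := isq_noise k.
set F := fun w => J *m z (x_proc k w) - (alpha * g k) *: (J *m u (x_proc k w)).
set V := fun w => J *m (offdiag W *m noise_mx xi k w - alpha *: (offdiag W *m noise_mx eta k w)).
have iF : mx_sqint P F.
  apply: mx_sqintB; first exact/mx_sqint_mulmx/deviation_sqint.
  exact/mx_sqintZ/mx_sqint_mulmx/grad_deviation_sqint.
have iV : mx_sqint P V.
  apply/mx_sqint_mulmx/mx_sqintB; first exact: mx_sqint_mulmx.
  exact/mx_sqintZ/mx_sqint_mulmx.
have E w : norm2 (J *m z (x_proc k.+1 w)) ^+ 2
    = norm2 (F w) ^+ 2 + (2 * b k * ip (F w) (V w) + b k ^+ 2 * norm2 (V w) ^+ 2).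
  rewrite x_procS (mean_step _ WP xsP) -/(F w) -/(V w).
  move: (F w) (V w) => Fw Vw; rewrite !norm2_sqr.
  by rewrite ipDl !ipDr !ipZl !ipZr (ipC Vw); ring.
rewrite /mean_moment; under eq_fun do rewrite E.
have cross : Ex P (fun w => ip (F w) (V w)) = 0 by exact: mean_cross.
rewrite ExD; [|exact: intble_norm2_sqr|]; last first.
  by apply: intbleD; apply: intbleZ; [exact: intble_ip|exact: intble_norm2_sqr].
rewrite ExD; [|exact/intbleZ/intble_ip|exact/intbleZ/intble_norm2_sqr].
rewrite !ExZ ?cross ?mulr0 ?add0r//; [exact: intble_norm2_sqr|exact: intble_ip].
Qed.

Let Ex_affine (a c : R) (X Y : Omega -> R) : intble P X -> intble P Y ->
  intble P (fun w => a * X w + c * Y w) /\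
  Ex P (fun w => a * X w + c * Y w) = a * Ex P X + c * Ex P Y.
Proof.
by move=> iX iY; split; [apply: intbleD; exact: intbleZ|rewrite ExD ?ExZ//; exact: intbleZ].
Qed.

(** Expectation of [diminishing_step], with the variance of the noise absorbed in
    the constant. *)
Lemma moment_recursions (gam : R) (t : nat -> R) : 0 < gam ->
  (forall k, g k = gam * t k) -> (forall k, 0 < t k <= 1) ->
  exists2 C, 0 <= C & forall k,
  let E := mean_moment k in let X := disagreement_moment k in let S := state_moment k in
  let F := b k ^+ 2 + t k ^+ 2 * (E + X + 1) in
  [/\ state_moment k.+1 <= rho * S + C * F,
      increment_moment k <= C * (S + F),
      disagreement_moment k.+1 <= rho * X + C * (S + F) &
      mean_moment k.+1 <= (1 - alpha * gam * mu * t k + C * t k ^+ 2) * E + C * t k * X + C * b k ^+ 2].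
Proof.
move=> gam0 gE tP.
have [C0 C00 step] := diminishing_step xs n_gt0 WP mu_gt0 L_gt0 alpha_gt0 fP gam0.
have sig0 : 0 <= sigma2 by rewrite addr_ge0 ?sqr_ge0.
have CC : C0 <= C0 * (1 + sigma2) by rewrite ler_peMr// lerDl.
have Cge0 : 0 <= C0 * (1 + sigma2) by exact: le_trans CC.
exists (C0 * (1 + sigma2)) => // k E X S F.
have tk := tP k; have [t0 t1] := andP tk.
have E0 : 0 <= E := mean_moment_ge0 k.
have X0 : 0 <= X := disagreement_moment_ge0 k.
have S0 : 0 <= S := state_moment_ge0 k.
have EX1 : 0 <= E + X + 1 := addr_ge0 (addr_ge0 E0 X0) ler01.
have b0 := sqr_ge0 (b k); have tt0 := sqr_ge0 (t k).
have F0 : 0 <= F := addr_ge0 b0 (mulr_ge0 tt0 EX1).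
pose T w := b k ^+ 2 * noise_power k w + t k ^+ 2 *
  (norm2 (J *m z (x_proc k w)) ^+ 2 + norm2 (Q *m z (x_proc k w)) ^+ 2 + 1).
have iEX : intble P (fun w => norm2 (J *m z (x_proc k w)) ^+ 2
    + norm2 (Q *m z (x_proc k w)) ^+ 2 + 1).
  by apply: intbleD; [apply: intbleD|exact: intble_cst].
have [iT ET] := Ex_affine (b k ^+ 2) (t k ^+ 2) (intN k) iEX.
have T_le : Ex P T <= (1 + sigma2) * F.
  rewrite /T ET; have -> : Ex P (fun w => norm2 (J *m z (x_proc k w)) ^+ 2
      + norm2 (Q *m z (x_proc k w)) ^+ 2 + 1) = E + X + 1.
    by rewrite ExD ?Ex_cst ?ExD//; [exact: intbleD|exact: intble_cst].
  exact: forcing_bound b0 sig0 (mulr_ge0 tt0 EX1) (noise_power_le k).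
have T_ge0 : 0 <= Ex P T.
  apply: Ex_ge0 => w; rewrite /T /noise_power addr_ge0// mulr_ge0// ?addr_ge0 ?sqr_ge0//.
have CT : C0 * Ex P T <= C0 * (1 + sigma2) * F by rewrite -mulrA ler_wpM2l.
have [iST EST] := Ex_affine 1 1 (intS k) iT.
have EST' : Ex P (fun w => 1 * norm2 (Q *m s_proc k w) ^+ 2 + 1 * T w) = S + Ex P T.
  by rewrite EST !mul1r.
have CST : C0 * (S + Ex P T) <= C0 * (1 + sigma2) * (S + F).
  by rewrite mulrDr (mulrDr (C0 * _)); apply: lerD => //; rewrite ler_wpM2r.
split.
- have [iR ER] := Ex_affine rho C0 (intS k) iT.
  apply: le_trans (Ex_le (intS k.+1) iR _) _ => [w|].
    rewrite s_procS gE.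
    by have [] := step (b k) (t k) (s_proc k w) (x_proc k w) (noise_mx eta k w) (noise_mx xi k w) tk.
  by rewrite ER lerD2l.
- have [iR ER] := Ex_affine 0 C0 (intS k) iST.
  apply: le_trans (Ex_le (intY k) iR _) _ => [w|].
    rewrite s_procS gE mul0r add0r !mul1r.
    by have [] := step (b k) (t k) (s_proc k w) (x_proc k w) (noise_mx eta k w) (noise_mx xi k w) tk.
  by rewrite ER mul0r add0r EST'.
- have [iR ER] := Ex_affine rho C0 (intX k) iST.
  apply: le_trans (Ex_le (intX k.+1) iR _) _ => [w|].
    rewrite x_procS gE !mul1r.
    by have [] := step (b k) (t k) (s_proc k w) (x_proc k w) (noise_mx eta k w) (noise_mx xi k w) tk.
  by rewrite ER EST' lerD2l.
- rewrite mean_moment_step; have [ie iv] := isq_noise k.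
  set c := 1 - alpha * gam * mu * t k + C0 * t k ^+ 2.
  have [iR ER] := Ex_affine c (C0 * t k) (intE k) (intX k).
  have le1 : Ex P (fun w => norm2 (J *m z (x_proc k w) - (alpha * g k) *: (J *m u (x_proc k w))) ^+ 2)
      <= c * E + C0 * t k * X.
    rewrite -ER; apply: Ex_le iR _ => [|w].
      apply: intble_norm2_sqr; apply: mx_sqintB; first exact/mx_sqint_mulmx/deviation_sqint.
      exact/mx_sqintZ/mx_sqint_mulmx/grad_deviation_sqint.
    rewrite gE.
    by have [] := step (b k) (t k) (s_proc k w) (x_proc k w) (noise_mx eta k w) (noise_mx xi k w) tk.
  have le2 : Ex P (fun w => norm2 (J *m (offdiag W *m noise_mx xi k w
      - alpha *: (offdiag W *m noise_mx eta k w))) ^+ 2) <= C0 * sigma2.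
    apply: le_trans (Ex_le _ (intbleZ C0 (intN k)) _) _ => [|w|].
    + apply: intble_norm2_sqr; apply/mx_sqint_mulmx/mx_sqintB; first exact: mx_sqint_mulmx.
      exact/mx_sqintZ/mx_sqint_mulmx.
    + by have [] := step (b k) (t k) (s_proc k w) (x_proc k w) (noise_mx eta k w) (noise_mx xi k w) tk.
    + by rewrite ExZ// ler_wpM2l// noise_power_le.
  apply: collect_bound le1 le2 CC _ (ltW t0) b0 E0 X0.
  by rewrite ler_wpM2l// lerDr.
Qed.

(** The contraction factor is constant, so the second moments follow the forcing
    [beta_k^2]. *)
Lemma geometric_moments (gam q : R) : 0 < gam -> 0 <= q ->
  (forall k, g k = gam) -> (forall k, b k = (time k `^ q)^-1) ->
  alpha * gam * L < 2 -> Q = 0 \/ 8 * (alpha * gam * L) ^+ 2 <= (1 - rho) ^+ 4 ->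
  exists2 M, 0 <= M & forall k,
  [/\ mean_moment k <= M / time k `^ (2 * q),
      disagreement_moment k <= M / time k `^ (2 * q) &
      increment_moment k <= M / time k `^ (2 * q)].
Proof.
move=> gam0 q0 gE bE hL small; pose h := alpha * gam.
have [k1 [k2 [dl [C [k10 k20 /andP[d0 d1] C0 step]]]]] :=
  geometric_step n_gt0 WP mu_gt0 L_gt0 alpha_gt0 fP xsP gam0 (erefl h) hL small.
have sig0 : 0 <= sigma2 by rewrite addr_ge0 ?sqr_ge0.
pose B k w := tracking_error f alpha W xs h (s_proc k w).
have iB k : intble P (fun w => norm2 (B k w) ^+ 2).
  apply/intble_norm2_sqr; apply: mx_sqintD; last exact: mx_sqint_cst.
  exact/mx_sqintZ/mx_sqint_mulmx/s_proc_sqint.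
pose phi k w := norm2 (J *m z (x_proc k w)) ^+ 2 + k1 * norm2 (Q *m z (x_proc k w)) ^+ 2
  + k2 * norm2 (B k w) ^+ 2.
have iphi k : intble P (phi k).
  by apply: intbleD; [apply: intbleD => //|]; exact: intbleZ.
pose a k := Ex P (phi k); pose bm k := Ex P (fun w => norm2 (B k w) ^+ 2).
have bm0 k : 0 <= bm k by apply: Ex_ge0 => w; exact: sqr_ge0.
have aE k : a k = mean_moment k + k1 * disagreement_moment k + k2 * bm k.
  rewrite /a /phi ExD; [|by apply: intbleD => //; exact: intbleZ|exact: intbleZ].
  by rewrite ExD ?ExZ//; exact: intbleZ.
have xk k : 0 <= k1 * disagreement_moment k.
  exact: mulr_ge0 (ltW k10) (disagreement_moment_ge0 k).
have bk k : 0 <= k2 * bm k by exact: mulr_ge0 (ltW k20) (bm0 k).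
have a0 k : 0 <= a k.
  by rewrite aE; exact: addr_ge0 (addr_ge0 (mean_moment_ge0 k) (xk k)) (bk k).
have rec k : a k.+1 <= (1 - dl) * a k + C * sigma2 * b k ^+ 2.
  have [iR ER] := Ex_affine (1 - dl) (C * b k ^+ 2) (iphi k) (intN k).
  apply: le_trans (Ex_le (iphi k.+1) iR _) _ => [w|].
    rewrite /phi x_procS /B s_procS gE; apply: le_trans (step _ _ _ _ _) _.
    by rewrite -mulrA.
  rewrite ER lerD2l [leRHS]mulrAC; apply: ler_wpM2l (noise_power_le k).
  exact: mulr_ge0 C0 (sqr_ge0 _).
have [|||||M M0 hM] := @rate_recursion R a dl (C * sigma2) 0 (2 * q) 0 a0 d0.
- by rewrite mulr_ge0.
- by rewrite lexx ler01.
- by rewrite mulr_ge0.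
- by left.
- by move=> k _; rewrite powRr0 divr1 mul1r -time_powR_sqr -bE; exact: rec.
have k1i : 0 <= k1^-1 by rewrite invr_ge0 ltW.
have k2i : 0 <= k2^-1 by rewrite invr_ge0 ltW.
have mM k : mean_moment k <= M / time k `^ (2 * q).
  apply: le_trans (hM k); rewrite aE -addrA lerDl.
  exact: addr_ge0 (xk k) (bk k).
have dM k : disagreement_moment k <= k1^-1 * M / time k `^ (2 * q).
  rewrite -mulrA -ler_pdivrMl ?invr_gt0// invrK.
  apply: le_trans (hM k); rewrite aE addrAC lerDr.
  exact: addr_ge0 (mean_moment_ge0 k) (bk k).
have bM k : bm k <= k2^-1 * M / time k `^ (2 * q).
  rewrite -mulrA -ler_pdivrMl ?invr_gt0// invrK.
  apply: le_trans (hM k); rewrite aE lerDr.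
  exact: addr_ge0 (mean_moment_ge0 k) (xk k).
pose K1 := 4 / alpha ^+ 2; pose K2 := h ^+ 2 * L ^+ 2; pose K3 := alpha ^+ 2 * norm2 (offdiag W) ^+ 2.
have K10 : 0 <= K1 by rewrite divr_ge0 ?sqr_ge0.
have K20 : 0 <= K2 by rewrite mulr_ge0 ?sqr_ge0.
have K30 : 0 <= K3 by rewrite mulr_ge0 ?sqr_ge0.
pose M' := K1 * (k2^-1 * M + K2 * (M + k1^-1 * M) + K3 * sigma2).
have yM k : increment_moment k <= M' / time k `^ (2 * q).
  pose D w := norm2 (B k w) ^+ 2 + K2 * (norm2 (J *m z (x_proc k w)) ^+ 2
    + norm2 (Q *m z (x_proc k w)) ^+ 2) + K3 * b k ^+ 2 * noise_power k w.
  have iJQ : intble P (fun w => norm2 (J *m z (x_proc k w)) ^+ 2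
    + norm2 (Q *m z (x_proc k w)) ^+ 2) by exact: intbleD.
  have iD : intble P D.
    by apply: intbleD; [apply: intbleD => //|]; exact: intbleZ.
  have ED : Ex P D = bm k + K2 * (mean_moment k + disagreement_moment k)
      + K3 * b k ^+ 2 * Ex P (noise_power k).
    rewrite /D ExD; [|by apply: intbleD => //; exact: intbleZ|exact: intbleZ].
    rewrite ExD; [|exact: iB|exact: intbleZ].
    by rewrite (ExZ K2 iJQ) (ExZ _ (intN k)) (ExD (intE k) (intX k)).
  apply: le_trans (Ex_le (intY k) (intbleZ K1 iD) _) _ => [w|].
    rewrite s_procS gE.
    apply: le_trans (increment_bound xs n_gt0 WP L_gt0 alpha_gt0 fP _ _ _ _ (erefl h)) _.
    rewrite ler_wpM2l// /D -/K2 -/K3 -/(B k w) (norm2_split n_gt0 (z _)) lerD2l.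
    by rewrite -mulrA ler_wpM2l// ler_wpM2l ?sqr_ge0// /noise_power lerDl sqr_ge0.
  rewrite ExZ// /M' -mulrA ler_wpM2l// ED.
  have := bM k; have := ler_wpM2l K20 (lerD (mM k) (dM k)).
  have b20 := sqr_ge0 (b k).
  have := ler_wpM2l (mulr_ge0 K30 b20) (noise_power_le k).
  rewrite bE time_powR_sqr; set T := (time k `^ (2 * q))^-1.
  lra.
have M'0 : 0 <= M'.
  have x1 := mulr_ge0 k2i M0; have x2 := mulr_ge0 k1i M0.
  exact: mulr_ge0 K10 (addr_ge0 (addr_ge0 x1 (mulr_ge0 K20 (addr_ge0 M0 x2))) (mulr_ge0 K30 sig0)).
have x2 := mulr_ge0 k1i M0.
exists (M + k1^-1 * M + M'); first by rewrite !addr_ge0.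
move=> k; have T0 : 0 <= (time k `^ (2 * q))^-1 by rewrite invr_ge0 powR_ge0.
split.
- by apply: le_trans (mM k) _; rewrite ler_wpM2r//; lra.
- by apply: le_trans (dM k) _; rewrite ler_wpM2r//; lra.
- by apply: le_trans (yM k) _; rewrite ler_wpM2r//; lra.
Qed.

End ErrorMoments.

Section TrivialDimension.
Context {R : realType}.

Lemma norm2_dim0 n (A : 'M[R]_(n, 0)) : norm2 A = 0.
Proof. by rewrite norm2E ipE big_ord0 sqrtr0. Qed.

End TrivialDimension.

Unset Implicit Arguments.
Set Strict Implicit.
Set Printing Implicit Defensive.

(** * The convergence theorem *)

Theorem theorem1 (d : measure_display) (Omega : measurableType d)
    (R : realType) (P : probability Omega R)
    (n r : nat) (n_gt0 : (0 < n)%N)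
    (f : 'I_n -> 'rV[R]_r -> R) (mu L : R) (mu_gt0 : 0 < mu)
    (fP : forall i, objective_class mu L (f i))
    (xstar : 'rV[R]_r)
    (xstarP : forall x, global_objective f xstar <= global_objective f x)
    (W : 'M[R]_n) (WP : coupling_matrix W)
    (eta xi : nat -> 'I_n -> 'I_r -> {RV P >-> R})
    (sigma_eta sigma_xi : R)
    (sigma_eta_gt0 : 0 < sigma_eta) (sigma_xi_gt0 : 0 < sigma_xi)
    (noiseP : noise_class eta xi sigma_eta sigma_xi)
    (alpha gamma p q : R)
    (alpha_gt0 : 0 < alpha) (gamma_gt0 : 0 < gamma)
    (p_ge0 : 0 <= p) (q_ge0 : 0 <= q) :
  exists2 m : R, 0 < m & forall s0 x0 : 'M[R]_(n, r),
    let gamma_ (k : nat) := gamma / (m + k%:R) `^ p in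
    let beta_ (k : nat) := 1 / (m + k%:R) `^ q in
    let x (k : nat) (w : Omega) := x_iter f W alpha beta_ gamma_ s0 x0
      (fun l => noise_mx eta l w) (fun l => noise_mx xi l w) k in
    let y (k : nat) (w : Omega) := y_iter f W alpha beta_ gamma_ s0 x0
      (fun l => noise_mx eta l w) (fun l => noise_mx xi l w) k in
    let opt_err (k : nat) := 'E_P[fun w => (norm2 (row_mean (x k w) - xstar) ^+ 2)%R]%E in
    let x_err (k : nat) := 'E_P[fun w => (consensus_error (x k w) ^+ 2)%R]%E in
    let y_err (k : nat) := 'E_P[fun w => (consensus_error (y k w) ^+ 2)%R]%E in
    [/\ p = 0 -> 0 < q ->
          ((alpha * gamma)%:E < stepsize_bound W mu L)%E ->
          [/\ exists C : R, forall k, (opt_err k <= (C / (m + k%:R) `^ (2 * q))%:E)%E,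
              exists C : R, forall k, (x_err k <= (C / (m + k%:R) `^ (2 * q))%:E)%E &
              exists C : R, forall k, (y_err k <= (C / (m + k%:R) `^ (2 * q))%:E)%E],
        0 < p -> p <= 1 -> p < q ->
          Num.min (2 * q - p) (2 * p) / mu < alpha * gamma ->
          [/\ exists C : R, forall k,
                (opt_err k <= (C / (m + k%:R) `^ Num.min (2 * q - p) (2 * p))%:E)%E,
              exists C : R, forall k,
                (x_err k <= (C / (m + k%:R) `^ (2 * Num.min q p))%:E)%E &
              exists C : R, forall k,
                (y_err k <= (C / (m + k%:R) `^ (2 * Num.min q p))%:E)%E] &
        1 < p -> p / 2 <= q ->
          [/\ exists C1 C2 : R, forall k,
                (opt_err k <= (C1 + C2 / (m + k%:R) `^ p)%:E)%E,
              exists C : R, forall k,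
                (x_err k <= (C / (m + k%:R) `^ (2 * Num.min q p))%:E)%E &
              exists C : R, forall k,
                (y_err k <= (C / (m + k%:R) `^ (2 * Num.min q p))%:E)%E]].
Proof.
exists 1 => // s0 x0 gamma_ beta_ x y opt_err x_err y_err.
(* in dimension zero [L] may be negative, but all errors vanish *)
have [r0|r_gt0] := posnP r.
  have E0 n' (A : Omega -> 'M[R]_(n', r)) : ('E_P[fun w => (norm2 (A w) ^+ 2)%R] = 0)%E.
    subst r; apply: etrans (expectation_cst P 0); congr expectation.
    by apply/funext => w; rewrite norm2_dim0 expr0n.
  have opt0 k : opt_err k = 0%E by exact: E0.
  have x0' k : x_err k = 0%E by exact: E0.
  have y0 k : y_err k = 0%E by exact: E0.
  have bound0 (e : nat -> \bar R) (s : R) : (forall k, e k = 0%E) ->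
      exists C : R, forall k, (e k <= (C / (1 + k%:R) `^ s)%:E)%E.
    by move=> e0; exists 0 => k; rewrite e0 mul0r.
  split=> *; split; [exact: (bound0 _ _ opt0)|exact: (bound0 _ _ x0')|exact: (bound0 _ _ y0)
    |exact: (bound0 _ _ opt0)|exact: (bound0 _ _ x0')|exact: (bound0 _ _ y0)
    | |exact: (bound0 _ _ x0')|exact: (bound0 _ _ y0)].
  by exists 0, 0 => k; rewrite opt0 mul0r addr0.
have L_gt0 : 0 < L.
  exact: lt_le_trans mu_gt0 (modulus_le_lipschitz (fP (Ordinal n_gt0)) r_gt0).
have xsP := optimality L_gt0 fP n_gt0 xstarP.
have rhoP := rho_w_lt1 n_gt0 WP.
pose E := mean_moment f alpha W xstar eta xi beta_ gamma_ s0 x0.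
pose X := disagreement_moment f alpha W xstar eta xi beta_ gamma_ s0 x0.
pose S := state_moment f alpha W eta xi beta_ gamma_ s0 x0.
pose Y := increment_moment f alpha W eta xi beta_ gamma_ s0 x0.
have optE k : opt_err k = (n%:R^-1 * E k)%:E.
  exact: opt_errE n_gt0 L_gt0 fP noiseP _ _ _ _ k.
have xE k : x_err k = (X k)%:E.
  exact: x_errE n_gt0 L_gt0 fP noiseP _ _ _ _ k.
have yE k : y_err k = (Y k)%:E.
  exact: y_errE L_gt0 fP noiseP _ _ _ _ k.
have n1_ge0 : 0 <= n%:R^-1 :> R by rewrite invr_ge0.
have opt_bound M s : (forall k, E k <= M / (1 + k%:R) `^ s) ->
    exists C : R, forall k, (opt_err k <= (C / (1 + k%:R) `^ s)%:E)%E.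
  move=> h; exists (n%:R^-1 * M) => k.
  by rewrite optE lee_fin -mulrA ler_wpM2l.
have x_bound M s : (forall k, X k <= M / (1 + k%:R) `^ s) ->
    exists C : R, forall k, (x_err k <= (C / (1 + k%:R) `^ s)%:E)%E.
  by move=> h; exists M => k; rewrite xE lee_fin.
have y_bound M s : (forall k, Y k <= M / (1 + k%:R) `^ s) ->
    exists C : R, forall k, (y_err k <= (C / (1 + k%:R) `^ s)%:E)%E.
  by move=> h; exists M => k; rewrite yE lee_fin.
have betaE k : beta_ k = (time k `^ q)^-1 by rewrite /beta_ div1r.
have E_ge0 : forall k, 0 <= E k by exact: mean_moment_ge0.
have X_ge0 : forall k, 0 <= X k by exact: disagreement_moment_ge0.
have S_ge0 : forall k, 0 <= S k by exact: state_moment_ge0.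
split.
- move=> p0 q_gt0 step_small.
  have ag0 : 0 < alpha * gamma by rewrite mulr_gt0.
  have muL := modulus_le_lipschitz (fP (Ordinal n_gt0)) r_gt0.
  have [hL small] := stepsize_condition n_gt0 WP mu_gt0 muL ag0 step_small.
  have gammaE k : gamma_ k = gamma by rewrite /gamma_ p0 powRr0 divr1.
  have [M M0 hM] := geometric_moments n_gt0 WP mu_gt0 L_gt0 alpha_gt0 fP xsP noiseP
    s0 x0 gamma_gt0 q_ge0 gammaE betaE hL small.
  split.
  + by apply: (opt_bound M) => k; have [h _ _] := hM k; exact: h.
  + by apply: (x_bound M) => k; have [_ h _] := hM k; exact: h.
  + by apply: (y_bound M) => k; have [_ _ h] := hM k; exact: h.
all: have [p_gt0|] := ltP 0 p; last by move=> ? *; exfalso; lra.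
all: have gammaE k : gamma_ k = gamma * (time k `^ p)^-1 by [].
all: have tP k : 0 < (@time R k `^ p)^-1 <= 1 by
  rewrite invr_gt0 powR_gt0 ?time_gt0// invf_le1 ?powR_gt0 ?time_gt0//
    -[leLHS](powRr0 (time k)) ler_powR ?time_ge1// ltW.
all: have [C C0 rec] := moment_recursions n_gt0 WP mu_gt0 L_gt0 alpha_gt0 fP xsP noiseP
    beta_ s0 x0 gamma_gt0 gammaE tP.
all: have c_gt0 : 0 < alpha * gamma * mu by rewrite !mulr_gt0.
all: have SP k : S k.+1 <= rho_w W * S k
    + C * ((time k `^ q)^-1 ^+ 2 + (time k `^ p)^-1 ^+ 2 * (E k + X k + 1))
  by rewrite -betaE; have [h _ _ _] := rec k; exact: h.
all: have YP k : Y k <= C * (S k + (time k `^ q)^-1 ^+ 2 + (time k `^ p)^-1 ^+ 2 * (E k + X k + 1))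
  by rewrite -betaE -addrA; have [_ h _ _] := rec k; exact: h.
all: have XP k : X k.+1 <= rho_w W * X k
    + C * (S k + (time k `^ q)^-1 ^+ 2 + (time k `^ p)^-1 ^+ 2 * (E k + X k + 1))
  by rewrite -betaE -(addrA (S k)); have [_ _ h _] := rec k; exact: h.
all: have EP k : E k.+1 <= (1 - alpha * gamma * mu * (time k `^ p)^-1 + C * (time k `^ p)^-1 ^+ 2) * E k
    + C * (time k `^ p)^-1 * X k + C * (time k `^ q)^-1 ^+ 2
  by rewrite -betaE; have [_ _ _ h] := rec k; exact: h.
- move=> _ p1 pq step_large.
  have bounded := bounded_large_step E_ge0 X_ge0 S_ge0 rhoP c_gt0 C0 p_gt0 SP XP EP p1 (ltW pq).
  have [M M0 hM] := consensus_rates X_ge0 S_ge0 rhoP C0 p_gt0 q_ge0 SP YP XP bounded.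
  have sc : Num.min (2 * q - p) (2 * p) < alpha * gamma * mu by rewrite -ltr_pdivrMr.
  have [M' M'0 hM'] := optimality_rate E_ge0 X_ge0 S_ge0 rhoP c_gt0 C0 p_gt0 q_ge0 SP YP XP EP p1 pq sc.
  split; first exact: (opt_bound M').
    by apply: (x_bound M) => k; have [h _] := hM k; exact: h.
  by apply: (y_bound M) => k; have [_ h] := hM k; exact: h.
move=> p1 pq.
have p2 : 1 < 2 * p by lra.
have q2 : 1 < 2 * q by lra.
have bounded := bounded_small_step E_ge0 X_ge0 S_ge0 rhoP c_gt0 C0 p_gt0 SP XP EP p2 q2.
have [M M0 hM] := consensus_rates X_ge0 S_ge0 rhoP C0 p_gt0 q_ge0 SP YP XP bounded.
split.
- have [B B0 hB] := bounded; exists (n%:R^-1 * B), 0 => k.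
  have -> : n%:R^-1 * B + 0 / (1 + k%:R) `^ p = n%:R^-1 * B by rewrite mul0r addr0.
  rewrite optE lee_fin; apply: (ler_wpM2l n1_ge0); apply: le_trans (hB k).
  rewrite -(addrA (E k)) (lerDl (E k)); exact: addr_ge0 (X_ge0 k) ler01.
- by apply: (x_bound M) => k; have [h _] := hM k; exact: h.
- by apply: (y_bound M) => k; have [_ h] := hM k; exact: h.
Qed.
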